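(* Let $M=(\mu_1,\dots,\mu_n)$ have strictly positive integer components, let $m\in\mathbb R$, $\delta\in[0,1]$, and assume $\kappa>[n/\mu_\ast]+1$. Let $a(x,\xi)\in S^m_{M,\delta,\kappa}$ satisfy the localization condition $$\operatorname{supp}a(\cdot,\xi)\subseteq\mathcal K\quad\text{for all }\xi\in\mathbb R^n,$$ for a suitable compact set $\mathcal K\subset\mathbb R^n$. Then for all $p\in[1,+\infty]$ the pseudodifferential operator $a(x,D)$ extends as a linear bounded operator $$a(x,D):\mathcal FL^p_{s+m,M}\rightarrow\mathcal FL^p_{s,M}\quad\text{for all }s\in\mathbb R,\ \text{if }0\le\delta<1,$$ $$a(x,D):\mathcal FL^p_{s+m,M}\rightarrow\mathcal FL^p_{s,M}\quad\text{for all }s>0,\ \text{if }\delta=1.$$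
   Context: $\mathbb Z^n_+$ is the set of multi-indices with nonnegative integer entries. For $M=(\mu_1,\dots,\mu_n)$ put $|\xi|_M=\big(\sum_{j=1}^n|\xi_j|^{2\mu_j}\big)^{1/2}$, $\langle\xi\rangle_M=(1+|\xi|_M^2)^{1/2}$, $\langle\alpha,1/M\rangle=\sum_j\alpha_j/\mu_j$, $\mu_\ast=\min_j\mu_j$. $t_+=\max\{t,0\}$ and $[t]$ is the integer part of $t$. The Fourier transform is $\hat u(\xi)=\int e^{-ix\cdot\xi}u(x)\,dx$. $\mathcal FL^p_{s,M}$ is the Banach space of all $u\in\mathcal S'(\mathbb R^n)$ such that $\hat u$ is a measurable function and $\|u\|_{\mathcal FL^p_{s,M}}:=\|\langle\cdot\rangle_M^s\hat u\|_{L^p}<\infty$. $a(x,D)u(x)=(2\pi)^{-n}\int e^{ix\cdot\xi}a(x,\xi)\hat u(\xi)\,d\xi$ for $u\in\mathcal S(\mathbb R^n)$. For $m\in\mathbb R$, $\delta\in[0,1]$, $\kappa>0$, $S^m_{M,\delta,\kappa}$ is the class of all $a(x,\xi)\in C^\infty(\mathbb R^{2n})$ such that for all $\alpha,\beta\in\mathbb Z^n_+$ there is $C_{\alpha,\beta}>0$ such that for all $x,\xi\in\mathbb R^n$ $$|\partial^\alpha_\xi\partial^\beta_xa(x,\xi)|\le C_{\alpha,\beta}\langle\xi\rangle_M^{m-\langle\alpha,1/M\rangle+\delta(\langle\beta,1/M\rangle-\kappa)_+}\ \text{ if }\langle\beta,1/M\rangle\ne\kappa,$$ $$|\partial^\alpha_\xi\partial^\beta_xa(x,\xi)|\le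 C_{\alpha,\beta}\langle\xi\rangle_M^{m-\langle\alpha,1/M\rangle}\log(1+\langle\xi\rangle_M^\delta)\ \text{ if }\langle\beta,1/M\rangle=\kappa.$$ *)

(* Defs.v *)
From HB Require Import structures.
From mathcomp Require Import all_boot all_order all_algebra.
From mathcomp Require Import all_classical all_reals all_analysis.
From mathcomp Require Import complex.

Set Implicit Arguments.
Unset Strict Implicit.
Unset Printing Implicit Defensive.

Import Order.TTheory GRing.Theory Num.Theory.
Import numFieldNormedType.Exports.

Set Warnings "-redundant-canonical-projection,-projection-no-head-constant".

Local Open Scope ring_scope.
Local Open Scope classical_set_scope.
Local Open Scope complex_scope.

(** R^n is ['rV[R]_n]; the topology is the library's (sup norm) topology on
    matrices. *)

(** The product sigma-algebra on R^n, generated by the coordinates. *)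
Section measurable_rV.
Context (R : realType) (n : nat).

Let coords : 'I_n -> 'rV[R]_n -> R := fun i x => x ord0 i.

Let rV_set0 : g_sigma_preimage coords set0.
Proof. exact: sigma_algebra0. Qed.

Let rV_setC A : g_sigma_preimage coords A -> g_sigma_preimage coords (~` A).
Proof. exact: sigma_algebraC. Qed.

Let rV_bigcup (F : (set 'rV[R]_n)^nat) :
  (forall i, g_sigma_preimage coords (F i)) ->
  g_sigma_preimage coords (\bigcup_i (F i)).
Proof. exact: sigma_algebra_bigcup. Qed.

HB.instance Definition _ := @isMeasurable.Build default_measure_display
  'rV[R]_n (g_sigma_preimage coords) rV_set0 rV_setC rV_bigcup.

End measurable_rV.

Definition rV_cons (R : realType) n (p : R * 'rV[R]_n) : 'rV[R]_n.+1 :=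
  row_mx (const_mx p.1 : 'rV_1) p.2.

Lemma measurable_rV_coord (R : realType) n (i : 'I_n) :
  measurable_fun [set: 'rV[R]_n] (fun x => x ord0 i).
Proof.
move=> _ Y mY; rewrite setTI; apply: sub_sigma_algebra => /=.
rewrite -bigcup_seq/=; exists i => /=; first by rewrite mem_index_enum.
by exists Y => //; rewrite setTI.
Qed.

Lemma measurable_rV_cons (R : realType) n : measurable_fun setT (@rV_cons R n).
Proof.
have gE : @measurable _ 'rV[R]_n.+1 = <<s \big[setU/set0]_(i < n.+1)
    preimage_set_system setT (fun x : 'rV[R]_n.+1 => x ord0 i) measurable >>.
  by [].
apply: (@measurability _ _ _ _ setT (@rV_cons R n) _ gE) => _ [A + <-].
rewrite -bigcup_seq/= => -[i /= _ [B mB <-]].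
rewrite !setTI.
have [j ij|k ik] := split_ordP (i : 'I_(1 + n)).
  have e (p : R * 'rV[R]_n) : rV_cons p ord0 i = p.1.
    by rewrite ij; apply: etrans (row_mxEl _ _ _ _) _; rewrite mxE.
  rewrite (_ : _ @^-1` _ = @fst R 'rV[R]_n @^-1` B).
    by rewrite -[X in measurable X]setTI; exact: measurable_fst.
  by apply/funext => p; rewrite /preimage/= e.
have e (p : R * 'rV[R]_n) : rV_cons p ord0 i = p.2 ord0 k.
  by rewrite ik; exact: row_mxEr.
rewrite (_ : _ @^-1` _ = (fun p : R * 'rV[R]_n => p.2 ord0 k) @^-1` B).
  rewrite -[X in measurable X]setTI.
  exact: (measurableT_comp (measurable_rV_coord k) measurable_snd).
by apply/funext => p; rewrite /preimage/= e.
Qed.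

(** Lebesgue measure on R^n, by recursion: the one on R^{n+1} is the image of
    the product of the measures on R and R^n under the identification
    R x R^n = R^{n+1}. *)
Section lebesgue_rV_step.
Context (R : realType) (n : nat).
Variable nu : {measure set 'rV[R]_n -> \bar R}.

Definition lebesgue_rV_step : set 'rV[R]_n.+1 -> \bar R :=
  pushforward (@lebesgue_measure R \x^ nu)%E (@rV_cons R n).

Let step0 : lebesgue_rV_step set0 = 0%E.
Proof. by rewrite /lebesgue_rV_step /pushforward preimage_set0 measure0. Qed.

Let step_ge0 A : (0 <= lebesgue_rV_step A)%E.
Proof. exact: integral_ge0. Qed.

Let step_sigma_additive : semi_sigma_additive lebesgue_rV_step.
Proof.
move=> F mF tF mUF; rewrite /lebesgue_rV_step /pushforward preimage_bigcup.
have mpre A : measurable A -> measurable (@rV_cons R n @^-1` A).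
  by move=> mA; rewrite -[X in measurable X]setTI; exact: measurable_rV_cons.
apply: measure_semi_sigma_additive.
- by move=> k; exact: mpre.
- apply/trivIsetP => /= i j _ _ ij; rewrite -preimage_setI.
  by move/trivIsetP : tF => /(_ _ _ _ _ ij) ->//; rewrite preimage_set0.
- by rewrite -preimage_bigcup; exact: mpre.
Qed.

HB.instance Definition _ := isMeasure.Build _ _ _
  lebesgue_rV_step step0 step_ge0 step_sigma_additive.

End lebesgue_rV_step.

Fixpoint lebesgue_rV (R : realType) n : {measure set 'rV[R]_n -> \bar R} :=
  match n with
  | 0 => \d_(0 : 'rV[R]_0)
  | k.+1 => lebesgue_rV_step (lebesgue_rV R k)
  end.

(** A multi-index is a function ['I_n -> nat]. *)
Section derivatives.
Context (R : realType) (n : nat).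
Implicit Types (f g : 'rV[R]_n -> R) (s : seq 'I_n) (al : 'I_n -> nat).

Definition pderiv (j : 'I_n) f : 'rV[R]_n -> R :=
  fun x => 'D_(delta_mx ord0 j) f x.

Definition iter_pderiv s f : 'rV[R]_n -> R := foldr pderiv f s.

(** C^oo: the iterated partial derivatives of all orders exist and are
    continuous. *)
Definition smooth f := forall s,
  continuous (iter_pderiv s f) /\
  forall j x, derivable (iter_pderiv s f) x (delta_mx ord0 j).

(** The list with [al j] occurrences of each index [j]. *)
Definition mseq al : seq 'I_n := flatten [seq nseq (al j) j | j <- enum 'I_n].

Definition mderiv al f : 'rV[R]_n -> R := iter_pderiv (mseq al) f.

Definition csmooth (f : 'rV[R]_n -> R[i]) :=
  smooth (fun x => complex.Re (f x)) /\ smooth (fun x => complex.Im (f x)).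

Definition cmderiv al (f : 'rV[R]_n -> R[i]) : 'rV[R]_n -> R[i] := fun x =>
  mderiv al (fun y => complex.Re (f y)) x +i*
  mderiv al (fun y => complex.Im (f y)) x.

Definition monom al (x : 'rV[R]_n) : R := \prod_(j < n) x ord0 j ^+ al j.

Lemma iter_pderiv_lin (a b : R) f g s : smooth f -> smooth g ->
  iter_pderiv s (fun x => a * f x + b * g x) =
  (fun x => a * iter_pderiv s f x + b * iter_pderiv s g x).
Proof.
move=> sf sg; elim: s => [//|j s IH] /=.
rewrite /iter_pderiv/= -!/(iter_pderiv _ _) IH; apply/funext => x.
have df := (sf s).2 j x; have dg := (sg s).2 j x.
rewrite /pderiv.
have -> : (fun y => a * iter_pderiv s f y + b * iter_pderiv s g y) =
  (a \*: (iter_pderiv s f : 'rV[R]_n -> R^o)) +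
  (b \*: (iter_pderiv s g : 'rV[R]_n -> R^o)) by [].
by rewrite deriveD ?deriveZ//; exact: derivableZ.
Qed.

Lemma smooth_lin (a b : R) f g : smooth f -> smooth g ->
  smooth (fun x => a * f x + b * g x).
Proof.
move=> sf sg s; rewrite iter_pderiv_lin//; split=> [x|j x].
  have cf := (sf s).1 x; have cg := (sg s).1 x.
  have cM (k : R) (h : 'rV[R]_n -> R) : {for x, continuous h} ->
      {for x, continuous (fun y => k * h y)}.
    move=> ch; apply: (@continuousM _ _ (cst k) h) => //; exact: cst_continuous.
  exact: continuousD (cM a _ cf) (cM b _ cg).
have df := (sf s).2 j x; have dg := (sg s).2 j x.
have -> : (fun y => a * iter_pderiv s f y + b * iter_pderiv s g y) =
  (a \*: (iter_pderiv s f : 'rV[R]_n -> R^o)) +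
  (b \*: (iter_pderiv s g : 'rV[R]_n -> R^o)) by [].
by apply: derivableD; exact: derivableZ.
Qed.

End derivatives.

(** [normc z : R] is the modulus of [z : R[i]]. *)
Notation normc := ComplexField.Normc.normc.

Section schwartz.
Context (R : realType) (n : nat).

Definition is_schwartz (f : 'rV[R]_n -> R[i]) :=
  csmooth f /\
  forall al be : 'I_n -> nat, exists C : R,
    forall x, `|monom al x| * normc (cmderiv be f x) <= C.

Definition schwartz_pred : {pred 'rV[R]_n -> R[i]} := [pred f | `[< is_schwartz f >]].

Let ReE (c : R[i]) (f g : 'rV[R]_n -> R[i]) :
  (fun x => complex.Re ((c *: f + g) x)) = (fun x =>
    1 * (complex.Re c * complex.Re (f x) + - complex.Im c * complex.Im (f x)) +
    1 * complex.Re (g x)).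
Proof.
apply/funext => x; rewrite fctE /GRing.scale/=.
by case: c (f x) (g x) => [a b] [u v] [w z] /=; rewrite !mul1r mulNr.
Qed.

Let ImE (c : R[i]) (f g : 'rV[R]_n -> R[i]) :
  (fun x => complex.Im ((c *: f + g) x)) = (fun x =>
    1 * (complex.Re c * complex.Im (f x) + complex.Im c * complex.Re (f x)) +
    1 * complex.Im (g x)).
Proof.
apply/funext => x; rewrite fctE /GRing.scale/=.
by case: c (f x) (g x) => [a b] [u v] [w z] /=; rewrite !mul1r.
Qed.

Lemma csmooth_lin (c : R[i]) (f g : 'rV[R]_n -> R[i]) :
  csmooth f -> csmooth g -> csmooth (c *: f + g).
Proof.
move=> [f1 f2] [g1 g2]; split; rewrite ?ReE ?ImE.
  by do 2 (apply: smooth_lin => //).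
by do 2 (apply: smooth_lin => //).
Qed.

Lemma cmderiv_lin (c : R[i]) (f g : 'rV[R]_n -> R[i]) al :
  csmooth f -> csmooth g ->
  cmderiv al (c *: f + g) = c *: cmderiv al f + cmderiv al g.
Proof.
move=> [f1 f2] [g1 g2]; apply/funext => x.
rewrite fctE /GRing.scale/= /cmderiv ReE ImE /mderiv.
rewrite !iter_pderiv_lin//; do ?exact: smooth_lin.
by case: c => a b /=; rewrite !mul1r mulNr.
Qed.

Let iter_pderiv0 (s : seq 'I_n) :
  iter_pderiv s (cst 0 : 'rV[R]_n -> R) = cst 0.
Proof.
elim: s => [//|j s /= ->]; apply/funext => x.
by rewrite /pderiv; exact: derive_cst.
Qed.

Let smooth0 : smooth (cst 0 : 'rV[R]_n -> R).
Proof.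
move=> s; rewrite iter_pderiv0; split=> [x|j x]; first exact: cst_continuous.
exact: derivable_cst.
Qed.

Lemma is_schwartz0 : is_schwartz 0.
Proof.
split=> [|al be]; first by split; exact: smooth0.
exists 0 => x; rewrite /cmderiv/= /mderiv !iter_pderiv0 /=.
by rewrite expr0n/= addr0 sqrtr0 mulr0.
Qed.

Lemma schwartz_submod_closed : submod_closed schwartz_pred.
Proof.
split=> [|c f g]; first by rewrite inE; exact: is_schwartz0.
rewrite !inE => -[sf bf] [sg bg]; split=> [|al be]; first exact: csmooth_lin.
have [C HC] := bf al be; have [D HD] := bg al be.
exists (normc c * C + D) => x; rewrite cmderiv_lin// fctE.
apply: (@le_trans _ _
  (`|monom al x| * (normc c * normc (cmderiv be f x) + normc (cmderiv be g x)))).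
  apply: ler_wpM2l => //; apply: le_trans (le_normcD _ _) _.
  by rewrite lerD2r -ComplexField.Normc.normcM.
rewrite mulrDr; apply: lerD => //.
rewrite mulrCA; apply: ler_wpM2l => //.
by case: (c) => a b /=; exact: sqrtr_ge0.
Qed.

HB.instance Definition _ := GRing.isSubmodClosed.Build _ _ schwartz_pred
  schwartz_submod_closed.

Record schwartz := Schwartz {
  schwartz_fun :> 'rV[R]_n -> R[i] ;
  schwartz_funP : schwartz_fun \in schwartz_pred }.

HB.instance Definition _ := [isSub for schwartz_fun].
HB.instance Definition _ := [Choice of schwartz by <:].
HB.instance Definition _ := [SubChoice_isSubLmodule of schwartz by <:].

Definition seminorm (al be : 'I_n -> nat) (f : schwartz) : R :=
  sup [set `|monom al x| * normc (cmderiv be f x) | x in setT].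

Lemma seminorm_ge0 al be f : 0 <= seminorm al be f.
Proof.
rewrite /seminorm; case: (pselect (has_sup
  [set `|monom al x| * normc (cmderiv be f x) | x in [set: 'rV[R]_n]])).
  move=> [_ ub]; apply: le_trans (ub_le_sup ub _); last by exists 0.
  rewrite mulr_ge0//.
  by case: (cmderiv be f 0) => a b /=; exact: sqrtr_ge0.
by move/sup_out => ->.
Qed.

End schwartz.

(** The space S'(R^n) of tempered distributions: linear functionals on S(R^n)
    which are continuous, i.e. bounded by finitely many of the seminorms that
    define the topology of S(R^n). *)
Section tempered.
Context (R : realType) (n : nat).

Definition is_tempered (u : schwartz R n -> R[i]) :=
  linear u /\
  exists (C : R) (s : seq (('I_n -> nat) * ('I_n -> nat))),
    forall f, normc (u f) <= C * \sum_(p <- s) seminorm p.1 p.2 f.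

Definition tempered_pred : {pred schwartz R n -> R[i]} :=
  [pred u | `[< is_tempered u >]].

Lemma tempered_submod_closed : submod_closed tempered_pred.
Proof.
split=> [|c u v].
  rewrite inE; split=> [k f g|]; first by rewrite /= scaler0 addr0.
  by exists 0, [::] => f; rewrite /= expr0n/= addr0 sqrtr0 mul0r.
rewrite !inE => -[lu [C [s Hs]]] [lv [D [t Ht]]]; split=> [k f g|].
  rewrite !fctE lu lv !scalerDr addrACA; congr (_ + _ + _).
  by rewrite !scalerA mulrC.
exists (normc c * `|C| + `|D|), (s ++ t) => f; rewrite fctE big_cat/=.
have nc : 0 <= normc c by case: (c) => a b /=; exact: sqrtr_ge0.
have ss (r : seq (('I_n -> nat) * ('I_n -> nat))) :
    0 <= \sum_(p <- r) seminorm p.1 p.2 f.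
  by apply: sumr_ge0 => p _; exact: seminorm_ge0.
apply: le_trans (le_normcD _ _) _.
rewrite (_ : (c *: u) f = c * u f)// ComplexField.Normc.normcM mulrDl.
apply: lerD.
  rewrite -mulrA ler_wpM2l//; apply: le_trans (Hs f) _.
  by rewrite mulrDr (le_trans (ler_wpM2r _ (ler_norm _)))// lerDl mulr_ge0.
rewrite mulrDr; apply: le_trans (Ht f) _.
by rewrite (le_trans (ler_wpM2r _ (ler_norm _)))// lerDr mulr_ge0.
Qed.

HB.instance Definition _ := GRing.isSubmodClosed.Build _ _ tempered_pred
  tempered_submod_closed.

Record tempered := Tempered {
  tempered_fun :> schwartz R n -> R[i] ;
  tempered_funP : tempered_fun \in tempered_pred }.

HB.instance Definition _ := [isSub for tempered_fun].
HB.instance Definition _ := [Choice of tempered by <:].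
HB.instance Definition _ := [SubChoice_isSubLmodule of tempered by <:].

End tempered.

Section fourier.
Context (R : realType) (n : nat).
Implicit Types (f : 'rV[R]_n -> R[i]) (u : tempered R n).

Definition dot (x xi : 'rV[R]_n) : R := \sum_(j < n) x ord0 j * xi ord0 j.

Definition expi (t : R) : R[i] := cos t +i* sin t.

Definition cint f : R[i] :=
  (\int[lebesgue_rV R n]_x complex.Re (f x)) +i*
  (\int[lebesgue_rV R n]_x complex.Im (f x)).

Definition fourier f : 'rV[R]_n -> R[i] :=
  fun xi => cint (fun x => expi (- dot x xi) * f x).

(** The Fourier transform on S(R^n).  It maps S(R^n) into itself, so that the
    default value of [insubd] is never used. *)
Definition schwartz_fourier (phi : schwartz R n) : schwartz R n :=
  insubd (0 : schwartz R n) (fourier phi).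

(** The Fourier transform on S'(R^n), by duality. *)
Definition tempered_fourier u : schwartz R n -> R[i] :=
  fun phi => u (schwartz_fourier phi).

(** [v] is the functional [phi |-> \int f phi] given by a measurable function
    [f]; integrability is required since [Rintegral] is total. *)
Definition is_function (v : schwartz R n -> R[i]) f :=
  [/\ measurable_fun setT (fun x => complex.Re (f x)),
      measurable_fun setT (fun x => complex.Im (f x)) &
      forall phi : schwartz R n,
        (lebesgue_rV R n).-integrable setT
          (fun x => (normc (f x * phi x))%:E) /\
        v phi = cint (fun x => f x * phi x)].

(** The function \hat u, when there is one; it is unique up to a null set. *)
Definition fourier_fun u : 'rV[R]_n -> R[i] :=
  xget (cst 0) [set f | is_function (tempered_fourier u) f].

End fourier.

Section weights.
Context (R : realType) (n : nat) (mu : 'I_n -> nat).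

Definition Mnorm (xi : 'rV[R]_n) : R :=
  Num.sqrt (\sum_(j < n) `|xi ord0 j| ^+ (2 * mu j)%N).

Definition Mbracket (xi : 'rV[R]_n) : R := Num.sqrt (1 + Mnorm xi ^+ 2).

Definition Mweight (al : 'I_n -> nat) : R := \sum_(j < n) (al j)%:R / (mu j)%:R.

(** min_j mu_j: for n > 0 the neutral element max_j mu_j plays no role. *)
Definition Mmin : nat := (\big[minn/(\max_(j < n) mu j)]_(j < n) mu j)%N.

(** The norm of FL^p_{s,M}, meaningful when \hat u is a function. *)
Definition FLnorm (p : \bar R) (s : R) (u : tempered R n) : \bar R :=
  Lnorm (lebesgue_rV R n) p
    (fun xi => (Mbracket xi `^ s * normc (fourier_fun u xi))%:E).

Definition FL (p : \bar R) (s : R) : set (tempered R n) :=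
  [set u | (exists f, is_function (tempered_fourier u) f) /\
           (FLnorm p s u < +oo)%E].

Definition symbol_class (m delta kappa : R)
    (a : 'rV[R]_n -> 'rV[R]_n -> R[i]) :=
  csmooth (fun z : 'rV[R]_(n + n) => a (lsubmx z) (rsubmx z)) /\
  forall al be : 'I_n -> nat, exists2 C : R, 0 < C &
    forall x xi : 'rV[R]_n,
      let d := cmderiv al (fun eta => cmderiv be (fun y => a y eta) x) xi in
      (Mweight be != kappa -> normc d <=
         C * Mbracket xi `^
           (m - Mweight al + delta * Num.max (Mweight be - kappa) 0)) /\
      (Mweight be = kappa -> normc d <=
         C * (Mbracket xi `^ (m - Mweight al) *
              ln (1 + Mbracket xi `^ delta))).

(** The operator [A], defined on S(R^n), extends to a bounded linear operator
    from FL^p_{s1,M} to FL^p_{s2,M}.  [T] is only relevant on FL^p_{s1,M}. *)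
Definition extends_bounded (A : schwartz R n -> 'rV[R]_n -> R[i])
    (p : \bar R) (s1 s2 : R) :=
  exists T : tempered R n -> tempered R n,
  [/\ forall (c : R[i]) u v, FL p s1 u -> FL p s1 v ->
        T (c *: u + v) = c *: T u + T v,
      exists C : R, forall u, FL p s1 u ->
        FL p s2 (T u) /\ (FLnorm p s2 (T u) <= C%:E * FLnorm p s1 u)%E &
      forall (f : schwartz R n) (u : tempered R n),
        is_function u f -> is_function (T u) (A f)].

End weights.

Definition psido (R : realType) n (a : 'rV[R]_n -> 'rV[R]_n -> R[i])
    (u : schwartz R n) : 'rV[R]_n -> R[i] :=
  fun x => ((2 * pi) ^- n)%:C *
    cint (fun xi => expi (dot x xi) * a x xi * fourier u xi).

(* Main.v *)
Require Import Defs.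
From HB Require Import structures.
From mathcomp Require Import all_boot all_order all_algebra.
From mathcomp Require Import all_classical all_reals all_analysis.
From mathcomp Require Import measurable_realfun ess_sup_inf complex ring lra.
Import Order.TTheory GRing.Theory Num.Theory.
Import numFieldNormedType.Exports.
Set Implicit Arguments.
Unset Strict Implicit.
Unset Printing Implicit Defensive.
Local Open Scope ring_scope.
Local Open Scope classical_set_scope.
Local Open Scope complex_scope.

(** Let A(zeta, xi) be the Fourier transform of a(., xi) at zeta, which exists
    since a(., xi) has compact support.  On the Fourier side the operator is
    the integral operator g(eta) = (2 pi)^-n int A(eta - xi, xi) u^(xi) dxi.
    Integrating by parts N mu_j times in x_j gives
      |A(zeta, xi)| <= C <zeta>^-N <xi>^(m + delta (N - kappa)),  N >= kappa + 1,
      |A(zeta, xi)| <= C <zeta>^-N0 <xi>^m,  N0 = [n / mu_*] + 1 < kappa.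
    Using the second bound where zeta is not larger than xi (or eta), and the
    first one with N large elsewhere, one gets, for delta < 1 or s > 0,
      <eta>^s |A(eta - xi, xi)| <= C <xi>^(s + m) w(eta - xi),
    where w is a product of integrable powers of 1 + |zeta_j|; here
    N0 mu_* > n is used.  Schur's test then gives the L^p bound.

    To avoid Fourier inversion the extension is defined by duality:
    <T u, phi> = (2 pi)^-n int u^(xi) A_phi(xi) dxi, where A_phi(xi) is the
    integral of exp(i x.xi) a(x, xi) phi(x).  By Fubini's theorem the Fourier
    transform of T u is g, and T agrees with a(x, D) on S(R^n).  The norm of
    FL^p_{s,M} involves a chosen representative of u^, so one also needs that
    a function is determined a.e. by its integrals against S(R^n). *)

(** The trade between decay in zeta and powers of <xi> separates the two cases. With e = m + delta
    (N - kappa), the region where zeta dominates leaves the exponent e - N + N0 on <xi>, which must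
    not exceed m + min(s, 0); that is, delta (N - kappa) + N0 <= N + min(s, 0). For delta < 1 a
    large N achieves this for every s. For delta = 1 the order N cancels: the gain is capped at
    kappa - N0, however often one integrates by parts, and N0 < kappa is just what s > 0 asks for.

    Only derivatives in a single variable x_j occur, since <zeta>^N is at most a constant times 1 +
    sum_j |zeta_j|^(N mu_j). A derivative of order l in x_j has weight l / mu_j, so N mu_j
    integrations by parts stay within weight N.

    The kernel bound does not involve p. As w is integrable and bounded by 1, one weighted L^1
    condition on u^ holds for all p at once and makes the duality integral converge absolutely.

    Partial derivatives being defined on real functions, the Fourier transform is differentiated and
    estimated through its real and imaginary parts, both of which have the same form. *)

Lemma eqW d (T : porderType d) (x y : T) : x = y -> (x <= y)%O.
Proof. by move=> ->. Qed.

(** * Measurability and integration on R^n *)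

Section measurability_rV.
Context (R : realType).

Lemma measurable_fun_rV n d (T : measurableType d) (f : T -> 'rV[R]_n) :
  (forall i, measurable_fun setT (fun x => f x ord0 i)) -> measurable_fun setT f.
Proof.
move=> mf.
have gE : @measurable _ 'rV[R]_n = <<s \big[setU/set0]_(i < n)
    preimage_set_system setT (fun x : 'rV[R]_n => x ord0 i) measurable >> by [].
apply: (@measurability _ _ _ _ setT f _ gE) => _ [A + <-].
rewrite -bigcup_seq/= => -[i /= _ [B mB <-]].
rewrite !setTI.
by rewrite -[X in measurable X]setTI; exact: (mf i _ B mB).
Qed.

Lemma measurable_rV_itv n (i : 'I_n) (I : interval R) :
  measurable [set x : 'rV[R]_n | x ord0 i \in I].
Proof.
have mI : measurable ([set` I] : set R) by exact: measurable_itv.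
by have := measurable_rV_coord i measurableT mI; rewrite setTI.
Qed.

Lemma continuous_coord n (i : 'I_n) : continuous (fun x : 'rV[R]_n => x ord0 i).
Proof. exact: coord_continuous. Qed.

Definition grid_rV n (k : nat) (x : 'rV[R]_n) : 'rV[int]_n :=
  \row_i Num.floor (x ord0 i * k.+1%:R).

Definition grid_point n (k : nat) (z : 'rV[int]_n) : 'rV[R]_n :=
  \row_i ((z ord0 i)%:~R / k.+1%:R).

(** The sigma-algebra is the product one, the topology that of the sup norm, so they have to be
    related. [f] is the pointwise limit of its values at points rounded to the grid of mesh
    [1 / (k + 1)], and a rounded function is constant on each of countably many boxes. *)
Lemma continuous_measurable_rV n (f : 'rV[R]_n -> R) :
  continuous f -> measurable_fun setT f.
Proof.
move=> cf.
have gc (x : 'rV[R]_n) : grid_point k (grid_rV k x) @[k --> \oo] --> x.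
  apply/cvg_ballP => e e0.
  have [N HN] : exists N, N.+1%:R^-1 < e :> R.
    have := @near_infty_natSinv_lt R (PosNum e0).
    by case=> N _ HN; exists N; apply: HN => /=.
  exists N => //= k /= Nk; split=> // i j.
  rewrite !mxE (ord1 i) /ball/= .
  have k0 : 0 < k.+1%:R :> R by [].
  rewrite -[X in `|X - _|](mulfK (lt0r_neq0 k0)) -mulrBl normrM normfV.
  rewrite (gtr0_norm k0) ltr_pdivrMr//.
  have /andP[h1 h2] := floor_itv (x ord0 j * k.+1%:R).
  have : N.+1%:R^-1 * k.+1%:R < e * k.+1%:R by rewrite ltr_pM2r.
  have : 1 <= N.+1%:R^-1 * k.+1%:R :> R.
    by rewrite mulrC ler_pdivlMr ?mul1r ?ler_nat.
  rewrite ger0_norm ?subr_ge0//.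
  move=> h3 h4; rewrite intrD in h2.
  rewrite ltrBlDl; apply: (lt_trans h2); rewrite ltrD2l.
  exact: le_lt_trans h3 h4.
apply: (@measurable_fun_cvg _ _ _ _ (fun k x => f (grid_point k (grid_rV k x)))).
  move=> k _ Y mY; rewrite setTI.
  rewrite (_ : _ @^-1` _ = \bigcup_(z : 'rV[int]_n)
     ((@grid_rV n k @^-1` [set z]) `&` [set _ | Y (f (grid_point k z))])).
    apply: (@countable_bigcupT_measurable _ _ 'rV[int]_n) => [|z].
      exact: countableP.
    apply: measurableI; last first.
      have [h|h] := pselect (Y (f (grid_point k z))).
        by rewrite (_ : [set _ | _] = setT)//; apply/seteqP; split.
      by rewrite (_ : [set _ | _] = set0)//; apply/seteqP; split.
    rewrite (_ : _ @^-1` _ = \big[setI/setT]_(i < n)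
      ((fun x : 'rV[R]_n => Num.floor (x ord0 i * k.+1%:R)) @^-1` [set z ord0 i])).
      apply: bigsetI_measurable => i _.
      rewrite (_ : _ @^-1` _ = [set x : 'rV[R]_n | x ord0 i \in
         `[(z ord0 i)%:~R / k.+1%:R, (z ord0 i + 1)%:~R / k.+1%:R[%R]).
        exact: measurable_rV_itv.
      apply/seteqP; split=> x /=; rewrite in_itv/= ler_pdivrMr// ltr_pdivlMr//.
        by move=> <-; exact: floor_itv.
      by move=> h; exact: floor_def.
    rewrite -bigcap_seq; apply/seteqP; split=> x /=.
      by move=> <- i _ /=; rewrite mxE.
    by move=> h; apply/rowP => i; rewrite mxE; apply: h => /=; rewrite mem_index_enum.
  apply/seteqP; split=> x /=; first by move=> Yx; exists (grid_rV k x).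
  by move=> [z _ [/= <-]].
by move=> x _; apply: (cvg_trans _ (cf x)); apply: (cvg_app f (gc x)).
Unshelve. all: end_near. Qed.

Lemma measurable_row_mx n p d (T : measurableType d) (f : T -> 'rV[R]_n)
    (g : T -> 'rV[R]_p) : measurable_fun setT f -> measurable_fun setT g ->
  measurable_fun setT (fun x => row_mx (f x) (g x)).
Proof.
move=> mf mg; apply: measurable_fun_rV => i.
have [j ij|k ik] := split_ordP i.
  rewrite (_ : (fun x => _) = (fun x => f x ord0 j)).
    exact: (measurableT_comp (measurable_rV_coord j) mf).
  by apply/funext => x; rewrite ij row_mxEl.
rewrite (_ : (fun x => _) = (fun x => g x ord0 k)).
  exact: (measurableT_comp (measurable_rV_coord k) mg).
by apply/funext => x; rewrite ik row_mxEr.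
Qed.

Lemma continuous_measurable_rV2 n p (f : 'rV[R]_n -> 'rV[R]_p -> R) :
  continuous (fun z : 'rV[R]_(n + p) => f (lsubmx z) (rsubmx z)) ->
  measurable_fun setT (fun z : 'rV[R]_n * 'rV[R]_p => f z.1 z.2).
Proof.
move=> cf; rewrite (_ : (fun z => _) = (fun z : 'rV[R]_(n + p) =>
   f (lsubmx z) (rsubmx z)) \o (fun z : 'rV[R]_n * 'rV[R]_p => row_mx z.1 z.2)).
  apply: measurableT_comp; first exact: continuous_measurable_rV.
  exact: measurable_row_mx measurable_fst measurable_snd.
by apply/funext => z /=; rewrite row_mxKl row_mxKr.
Qed.

Lemma measurable_rVD n d (T : measurableType d) (f g : T -> 'rV[R]_n) :
  measurable_fun setT f -> measurable_fun setT g ->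
  measurable_fun setT (fun x => f x + g x).
Proof.
move=> mf mg; apply: measurable_fun_rV => i; under eq_fun do rewrite mxE.
apply: measurable_funD.
  exact: (measurableT_comp (measurable_rV_coord i) mf).
exact: (measurableT_comp (measurable_rV_coord i) mg).
Qed.

Lemma measurable_rVN n d (T : measurableType d) (f : T -> 'rV[R]_n) :
  measurable_fun setT f -> measurable_fun setT (fun x => - f x).
Proof.
move=> mf; apply: measurable_fun_rV => i; under eq_fun do rewrite mxE.
apply: measurableT_comp => //.
exact: (measurableT_comp (measurable_rV_coord i) mf).
Qed.

Lemma measurable_dot n d (T : measurableType d) (f g : T -> 'rV[R]_n) :
  measurable_fun setT f -> measurable_fun setT g ->
  measurable_fun setT (fun x => dot (f x) (g x)).
Proof.
move=> mf mg; apply: measurable_sum => i; apply: measurable_funM.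
  exact: (measurableT_comp (measurable_rV_coord i) mf).
exact: (measurableT_comp (measurable_rV_coord i) mg).
Qed.
End measurability_rV.

(** * Sigma-finiteness, Tonelli's and Fubini's theorems on R^n *)

Section lebesgue_rV_theory.
Context (R : realType).
Local Notation lam n := (lebesgue_rV R n).

Definition cube n (k : nat) : set 'rV[R]_n :=
  [set x | forall i, x ord0 i \in `](- k%:R), k%:R]%R].

Lemma measurable_cube n k : measurable (@cube n k).
Proof.
rewrite (_ : cube k = \big[setI/setT]_(i < n)
    [set x : 'rV[R]_n | x ord0 i \in `](- k%:R), k%:R]%R]).
  apply: bigsetI_measurable => i _.
  exact: measurable_rV_itv.
rewrite -bigcap_seq; apply/seteqP; split=> x /= h => [i _|i]; first exact: h.
by apply: h => /=; rewrite mem_index_enum.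
Qed.

Lemma rV_cons0 n (t : R) (y : 'rV[R]_n) : rV_cons (t, y) ord0 ord0 = t.
Proof.
have -> : ord0 = lshift n ord0 :> 'I_(1 + n) by exact: val_inj.
by apply: etrans (row_mxEl _ _ _ _) _; rewrite mxE.
Qed.

Lemma rV_consS n (t : R) (y : 'rV[R]_n) i :
  rV_cons (t, y) ord0 (lift ord0 i) = y ord0 i.
Proof.
have -> : lift ord0 i = rshift 1 i :> 'I_(1 + n) by exact: val_inj.
exact: row_mxEr.
Qed.

Lemma cube_cons n k : @rV_cons R n @^-1` (cube k) =
  [set` `](- k%:R), k%:R]%R] `*` cube k.
Proof.
apply/seteqP; split=> -[t y] /=.
  move=> h; split=> [|i] /=; first by have := h ord0; rewrite rV_cons0.
  by have := h (lift ord0 i); rewrite rV_consS.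
move=> [ht hy] i; have [j ->|->] := unliftP ord0 i.
by rewrite rV_consS; exact: hy.
by rewrite rV_cons0.
Qed.

Lemma lebesgue_cube n k : (lam n (cube k) < +oo)%E.
Proof.
elim: n => [|n IH]; first by rewrite /= diracE ltry.
rewrite /= /lebesgue_rV_step /pushforward cube_cons.
rewrite product_measure2E//; last exact: measurable_cube.
have h : (@lebesgue_measure R [set` `](- k%:R), k%:R]%R] < +oo)%E.
  by rewrite lebesgue_measure_itv/=; case: ifPn => _; rewrite ?ltry// -EFinB ltry.
by rewrite lte_mul_pinfty// ge0_fin_numE.
Qed.

Lemma sigma_finite_lebesgue_rV n : sigma_finite setT (lam n).
Proof.
exists (@cube n) => [|k]; last by split; [exact: measurable_cube|exact: lebesgue_cube].
apply/esym/seteqP; split=> // x _.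
exists (\max_(i < n) (Num.truncn `|x ord0 i|).+1)%N => // i /=.
rewrite in_itv/=.
have : `|x ord0 i| < (\max_(i < n) (Num.truncn `|x ord0 i|).+1)%:R.
  apply: lt_le_trans (truncnS_gt _) _.
  rewrite ler_nat.
  pose F (i : 'I_n) := (Num.truncn `|x ord0 i|).+1; exact: (@leq_bigmax _ F i).
by rewrite ltr_norml => /andP[-> /ltW ->].
Qed.

(** Lebesgue measure under a name of its own, to which sigma-finiteness can be attached so that the
    theorems on products of sigma-finite measures apply. *)
Definition lebesgue_rV_fun n : set 'rV[R]_n -> \bar R := lam n.
Arguments lebesgue_rV_fun : clear implicits.
HB.instance Definition _ n :=
  Measure.copy (lebesgue_rV_fun n) (Measure.sort (lam n)).
HB.instance Definition _ n := Measure_isSigmaFinite.Build _ _ _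
  (lebesgue_rV_fun n) (sigma_finite_lebesgue_rV n).
Definition lebesgue_rV_sf n : {sigma_finite_measure set 'rV[R]_n -> \bar R} :=
  lebesgue_rV_fun n.

Lemma measurable_Tonelli_rV n d (T : measurableType d) (f : T -> 'rV[R]_n -> \bar R) :
  measurable_fun setT (fun z : T * 'rV[R]_n => f z.1 z.2) ->
  (forall x y, 0 <= f x y)%E ->
  measurable_fun setT (fun x => \int[lam n]_y f x y)%E.
Proof.
move=> mf f0.
exact: (@measurable_fun_fubini_tonelli_F _ _ _ _ _ (lebesgue_rV_sf n) (fun z => f z.1 z.2)).
Qed.

Lemma Tonelli_rV n p (f : 'rV[R]_n -> 'rV[R]_p -> \bar R) :
  measurable_fun setT (fun z : 'rV[R]_n * 'rV[R]_p => f z.1 z.2) ->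
  (forall x y, 0 <= f x y)%E ->
  (\int[lam n]_x \int[lam p]_y f x y = \int[lam p]_y \int[lam n]_x f x y)%E.
Proof.
move=> mf f0.
exact: (@fubini_tonelli _ _ _ _ _ (lebesgue_rV_sf n) (lebesgue_rV_sf p) (fun z => f z.1 z.2)).
Qed.

Lemma Fubini_rV n p (f : 'rV[R]_n -> 'rV[R]_p -> \bar R) :
  measurable_fun setT (fun z : 'rV[R]_n * 'rV[R]_p => f z.1 z.2) ->
  (\int[lam n]_x \int[lam p]_y `|f x y| < +oo)%E ->
  (\int[lam n]_x \int[lam p]_y f x y = \int[lam p]_y \int[lam n]_x f x y)%E.
Proof.
move=> mf f0.
apply: (@Fubini _ _ _ _ _ (lebesgue_rV_sf n) (lebesgue_rV_sf p) (fun z => f z.1 z.2)).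
exact/integrable12ltyP.
Qed.

Lemma ge0_integral_rVS n (f : 'rV[R]_n.+1 -> \bar R) :
  measurable_fun setT f -> (forall x, 0 <= f x)%E ->
  (\int[lam n.+1]_x f x =
   \int[lam n]_y \int[@lebesgue_measure R]_t f (rV_cons (t, y)))%E.
Proof.
move=> mf f0.
have mfc : measurable_fun setT (fun z : R * 'rV[R]_n => f (rV_cons z)).
  exact: (measurableT_comp mf (@measurable_rV_cons R n)).
transitivity (\int[(@lebesgue_measure R \x^ lam n)%E]_z (f \o @rV_cons R n) z)%E.
  pose m : {measure set (measurableTypeR R * 'rV[R]_n) -> \bar R} :=
    (@lebesgue_measure R \x^ lam n)%E.
  have := @ge0_integral_pushforward _ _ (measurableTypeR R * 'rV[R]_n)%type _ R
    (@rV_cons R n) (@measurable_rV_cons R n) m setT f measurableT mf (fun x _ => f0 x).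
  rewrite preimage_setT => <-.
  by [].
(* [\x^] builds the product measure by integrating in the other order. It agrees with [\x] on
   rectangles, hence everywhere by uniqueness. *)
transitivity (\int[(@lebesgue_measure R \x lebesgue_rV_sf n)%E]_z (f \o @rV_cons R n) z)%E.
  apply/esym/eq_measure_integral => A mA _.
  apply: product_measure_unique => // B C mB mC.
  exact: product_measure2E.
rewrite fubini_tonelli2// => z; exact: f0.
Qed.

(** The first order of integration follows from the nonnegative case applied to positive and
    negative parts, the second by Fubini's theorem. Both are wanted because integration by parts has
    to take place in the inner integral, whichever variable is concerned. *)
Lemma integral_rVS n (f : 'rV[R]_n.+1 -> \bar R) :
  (lam n.+1).-integrable setT f ->
  (\int[lam n.+1]_x f x =
   \int[lam n]_y \int[@lebesgue_measure R]_t f (rV_cons (t, y)))%E /\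
  (\int[lam n.+1]_x f x =
   \int[@lebesgue_measure R]_t \int[lam n]_y f (rV_cons (t, y)))%E.
Proof.
move=> fi; have mf := measurable_int _ fi.
have mfc : measurable_fun setT (f \o @rV_cons R n).
  exact: (measurableT_comp mf (@measurable_rV_cons R n)).
have H : ((@lebesgue_measure R) \x (lebesgue_rV_sf n))%E.-integrable setT (f \o @rV_cons R n).
  apply/integrable21ltyP => //.
  have /integrableP[_] := fi.
  rewrite ge0_integral_rVS//.
  exact: measurableT_comp.
have E1 : (\int[lam n.+1]_x f x = \int[lam n]_y \int[@lebesgue_measure R]_t f (rV_cons (t, y)))%E.
  have g1 := ge0_integral_rVS (measurable_funepos mf) (fun x => funepos_ge0 f x).
  have g2 := ge0_integral_rVS (measurable_funeneg mf) (fun x => funeneg_ge0 f x).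
  rewrite integralE g1 g2.
  rewrite -[RHS]/(\int[lebesgue_rV_sf n]_y
    (fubini_G (@lebesgue_measure R) (f \o @rV_cons R n) y))%E.
  rewrite integral21_prod_meas1// [RHS]integralE.
  congr (_ - _)%E; apply/esym.
    have p1 := @fubini_tonelli2 _ _ _ _ _ (@lebesgue_measure R) (lebesgue_rV_sf n)
      ((f \o @rV_cons R n)^\+)%E (measurable_funepos mfc) (fun z => funepos_ge0 _ z).
    rewrite p1; apply: eq_integral => y _; apply: eq_integral => t _.
    by rewrite funepos_comp.
  have p1 := @fubini_tonelli2 _ _ _ _ _ (@lebesgue_measure R) (lebesgue_rV_sf n)
    ((f \o @rV_cons R n)^\-)%E (measurable_funeneg mfc) (fun z => funeneg_ge0 _ z).
  rewrite p1; apply: eq_integral => y _; apply: eq_integral => t _.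
  by rewrite funeneg_comp.
split=> //; rewrite E1.
exact/esym/(@Fubini _ _ _ _ _ (@lebesgue_measure R) (lebesgue_rV_sf n) (f \o @rV_cons R n)).
Qed.

Lemma integral_tensor_le n (v : 'I_n -> R -> R) (c : 'I_n -> R) :
  (forall i, measurable_fun setT (v i)) -> (forall i t, 0 <= v i t) ->
  (forall i, \int[@lebesgue_measure R]_t (v i t)%:E <= (c i)%:E)%E ->
  (\int[lam n]_x (\prod_(i < n) v i (x ord0 i))%:E <= (\prod_(i < n) c i)%:E)%E.
Proof.
move=> mv v0 vc.
have c0 i : 0 <= c i.
  by rewrite -lee_fin (le_trans _ (vc i))// integral_ge0// => t _; rewrite lee_fin.
elim: n v c mv v0 vc c0 => [|n IH] v c mv v0 vc c0.
  rewrite big_ord0; under eq_integral do rewrite big_ord0.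
  have -> : (\int[lam 0]_x (cst 1 x) = \d_(0%R : 'rV[R]_0) setT)%E.
    by rewrite /= integral_cst// mul1e.
  by rewrite diracE in_setT.
have mP p (u : 'I_p -> R -> R) : (forall i, measurable_fun setT (u i)) ->
    measurable_fun setT (fun x : 'rV[R]_p => \prod_(i < p) u i (x ord0 i)).
  move=> mu; apply: measurable_prod => i _.
  exact: (measurableT_comp (mu i) (measurable_rV_coord i)).
rewrite ge0_integral_rVS; last first.
- by move=> x; rewrite lee_fin prodr_ge0.
- by apply/measurable_EFinP; exact: mP.
have -> : (\int[lam n]_y \int[@lebesgue_measure R]_t
    (\prod_(i < n.+1) v i (rV_cons (t, y) ord0 i))%:E =
  \int[lam n]_y ((\int[@lebesgue_measure R]_t (v ord0 t)%:E) *
    (\prod_(i < n) v (lift ord0 i) (y ord0 i))%:E))%E.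
  apply: eq_integral => y _.
  under eq_integral do
    (rewrite big_ord_recl rV_cons0; under eq_bigr do rewrite rV_consS; rewrite EFinM).
  rewrite ge0_integralZr//.
  - by apply/measurable_EFinP; exact: mv.
  - by move=> t _; rewrite lee_fin.
  - by rewrite lee_fin prodr_ge0.
rewrite ge0_integralZl//; last first.
- by apply: integral_ge0 => t _; rewrite lee_fin.
- by move=> t _; rewrite lee_fin prodr_ge0.
- by apply/measurable_EFinP; exact: (mP n (fun i => v (lift ord0 i)) (fun i => mv _)).
rewrite big_ord_recl EFinM; apply: lee_pmul => //.
- by apply: integral_ge0 => t _; rewrite lee_fin.
- by apply: integral_ge0 => t _; rewrite lee_fin prodr_ge0.
- exact: (IH (fun i => v (lift ord0 i)) (fun i => c (lift ord0 i))).
Qed.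


End lebesgue_rV_theory.

(** * Integrable power weights and integrals of partial derivatives *)

Section decay.
Context (R : realType).
Implicit Types (tau c t : R).

Definition decay tau t : R := (1 + `|t|) `^ (- tau).

Lemma decay_ge0 tau t : 0 <= decay tau t.
Proof. exact: powR_ge0. Qed.

Lemma decayN tau t : decay tau (- t) = decay tau t.
Proof. by rewrite /decay normrN. Qed.

Lemma continuous_decay tau : continuous (decay tau).
Proof.
move=> t.
have h : {for 1 + `|t|, continuous (fun x : R => x `^ (- tau))}.
  apply: differentiable_continuous; apply/derivable1_diffP.
  by apply: derivable_powR; rewrite in_itv/= andbT ltr_pwDl.
apply: (@continuous_comp _ _ _ (fun t : R => 1 + `|t|) (fun x : R => x `^ (- tau))) => //.
apply: cvgD; first exact: cvg_cst.
exact: norm_continuous.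
Qed.

Lemma measurable_decay tau c : measurable_fun setT (fun t => decay tau (t - c)).
Proof.
apply: (measurableT_comp (continuous_measurable_fun (@continuous_decay tau))).
by apply: measurable_funB.
Qed.

Lemma powRN_cvg0 tau c : 0 < tau -> (1 + (t - c)) `^ (- tau) @[t --> +oo] --> (0 : R).
Proof.
move=> tau0; apply/cvgrPdist_lt => e e0; near=> t.
have t1 : e `^ (- tau^-1) < 1 + (t - c).
  rewrite addrC -ltrBlDr ltrBrDr; near: t.
  by apply: nbhs_pinfty_gt; exact: num_real.
have p0 : 0 < 1 + (t - c) by apply: le_lt_trans t1; exact: powR_ge0.
rewrite sub0r normrN ger0_norm ?powR_ge0// powRN.
rewrite invf_plt ?posrE ?powR_gt0//.
have -> : e^-1 = (e `^ (- tau^-1)) `^ tau.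
  by rewrite -powRrM mulNr mulVf ?gt_eqF// powR_inv1// ltW.
by apply: gt0_ltr_powR => //; rewrite nnegrE ?powR_ge0// ltW.
Unshelve. all: end_near. Qed.

Lemma decay_half tau c : 1 < tau ->
  (\int[@lebesgue_measure R]_(t in `[c, +oo[) (decay tau (t - c))%:E =
   ((tau - 1)^-1)%:E)%E.
Proof.
move=> t1; have tau1 : 0 < tau - 1 by rewrite subr_gt0.
pose F t : R := - (tau - 1)^-1 * (1 + (t - c)) `^ (- (tau - 1)).
have dF (t : R) : c <= t -> is_derive t (1 : R) F (decay tau (t - c)).
  move=> ct.
  have p0 : 0 < 1 + (t - c) by rewrite ltr_pwDl// subr_ge0.
  have D1 : is_derive t (1 : R) (fun t : R => 1 + (t - c)) 1.
    have h := is_deriveD (is_derive_cst (1 : R) t (1 : R))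
                   (is_deriveB (is_derive_id t (1 : R)) (is_derive_cst c t (1 : R))).
    by rewrite subr0 add0r in h.
  have D2 := @is_derive1_comp R (fun x => x `^ (- (tau - 1)))
    (fun t => 1 + (t - c)) t _ _ (is_derive1_powR (- (tau - 1)) p0) D1.
  have D3 := is_deriveZ (- (tau - 1)^-1) D2.
  refine (is_derive_eq D3 _).
  rewrite /decay ger0_norm ?subr_ge0// mulr1.
  rewrite /GRing.scale/= mulrA mulrNN mulVf ?mul1r ?gt_eqF//.
  by rewrite opprB addrAC subrr sub0r.
have Fc : F c = - (tau - 1)^-1 by rewrite /F subrr addr0 powR1 mulr1.
rewrite (@ge0_continuous_FTC2y R _ F c 0).
- by rewrite Fc sub0e -EFinN opprK.
- by move=> x _; exact: decay_ge0.
- apply: continuous_subspaceT => t.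
  apply: (@continuous_comp _ _ _ (fun t : R => t - c) (decay tau)).
    by apply: cvgB; [exact: cvg_id|exact: cvg_cst].
  exact: continuous_decay.
- rewrite /F -(mulr0 (- (tau - 1)^-1)); apply: cvgMr.
  exact: powRN_cvg0.
- by move=> x cx; have [] := dF _ (ltW cx).
- apply: cvg_at_right_filter.
  have [/derivable1_diffP/differentiable_continuous h _] := dF _ (lexx c).
  exact: h.
- move=> x; rewrite in_itv/= andbT => cx.
  by rewrite derive1E; have [] := dF _ (ltW cx).
Qed.

Lemma integral_decay_le tau c : 1 < tau ->
  (\int[@lebesgue_measure R]_t (decay tau (t - c))%:E <= (2 / (tau - 1))%:E)%E.
Proof.
move=> t1.
have mD A : measurable_fun A (fun t => (decay tau (t - c))%:E).
  by apply/measurable_EFinP; apply: measurable_funTS; exact: measurable_decay.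
have -> : [set: R] = `]-oo, c[%classic `|` `[c, +oo[%classic.
  by apply/seteqP; split=> x //= _; rewrite !in_itv/= andbT; case: (ltP x c) => h; [left|right].
rewrite ge0_integral_setU//; last 3 first.
- exact: mD.
- by move=> x _; rewrite lee_fin decay_ge0.
- apply/disj_setPRL => x/=; rewrite !in_itv/= andbT => h.
  by apply/negP; rewrite -leNgt.
rewrite integral_itv_bndo_bndc//.
have -> : (\int[@lebesgue_measure R]_(t in `]-oo, c]) (decay tau (t - c))%:E = 
   \int[@lebesgue_measure R]_(t in `[(- c)%R, +oo[) (decay tau (t - - c))%:E)%E.
  rewrite -{1}(opprK c) ge0_integration_by_substitutionNy.
  - by apply: eq_integral => t _ /=; rewrite -decayN; congr ((decay _ _)%:E); lra.
  - apply: continuous_subspaceT => t.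
    apply: (@continuous_comp _ _ _ (fun t : R => t - c) (decay tau)).
      by apply: cvgB; [exact: cvg_id|exact: cvg_cst].
    exact: continuous_decay.
  - by move=> x _; exact: decay_ge0.
by rewrite !decay_half// -EFinD lee_fin mulr_natl mulr2n.
Qed.

Lemma integrable_decay tau : 1 < tau ->
  (@lebesgue_measure R).-integrable setT (fun t => (decay tau t)%:E).
Proof.
move=> t1; apply/integrableP; split.
  by apply/measurable_EFinP; exact: continuous_measurable_fun (@continuous_decay tau).
apply: le_lt_trans (ltry (2 / (tau - 1))).
under eq_integral => x _ do rewrite gee0_abs ?lee_fin ?decay_ge0// -[x in decay _ x]subr0.
exact: integral_decay_le.
Qed.
End decay.

Section integral_derivative.
Context (R : realType).

(** Over [[-(k+1), k+1]] the integral of [g] is a difference of two values of [f], which tends to 0.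
    The weight [decay 2] is at once the integrable majorant for [g] and the bound on these boundary
    values. *)
Lemma integral_derive0 (f g : R -> R) (C : R) :
  (forall x : R, is_derive x (1 : R) f (g x)) -> continuous g ->
  (forall x, `|f x| <= C * decay 2 x) -> (forall x, `|g x| <= C * decay 2 x) ->
  (\int[@lebesgue_measure R]_x (g x)%:E = 0)%E.
Proof.
move=> dfg cg fC gC.
pose G k : R -> \bar R := (fun x => (g x)%:E) \_ `[(- k.+1%:R)%R, k.+1%:R%R].
have C0 : 0 <= C.
  have := le_trans (normr_ge0 _) (fC 0); rewrite /decay normr0 addr0 powR1 mulr1.
  by [].
have mg : measurable_fun setT (EFin \o g).
  by apply/measurable_EFinP; exact: continuous_measurable_fun.
have iG : (\int[@lebesgue_measure R]_x G k x)%E @[k --> \oo] -->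
    (\int[@lebesgue_measure R]_x (g x)%:E)%E.
  apply: (@dominated_cvg _ (measurableTypeR R) R (@lebesgue_measure R) setT
    measurableT G (EFin \o g) (fun x => (C * decay 2 x)%:E)) => //.
  - move=> k; apply/(measurable_restrictT _ _).1 => //.
    exact: measurable_funTS.
  - move=> x _; apply: cvg_near_cst; near=> k.
    rewrite /G patchE ifT// inE/= in_itv/= -ler_norml.
    near: k; exists (Num.truncn `|x|) => // k /= xk.
    by apply: le_trans (ltW (truncnS_gt _)) _; rewrite ler_nat.
  - have := integrableZl measurableT C (integrable_decay (ltr1n _ 2)).
    by under [X in _ -> _.-integrable _ X]eq_fun do rewrite EFinM.
  - move=> k x _; rewrite /G patchE; case: ifPn => _.
      by rewrite abse_EFin lee_fin; exact: gC.
    by rewrite abse0 lee_fin mulr_ge0// decay_ge0.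
have cf : continuous f.
  by move=> x; have [/derivable1_diffP/differentiable_continuous] := dfg x.
have EG k : (\int[@lebesgue_measure R]_x G k x)%E = (f k.+1%:R - f (- k.+1%:R))%:E.
  rewrite -integral_mkcond (@continuous_FTC2 R g f)//.
  - by rewrite gtrN.
  - exact: continuous_subspaceT.
  - split=> [x _||]; first by have [] := dfg x.
      by apply: cvg_at_right_filter; exact: cf.
    by apply: cvg_at_left_filter; exact: cf.
  - by move=> x _; rewrite derive1E; have [] := dfg x.
have h0 : (2 * C * k.+1%:R^-1) @[k --> \oo] --> (0:R).
  rewrite -(mulr0 (2 * C)); apply: cvgMr.
  exact: cvg_harmonic.
have f0 : (f k.+1%:R - f (- k.+1%:R)) @[k --> \oo] --> (0 : R).
  apply/norm_cvg0P.
  apply: (@squeeze_cvgr _ \oo _ R (cst 0) (fun k => 2 * C * k.+1%:R^-1)) => //; last exact: cvg_cst.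
  near=> k; rewrite normr_ge0/=.
  have hd : decay 2 k.+1%:R <= k.+1%:R^-1 :> R.
    have K0 : 0 < k.+1%:R :> R by [].
    rewrite /decay ger0_norm ?(ltW K0)//; move: (k.+1%:R) K0 => K K0.
    have K1 : 0 < 1 + K by rewrite addr_gt0.
    rewrite powRN powR_mulrn ?(ltW K1)// lef_pV2 ?posrE ?exprn_gt0//.
    by rewrite expr2; nra.
  apply: le_trans (ler_normB _ _) _.
  have := fC k.+1%:R; have := fC (- k.+1%:R); rewrite decayN.
  move=> h1 h2; have h3 := ler_wpM2l C0 hd.
  rewrite -mulrA mulr_natl mulr2n; apply: lerD; first exact: le_trans h2 h3.
  exact: le_trans h1 h3.
have f0' : (f k.+1%:R - f (- k.+1%:R))%:E @[k --> \oo] --> (0 : \bar R).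
  by apply: cvg_EFin => //; exact: nearW.
rewrite (_ : (fun k => _) = (fun k => (f k.+1%:R - f (- k.+1%:R))%:E)) in iG; last first.
  by apply/funext => k; exact: EG.
exact: (cvg_unique _ iG f0').
Unshelve. all: end_near. Qed.
End integral_derivative.

Section affine.
Context (R : realType) (V W : normedModType R) (L : V -> W) (F : W -> R).
Context (x v : V) (w : W).
Hypothesis hL : forall h : R, L (h *: v + x) = h *: w + L x.

Let quotientE :
  (fun h : R => h^-1 *: (((fun y => F (L y)) \o shift x) (h *: v) - F (L x))) =
  (fun h : R => h^-1 *: ((F \o shift (L x)) (h *: w) - F (L x))).
Proof. by apply/funext => h /=; rewrite hL. Qed.

(** [L] has to be affine only along the line through [x] in the direction [v]: the two difference
    quotients then coincide. This yields partial derivatives of slices, of functions of one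
    coordinate and of functions of a scalar product. *)
Lemma derive_comp_affine : 'D_v (fun y => F (L y)) x = 'D_w F (L x).
Proof. by rewrite /derive quotientE. Qed.

Lemma derivable_comp_affine :
  derivable F (L x) w -> derivable (fun y => F (L y)) x v.
Proof. by rewrite /derivable quotientE. Qed.
End affine.

Section ibp.
Context (R : realType).
Local Notation lam n := (lebesgue_rV R n).

Lemma continuous_rV (T : topologicalType) n (f : T -> 'rV[R]_n) :
  (forall i, continuous (fun x => f x ord0 i)) -> continuous f.
Proof.
move=> cf x; apply/cvg_ballP => e e0.
have H : \forall y \near x, forall i, ball (f x ord0 i) e (f y ord0 i).
  apply: filter_forall => i.
  have /cvg_ballP := cf i x; exact.
apply: filterS H => y H; split=> // i j.
by rewrite (ord1 i); exact: H.
Qed.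

Lemma add_scale_deltaE n (h : R) (k i : 'I_n) (z : 'rV[R]_n) :
  (h *: delta_mx ord0 k + z) ord0 i = h * (i == k)%:R + z ord0 i.
Proof. by rewrite !mxE eqxx. Qed.

Lemma delta_row_cons0 n (h t : R) (y : 'rV[R]_n) :
  rV_cons (h *: (1 : R) + t, y) = h *: delta_mx ord0 ord0 + rV_cons (t, y).
Proof.
apply/rowP => i; rewrite add_scale_deltaE.
have [j ->|->] := unliftP ord0 i; first by rewrite !rV_consS mulr0 add0r.
by rewrite !rV_cons0 eqxx /GRing.scale/=.
Qed.

Lemma delta_row_consS n (h t : R) (y : 'rV[R]_n) k :
  rV_cons (t, h *: delta_mx ord0 k + y) =
  h *: delta_mx ord0 (lift ord0 k) + rV_cons (t, y).
Proof.
apply/rowP => i; rewrite add_scale_deltaE.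
have [j ->|->] := unliftP ord0 i.
  by rewrite !rV_consS add_scale_deltaE (inj_eq (lift_inj (h:=ord0))).
by rewrite !rV_cons0 mulr0 add0r.
Qed.

(** The majorant for most integrals in the variable [x]. As a product it is integrated by Tonelli's
    theorem, and its slices at a fixed coordinate are again of this form up to a constant. *)
Definition Qdecay n (x : 'rV[R]_n) : R := \prod_(i < n) decay 2 (x ord0 i).

Lemma Qdecay_ge0 n (x : 'rV[R]_n) : 0 <= Qdecay x.
Proof. by apply: prodr_ge0 => i _; exact: decay_ge0. Qed.

Lemma measurable_Qdecay n : measurable_fun setT (@Qdecay n).
Proof.
apply: measurable_prod => i _.
apply: (measurableT_comp _ (measurable_rV_coord i)).
exact: (continuous_measurable_fun (@continuous_decay R 2)).
Qed.

Lemma integral_Qdecay n : (\int[lam n]_x (Qdecay x)%:E <= (2 ^+ n)%:E)%E.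
Proof.
have := @integral_tensor_le R n (fun=> decay 2) (fun=> 2).
rewrite prodr_const card_ord; apply=> [i|i t|i].
- exact: (continuous_measurable_fun (@continuous_decay R 2)).
- exact: decay_ge0.
- have := @integral_decay_le R 2 0 (ltr1n _ 2).
  under eq_integral do rewrite subr0.
  have -> : 2 - 1 = 1 :> R by lra.
  by rewrite divr1.
Qed.

Lemma Qdecay_cons n t (y : 'rV[R]_n) :
  Qdecay (rV_cons (t, y)) = decay 2 t * Qdecay y.
Proof.
rewrite /Qdecay big_ord_recl rV_cons0; congr (_ * _).
by apply: eq_bigr => i _; rewrite rV_consS.
Qed.

Lemma integrable_Qdecay n C : (lam n).-integrable setT (fun x => (C * Qdecay x)%:E).
Proof.
under eq_fun do rewrite EFinM; apply: integrableZl => //.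
apply/integrableP; split; first by apply/measurable_EFinP; exact: measurable_Qdecay.
under eq_integral do rewrite gee0_abs ?lee_fin ?Qdecay_ge0//.
exact: le_lt_trans (integral_Qdecay n) (ltry _).
Qed.

Lemma Qdecay_integrable n (f : 'rV[R]_n -> R) C :
  measurable_fun setT f -> (forall x, `|f x| <= C * Qdecay x) ->
  (lam n).-integrable setT (fun x => (f x)%:E).
Proof.
move=> mf fC; apply: le_integrable (integrable_Qdecay n C) => //.
  exact/measurable_EFinP.
by move=> x _; rewrite !abse_EFin lee_fin (le_trans (fC x))// ler_norm.
Qed.

Lemma continuous_rV_cons_l n (y : 'rV[R]_n) : continuous (fun t : R => rV_cons (t, y)).
Proof.
apply: continuous_rV => i; have [j ->|->] := unliftP ord0 i.
  by under eq_fun do rewrite rV_consS; exact: cst_continuous.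
under eq_fun do rewrite rV_cons0; move=> x; exact: cvg_id.
Qed.

Lemma continuous_rV_cons_r n (t : R) : continuous (fun y : 'rV[R]_n => rV_cons (t, y)).
Proof.
apply: continuous_rV => i; have [j ->|->] := unliftP ord0 i.
  under eq_fun do rewrite rV_consS; exact: continuous_coord.
by under eq_fun do rewrite rV_cons0; exact: cst_continuous.
Qed.

(** If [j] is the first index, the inner integral is the one-dimensional case. Otherwise the
    induction hypothesis applies to the slices at a fixed first coordinate [t], with [C * decay 2 t]
    in place of [C]. *)
Lemma integral_pderiv0 n (j : 'I_n) (F : 'rV[R]_n -> R) (C : R) :
  (forall x, derivable F x (delta_mx ord0 j)) -> continuous (pderiv j F) ->
  (forall x, `|F x| <= C * Qdecay x) ->
  (forall x, `|pderiv j F x| <= C * Qdecay x) ->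
  (\int[lam n]_x (pderiv j F x)%:E = 0)%E.
Proof.
elim: n j F C => [[]//|n IH] j F C dF cF FC FC'.
have iF : (lam n.+1).-integrable setT (fun x => (pderiv j F x)%:E).
  by apply: Qdecay_integrable FC'; exact: continuous_measurable_rV.
have [E1 E2] := integral_rVS iF.
have [k jk|j0] := unliftP ord0 j.
  rewrite E2; apply: integral0_eq => t _.
  pose G y := F (rV_cons (t, y)).
  have dG y : pderiv k G y = pderiv j F (rV_cons (t, y)).
    rewrite /pderiv /G jk; apply: (@derive_comp_affine R _ _ (fun y => rV_cons (t, y))) => h.
    exact: delta_row_consS.
  rewrite -(IH k G (C * decay 2 t)).
  - by apply: eq_integral => y _; rewrite dG.
  - move=> y; apply: (@derivable_comp_affine R _ _ (fun y => rV_cons (t, y))) (dF _) => h.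
    by rewrite jk; exact: delta_row_consS.
  - rewrite (_ : pderiv k G = pderiv j F \o (fun y => rV_cons (t, y))).
      move=> y; apply: continuous_comp; first exact: continuous_rV_cons_r.
      exact: cF.
    by apply/funext => y; exact: dG.
  - by move=> y; apply: le_trans (FC _) _; rewrite Qdecay_cons mulrA.
  - by move=> y; rewrite dG; apply: le_trans (FC' _) _; rewrite Qdecay_cons mulrA.
rewrite E1; apply: integral0_eq => y _.
apply: (@integral_derive0 R (fun t => F (rV_cons (t, y))) _ (C * Qdecay y)) => [t||t|t].
- split.
    apply: (@derivable_comp_affine R _ _ (fun t : R => rV_cons (t, y))) (dF _) => h.
    by rewrite j0; exact: delta_row_cons0.
  apply: (@derive_comp_affine R _ _ (fun t : R => rV_cons (t, y))) => h.
  by rewrite j0; exact: delta_row_cons0.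
- move=> t; apply: (@continuous_comp _ _ _ (fun t : R => rV_cons (t, y)) (pderiv j F)).
    exact: continuous_rV_cons_l.
  exact: cF.
- by apply: le_trans (FC _) _; rewrite Qdecay_cons mulrA mulrAC.
- by apply: le_trans (FC' _) _; rewrite Qdecay_cons mulrA mulrAC.
Qed.
End ibp.

(** * Smooth and rapidly decreasing functions *)

Section smooth_calculus.
Context (R : realType) (n : nat).
Implicit Types (f g u v : 'rV[R]_n -> R) (s : seq 'I_n) (al be : 'I_n -> nat) (j : 'I_n).

Lemma iter_pderiv_cat s1 s2 f :
  iter_pderiv (s1 ++ s2) f = iter_pderiv s1 (iter_pderiv s2 f).
Proof. by rewrite /iter_pderiv foldr_cat. Qed.

Lemma smooth_iter_pderiv s f : smooth f -> smooth (iter_pderiv s f).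
Proof. by move=> sf t; have := sf (t ++ s); rewrite iter_pderiv_cat. Qed.

Lemma smooth_pderiv j f : smooth f -> smooth (pderiv j f).
Proof. exact: (@smooth_iter_pderiv [:: j]). Qed.

Lemma smooth_continuous f : smooth f -> continuous f.
Proof. by move=> sf; have [] := sf [::]. Qed.

Lemma smooth_derivable f j x : smooth f -> derivable f x (delta_mx ord0 j).
Proof. by move=> sf; have [_] := sf [::]; exact. Qed.

Lemma pderivM j f g x :
  derivable f x (delta_mx ord0 j) -> derivable g x (delta_mx ord0 j) ->
  pderiv j (fun y => f y * g y) x = pderiv j f x * g x + f x * pderiv j g x.
Proof.
move=> df dg; have E := deriveM df dg.
apply: etrans E _.
by rewrite /GRing.scale/= addrC [X in X + _]mulrC.
Qed.

Lemma pderiv_sum_prod j (L : seq (('rV[R]_n -> R) * ('rV[R]_n -> R))) :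
  (forall p, List.In p L -> (forall x, derivable p.1 x (delta_mx ord0 j)) /\
     (forall x, derivable p.2 x (delta_mx ord0 j))) ->
  (forall x, derivable (fun x => \sum_(p <- L) p.1 x * p.2 x) x (delta_mx ord0 j)) /\
  pderiv j (fun x => \sum_(p <- L) p.1 x * p.2 x) =
  fun x => \sum_(p <- L) (pderiv j p.1 x * p.2 x + p.1 x * pderiv j p.2 x).
Proof.
elim: L => [_|[f g] L IH HL].
  split=> [x|]; first by under eq_fun do rewrite big_nil; exact: derivable_cst.
  apply/funext => x; rewrite big_nil; under eq_fun do rewrite big_nil.
  exact: derive_cst.
have [|dL EL] := IH; first by move=> p pL; apply: HL; right.
have [/= df dg] := HL (f, g) (or_introl erefl).
have dfg x : derivable (fun x => f x * g x) x (delta_mx ord0 j).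
  exact: (@derivableM _ _ f g).
have E : (fun x => \sum_(p <- (f, g) :: L) p.1 x * p.2 x) =
    (fun x => f x * g x) \+ (fun x => \sum_(p <- L) p.1 x * p.2 x).
  by apply/funext => x; rewrite big_cons.
rewrite E; split=> [x|]; first exact: (@derivableD _ _ _ (fun x => f x * g x)).
apply/funext => x; rewrite big_cons /pderiv.
rewrite (@deriveD _ _ _ (fun x => f x * g x))//.
rewrite -/(pderiv j (fun x => f x * g x) x) pderivM//; congr (_ + _).
by have := congr1 (fun F => F x) EL.
Qed.

Lemma continuous_rVD f g : continuous f -> continuous g ->
  continuous (fun x => f x + g x).
Proof. by move=> cf cg x; exact: (cvgD (cf x) (cg x)). Qed.

Lemma continuous_rVN f : continuous f -> continuous (fun x => - f x).
Proof. by move=> cf x; exact: (cvgN (cf x)). Qed.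

Lemma continuous_rVM f g : continuous f -> continuous g ->
  continuous (fun x => f x * g x).
Proof. by move=> cf cg x; exact: (cvgM (cf x) (cg x)). Qed.

Lemma derivable_rVM f g (x v : 'rV[R]_n) : derivable f x v -> derivable g x v ->
  derivable (fun y => f y * g y) x v.
Proof. by move=> df dg; exact: (derivableM df dg). Qed.

Lemma derivable_rVB f g (x v : 'rV[R]_n) : derivable f x v -> derivable g x v ->
  derivable (fun y => f y - g y) x v.
Proof. by move=> df dg; exact: (derivableB df dg). Qed.

Lemma pderivB j f g x :
  derivable f x (delta_mx ord0 j) -> derivable g x (delta_mx ord0 j) ->
  pderiv j (fun y => f y - g y) x = pderiv j f x - pderiv j g x.
Proof. by move=> df dg; exact: (deriveB df dg). Qed.

(** All ways of distributing the successive derivatives over two factors. Equal pairs are not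
    merged, so the Leibniz rule becomes a plain sum of [2 ^ size s] terms without binomial
    coefficients. *)
Fixpoint splits s : seq (seq 'I_n * seq 'I_n) :=
  if s is j :: t then
    [seq (j :: p.1, p.2) | p <- splits t] ++ [seq (p.1, j :: p.2) | p <- splits t]
  else [:: ([::], [::])].

Lemma splits_subseq s p : p \in splits s -> subseq p.1 s /\ subseq p.2 s.
Proof.
elim: s p => [|j s IH] p /=; first by rewrite inE => /eqP ->.
rewrite mem_cat => /orP[] /mapP[q /IH[q1 q2] ->] /=; rewrite eqxx; split=> //.
  exact: subseq_trans q2 (subseq_cons s j).
exact: subseq_trans q1 (subseq_cons s j).
Qed.

Lemma iter_pderivM s f g : smooth f -> smooth g ->
  iter_pderiv s (fun x => f x * g x) =
  fun x => \sum_(p <- splits s) iter_pderiv p.1 f x * iter_pderiv p.2 g x.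
Proof.
move=> sf sg; elim: s => [|j s IH]; first by apply/funext => x; rewrite big_seq1.
have -> : iter_pderiv (j :: s) (fun x => f x * g x) =
  pderiv j (iter_pderiv s (fun x => f x * g x)) by [].
pose L := [seq (iter_pderiv p.1 f, iter_pderiv p.2 g) | p <- splits s].
have EL : (fun x => \sum_(p <- splits s) iter_pderiv p.1 f x * iter_pderiv p.2 g x) =
    (fun x => \sum_(p <- L) p.1 x * p.2 x).
  by apply/funext => x; rewrite big_map.
rewrite IH EL; have [|_ ->] := @pderiv_sum_prod j L.
  move=> p /List.in_map_iff[q [<- _]] /=.
  by split=> x; [exact: (sf _).2|exact: (sg _).2].
apply/funext => x; by rewrite big_map big_cat !big_map big_split.
Qed.

Lemma continuous_sum (I : Type) (L : seq I) (F : I -> 'rV[R]_n -> R) :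
  (forall i, continuous (F i)) -> continuous (fun x => \sum_(i <- L) F i x).
Proof.
move=> cF x; elim: L => [|i L IH].
  rewrite (_ : (fun _ => _) = cst 0); first exact: cst_continuous.
  by apply/funext => y; rewrite big_nil.
rewrite (_ : (fun _ => _) = F i + (fun y => \sum_(i <- L) F i y)).
  by apply: continuousD => //; exact: cF.
by apply/funext => y; rewrite big_cons.
Qed.

Lemma smoothM f g : smooth f -> smooth g -> smooth (fun x => f x * g x).
Proof.
move=> sf sg s; rewrite iter_pderivM//.
split=> [|j x].
  apply: continuous_sum => p x; apply: (@continuousM _ _ (iter_pderiv p.1 f)).
    exact: (sf _).1.
  exact: (sg _).1.
pose L := [seq (iter_pderiv p.1 f, iter_pderiv p.2 g) | p <- splits s].
have EL : (fun x => \sum_(p <- splits s) iter_pderiv p.1 f x * iter_pderiv p.2 g x) =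
    (fun x => \sum_(p <- L) p.1 x * p.2 x).
  by apply/funext => y; rewrite big_map.
rewrite EL; have [|+ _] := @pderiv_sum_prod j L; last exact.
move=> p /List.in_map_iff[q [<- _]] /=.
by split=> y; [exact: (sf _).2|exact: (sg _).2].
Qed.

Lemma iter_pderiv_cst s c :
  iter_pderiv s (cst c : 'rV[R]_n -> R) = cst (if s is [::] then c else 0).
Proof.
elim: s => [//|j s IH] /=; rewrite -/(iter_pderiv s _) IH.
by apply/funext => x; rewrite /pderiv; exact: derive_cst.
Qed.

Lemma smooth_cst c : smooth (cst c : 'rV[R]_n -> R).
Proof.
move=> s; rewrite iter_pderiv_cst; split=> [x|j x]; first exact: cst_continuous.
exact: derivable_cst.
Qed.

Lemma is_derive_coord (k j : 'I_n) (x : 'rV[R]_n) :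
  is_derive x (delta_mx ord0 j : 'rV[R]_n) (fun x : 'rV[R]_n => x ord0 k) (j == k)%:R.
Proof.
have H h : (h *: delta_mx ord0 j + x : 'rV[R]_n) ord0 k = h *: (j == k)%:R + x ord0 k.
  by rewrite add_scale_deltaE eq_sym.
split.
  by apply: (@derivable_comp_affine R _ _ _ id _ _ (j == k)%:R H); exact: derivable_id.
rewrite (@derive_comp_affine R _ _ _ id _ _ (j == k)%:R H).
exact: derive_id.
Qed.

Lemma pderiv_coord (k j : 'I_n) :
  pderiv j (fun x : 'rV[R]_n => x ord0 k) = cst (j == k)%:R.
Proof. by apply/funext => x; have [_] := is_derive_coord k j x. Qed.

Lemma iter_pderiv_coord s (k : 'I_n) :
  iter_pderiv s (fun x : 'rV[R]_n => x ord0 k) =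
    match s with [::] => fun x => x ord0 k
    | [:: j] => cst (j == k)%:R | _ => cst 0 end.
Proof.
case/lastP: s => [//|s j]; rewrite -cats1 iter_pderiv_cat.
have -> : iter_pderiv [:: j] (fun x : 'rV[R]_n => x ord0 k) = cst (j == k)%:R.
  exact: pderiv_coord.
by rewrite iter_pderiv_cst; case: s => [|i [|l s]].
Qed.

Lemma smooth_coord (k : 'I_n) : smooth (fun x : 'rV[R]_n => x ord0 k).
Proof.
move=> s; case/lastP: s => [|s j].
  by split=> [|j x]; [exact: continuous_coord|have [] := is_derive_coord k j x].
rewrite -cats1 iter_pderiv_cat.
have -> : iter_pderiv [:: j] (fun x : 'rV[R]_n => x ord0 k) = cst (j == k)%:R.
  exact: pderiv_coord.
exact: smooth_cst.
Qed.

Lemma count_mseq al j : count_mem j (mseq al) = al j.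
Proof.
rewrite /mseq count_flatten -map_comp sumnE big_map.
rewrite (bigD1_seq j) ?mem_enum ?enum_uniq//= count_nseq/= eqxx mul1n.
rewrite big1 ?addn0// => i ij.
by rewrite count_nseq/= (negbTE ij).
Qed.

Let ord_leq : rel 'I_n := fun i j => (i <= j)%N.

Lemma sorted_mseq al : sorted ord_leq (mseq al).
Proof.
apply: pairwise_sorted; rewrite /mseq.
have : pairwise ord_leq (enum 'I_n).
  rewrite -sorted_pairwise; last by move=> a b c; exact: leq_trans.
  change (sorted (relpre (@nat_of_ord n) leq) (enum 'I_n)).
  by rewrite -sorted_map val_enum_ord iota_sorted.
elim: (enum 'I_n) => [//|j E IH] /= /andP[jE pE].
rewrite pairwise_cat IH// andbT; apply/andP; split.
  apply/allrelP => x y; rewrite mem_nseq => /andP[_ /eqP ->] /flattenP[t /mapP[k kE ->]].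
  by rewrite mem_nseq => /andP[_ /eqP ->]; exact: (allP jE).
elim: (al j) => [//|k IHk] /=; rewrite IHk andbT.
by apply/allP => x; rewrite mem_nseq => /andP[_ /eqP ->]; exact: leqnn.
Qed.

(** A subsequence of a sorted list is sorted, hence determined by its multiplicities. So the factors
    that the Leibniz rule produces from [mderiv] are themselves of the form [mderiv], and the
    seminorm bounds apply to them. *)
Lemma subseq_mseq s al : subseq s (mseq al) -> s = mseq (fun j => count_mem j s).
Proof.
move=> sal.
have tr : transitive ord_leq by move=> a b c; exact: leq_trans.
apply: (@sorted_eq _ ord_leq tr).
- by move=> x y; rewrite /ord_leq -eqn_leq => /eqP; exact: val_inj.
- exact: subseq_sorted tr _ _ sal (sorted_mseq al).
- exact: sorted_mseq.
- by apply/allP => x _ /=; rewrite count_mseq.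
Qed.

Definition mdelta (k : nat) (j : 'I_n) : 'I_n -> nat := fun i => if i == j then k else 0%N.

Lemma mseq_mdelta k j : mseq (mdelta k j) = nseq k j.
Proof.
have /(@subseq_mseq (nseq k j)) : subseq (nseq k j) (mseq (mdelta k j)).
  have kE : count_mem j (mseq (mdelta k j)) = k by rewrite count_mseq /mdelta eqxx.
  have -> : nseq k j = seq.filter (pred1 j) (mseq (mdelta k j)).
    rewrite -[in LHS]kE; elim: (mseq _) => [//|x t IH] /=.
    by case: eqP => [->|_] /=; rewrite ?add0n ?IH.
  exact: filter_subseq.
move=> ->; congr mseq; apply/funext => i.
by rewrite count_nseq/= /mdelta eq_sym; case: eqP => _; rewrite ?mul1n ?mul0n.
Qed.

Lemma iter_pderiv0_on (U : set 'rV[R]_n) s f : open U ->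
  (forall x, U x -> f x = 0) -> forall x, U x -> iter_pderiv s f x = 0.
Proof.
move=> oU fU; elim: s => [//|j s IH] x Ux /=.
rewrite /pderiv (@near_eq_derive _ _ _ _ (cst 0)); first exact: derive_cst.
by apply: filterS (oU x Ux) => y Uy; exact: IH.
Qed.

Lemma mderiv0 u : mderiv (fun=> 0%N) u = u.
Proof.
rewrite /mderiv; have -> : mseq (fun _ : 'I_n => 0%N) = [::]; last by [].
by rewrite /mseq; elim: (enum 'I_n).
Qed.

Lemma monom0 (x : 'rV[R]_n) : monom (fun=> 0%N) x = 1.
Proof. by rewrite /monom big1// => i _; rewrite expr0. Qed.

Definition bnd (F : 'rV[R]_n -> R) := exists C : R, forall x, `|F x| <= C.

Lemma bndD F G : bnd F -> bnd G -> bnd (fun x => F x + G x).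
Proof.
move=> [C HC] [D HD]; exists (C + D) => x.
by apply: le_trans (ler_normD _ _) _; exact: lerD.
Qed.

Lemma bndZ c F : bnd F -> bnd (fun x => c * F x).
Proof.
by move=> [C HC]; exists (`|c| * C) => x; rewrite normrM ler_wpM2l.
Qed.

Lemma bnd_eq F G : F =1 G -> bnd F -> bnd G.
Proof. by move=> FG [C HC]; exists C => x; rewrite -FG. Qed.

Lemma bnd_sum (I : eqType) (L : seq I) (F : I -> 'rV[R]_n -> R) :
  (forall i, i \in L -> bnd (F i)) -> bnd (fun x => \sum_(i <- L) F i x).
Proof.
elim: L => [_|i L IH HL].
  by exists 0 => x; rewrite big_nil normr0.
have h1 : bnd (F i) by apply: HL; rewrite mem_head.
have h2 : bnd (fun x => \sum_(i <- L) F i x).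
  by apply: IH => k kL; apply: HL; rewrite in_cons kL orbT.
by apply: bnd_eq (bndD h1 h2) => x; rewrite big_cons.
Qed.

Definition rschwartz u := smooth u /\
  forall al be, bnd (fun x => monom al x * mderiv be u x).

Lemma monomM al j (x : 'rV[R]_n) k :
  x ord0 j ^+ k * monom al x = monom (fun i => al i + mdelta k j i)%N x.
Proof.
rewrite /monom [in RHS](bigD1 j)//= [in LHS](bigD1 j)//= /mdelta eqxx exprD.
rewrite mulrA [X in X * _ = _]mulrC; congr (_ * _).
by apply: eq_bigr => i /negbTE ->; rewrite addn0.
Qed.

Lemma rschwartz0 : rschwartz (cst 0).
Proof.
split; first exact: smooth_cst.
move=> al be; exists 0 => x; rewrite /mderiv iter_pderiv_cst.
by case: (mseq be) => [|? ?]; rewrite mulr0 normr0.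
Qed.

Lemma rschwartzZ c u : rschwartz u -> rschwartz (fun x => c * u x).
Proof.
move=> [su bu].
have E : (fun x => c * u x) = (fun x => c * u x + 0 * (cst 0 x)).
  by apply/funext => x; rewrite mul0r addr0.
split; first by rewrite E; apply: smooth_lin => //; exact: smooth_cst.
move=> al be; apply: bnd_eq (bndZ c (bu al be)) => x.
rewrite E /mderiv iter_pderiv_lin//; last exact: smooth_cst.
by rewrite mul0r addr0 mulrCA.
Qed.

Lemma rschwartz_coordM j u : rschwartz u -> rschwartz (fun x => x ord0 j * u x).
Proof.
move=> [su bu]; split; first by apply: smoothM => //; exact: smooth_coord.
move=> al be; rewrite /mderiv iter_pderivM//; last exact: smooth_coord.
apply: (@bnd_eq (fun x => \sum_(p <- splits (mseq be))
    (monom al x * (iter_pderiv p.1 (fun x : 'rV[R]_n => x ord0 j) x * iter_pderiv p.2 u x)))).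
  by move=> x; rewrite mulr_sumr.
apply: bnd_sum => -[p1 p2] /splits_subseq[_ /= /subseq_mseq ->].
set be' := (fun i : 'I_n => count_mem i p2).
have E x := congr1 (fun F => F x) (iter_pderiv_coord p1 j).
case: p1 E => [|i [|l t]] E.
- apply: bnd_eq (bu (fun i => al i + mdelta 1 j i)%N be') => x.
  by rewrite -monomM expr1 mulrA [monom al x * _]mulrC.
- apply: bnd_eq (bndZ (i == j)%:R (bu al be')) => x.
  by rewrite E mulrCA.
- by exists 0 => x; rewrite E mul0r mulr0 normr0.
Qed.

(** The product of the [1 + x_j ^ 2] expands into monomials, so [u] stays bounded after
    multiplication by it. Then [1 / (1 + t ^ 2) <= 2 / (1 + |t|) ^ 2] is used in each coordinate,
    which gives the factor [2 ^ n]. *)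
Lemma rschwartz_Qdecay u al be : rschwartz u ->
  exists C : R, forall x, `|monom al x * mderiv be u x| <= C * Qdecay x.
Proof.
move=> [su bu].
have H (L : seq 'I_n) : forall al, bnd (fun x =>
    (\prod_(j <- L) (1 + x ord0 j ^+ 2)) * (monom al x * mderiv be u x)).
  elim: L => [|j L IH] {}al.
    by apply: bnd_eq (bu al be) => x; rewrite big_nil mul1r.
  apply: bnd_eq (bndD (IH al) (IH (fun i => al i + mdelta 2 j i)%N)) => x.
  by rewrite -monomM big_cons; ring.
have [C HC] := H (index_enum 'I_n) al.
exists (2 ^+ n * C) => x.
have Q0 : 0 < \prod_(j < n) (1 + x ord0 j ^+ 2).
  by apply: prodr_gt0 => j _; rewrite ltr_pwDl// sqr_ge0.
have hQ : (\prod_(j < n) (1 + x ord0 j ^+ 2))^-1 <= 2 ^+ n * Qdecay x.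
  rewrite -prodfV /Qdecay -[X in 2 ^+ X](card_ord n) -prodr_const -big_split/=.
  apply: ler_prod => j _; rewrite invr_ge0 addr_ge0 ?sqr_ge0//=.
  rewrite /decay powRN powR_mulrn; last by rewrite addr_ge0.
  have t1 : 0 < 1 + x ord0 j ^+ 2 by rewrite ltr_pwDl// sqr_ge0.
  have t2 : 0 < (1 + `|x ord0 j|) ^+ 2 by rewrite exprn_gt0// ltr_pwDl.
  rewrite -[_^-1]mul1r ler_pdivrMr// mulrAC ler_pdivlMr// mul1r.
  rewrite -(real_normK (num_real (x ord0 j))).
  move: `|x ord0 j| => t; have := sqr_ge0 (t - 1); rewrite !expr2; lra.
have := HC x; rewrite normrM (gtr0_norm Q0) => h.
have C0 : 0 <= C by apply: le_trans h; rewrite mulr_ge0// ltW.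
rewrite -(ler_pM2l Q0); apply: le_trans h _.
rewrite -mulrA mulrCA mulrA mulrC -mulrA; apply: ler_peMr => //.
move: hQ; rewrite -[X in X <= _]mul1r ler_pdivrMr// => hQ.
by rewrite mulrCA mulrA.
Qed.
End smooth_calculus.

(** * Fourier transform of rapidly decreasing functions *)

Section osc.
Context (R : realType) (n : nat).
Local Notation lam := (lebesgue_rV R n).
Implicit Types (u v : 'rV[R]_n -> R) (x zeta : 'rV[R]_n).

(* [osc u v] is the real part of the Fourier transform of [u + i v]; the
   imaginary part is [osc v (- u)]. *)
Definition osc_integrand u v zeta x : R :=
  cos (dot x zeta) * u x + sin (dot x zeta) * v x.

Definition osc u v zeta : R := \int[lam]_x osc_integrand u v zeta x.

Lemma dotC x zeta : dot x zeta = dot zeta x.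
Proof. by apply: eq_bigr => i _; rewrite mulrC. Qed.

Lemma dotDl x y zeta : dot (x + y) zeta = dot x zeta + dot y zeta.
Proof. by rewrite /dot -big_split/=; apply: eq_bigr => i _; rewrite mxE mulrDl. Qed.

Lemma dotNr x zeta : dot x (- zeta) = - dot x zeta.
Proof. by rewrite /dot -sumrN; apply: eq_bigr => i _; rewrite mxE mulrN. Qed.

Lemma dotBr x y z : dot x (y - z) = dot x y - dot x z.
Proof. by rewrite dotC dotDl !(dotC _ x) dotNr. Qed.

Lemma dot_deltal (h : R) j x zeta :
  dot (h *: delta_mx ord0 j + x) zeta = h * zeta ord0 j + dot x zeta.
Proof.
rewrite dotDl; congr (_ + _); rewrite /dot (bigD1 j)//= big1 => [|i ij].
  by rewrite !mxE !eqxx mulr1 addr0.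
by rewrite !mxE (negbTE ij) andbF mulr0 mul0r.
Qed.

Lemma continuous_dotl zeta : continuous (fun x => dot x zeta).
Proof.
apply: continuous_sum => i x; apply: (@continuousM _ _ (fun x : 'rV[R]_n => x ord0 i)).
  exact: continuous_coord.
exact: cst_continuous.
Qed.

Lemma is_derive_dir (g : R -> R) (t c dg : R) :
  is_derive t (1 : R) g dg -> is_derive t (c : R) g (c * dg).
Proof.
move=> [d1 e1]; have dg1 : differentiable g t by exact/derivable1_diffP.
split; first exact: diff_derivable.
rewrite deriveE// -[c in 'd _ _ c]mulr1 -[c * 1]/(c *: (1 : R)) linearZ/= -deriveE// e1.
by [].
Qed.

Lemma is_derive_dot (g : R -> R) (dg : R) j x zeta :
  is_derive (dot x zeta) (1 : R) g dg ->
  is_derive x (delta_mx ord0 j : 'rV[R]_n) (fun x => g (dot x zeta)) (zeta ord0 j * dg).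
Proof.
move=> /(is_derive_dir (zeta ord0 j)) [d e].
have H (h : R) : dot (h *: delta_mx ord0 j + x) zeta = h *: zeta ord0 j + dot x zeta.
  exact: dot_deltal.
split; first exact: (derivable_comp_affine (L := fun x => dot x zeta) H d).
by rewrite (derive_comp_affine (L := fun x => dot x zeta) _ H).
Qed.

Lemma derivable_dot_trig (g : R -> R) (dg : R -> R) j zeta :
  (forall t : R, is_derive t (1 : R) g (dg t)) ->
  (forall x, derivable (fun x => g (dot x zeta)) x (delta_mx ord0 j)) /\
  pderiv j (fun x => g (dot x zeta)) = (fun x => zeta ord0 j * dg (dot x zeta)).
Proof.
move=> H; have K x := @is_derive_dot g (dg (dot x zeta)) j x zeta (H _).
by split=> [x|]; [have [] := K x|apply/funext => x; have [_] := K x].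
Qed.

Lemma continuous_comp_dot (g : R -> R) zeta :
  continuous g -> continuous (fun x => g (dot x zeta)).
Proof.
move=> cg x; apply: (@continuous_comp _ _ _ (fun x => dot x zeta) g).
  exact: continuous_dotl.
exact: cg.
Qed.

Lemma normr_osc_integrand u v zeta x : `|osc_integrand u v zeta x| <= `|u x| + `|v x|.
Proof.
apply: le_trans (ler_normD _ _) _; rewrite !normrM; apply: lerD.
  by apply: ler_piMl => //; exact: cos_max.
by apply: ler_piMl => //; exact: sin_max.
Qed.

Lemma continuous_osc_integrand u v zeta : continuous u -> continuous v ->
  continuous (osc_integrand u v zeta).
Proof.
move=> cu cv; apply: continuous_rVD; apply: continuous_rVM => //.
  by apply: (continuous_comp_dot (g := cos)); exact: continuous_cos.
by apply: (continuous_comp_dot (g := sin)); exact: continuous_sin.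
Qed.

Lemma measurable_osc_integrand u v zeta :
  measurable_fun setT u -> measurable_fun setT v ->
  measurable_fun setT (osc_integrand u v zeta).
Proof.
move=> mu mv.
have md : measurable_fun setT (fun x => dot x zeta).
  by apply: measurable_dot => //; exact: measurable_cst.
apply: measurable_funD; apply: measurable_funM => //.
  exact: (measurableT_comp (continuous_measurable_fun (@continuous_cos R)) md).
exact: (measurableT_comp (continuous_measurable_fun (@continuous_sin R)) md).
Qed.

Lemma integrable_osc u v zeta :
  lam.-integrable setT (fun x => (u x)%:E) -> lam.-integrable setT (fun x => (v x)%:E) ->
  lam.-integrable setT (fun x => (osc_integrand u v zeta x)%:E).
Proof.
move=> iu iv.
have mu : measurable_fun setT u by apply/measurable_EFinP; exact: measurable_int iu.
have mv : measurable_fun setT v by apply/measurable_EFinP; exact: measurable_int iv.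
apply: le_integrable (integrableD measurableT (integrable_abse iu) (integrable_abse iv)) => //.
  by apply/measurable_EFinP; exact: measurable_osc_integrand.
move=> x _; rewrite /= lee_fin; apply: le_trans (normr_osc_integrand u v zeta x) _.
exact: ler_norm.
Qed.

(** The integral of [Qdecay] is at most [2 ^ n]; one more factor 2 accounts for the two
    functions. *)
Lemma osc_bound u v zeta C : measurable_fun setT u -> measurable_fun setT v ->
  (forall x, `|u x| <= C * Qdecay x) -> (forall x, `|v x| <= C * Qdecay x) ->
  `|osc u v zeta| <= C * 2 ^+ n.+1.
Proof.
move=> mu mv uC vC.
have C0 : 0 <= C.
  have := le_trans (normr_ge0 _) (uC 0); rewrite pmulr_lge0//.
  by apply: prodr_gt0 => i _; rewrite powR_gt0// ltr_pwDl.
have iu := Qdecay_integrable mu uC; have iv := Qdecay_integrable mv vC.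
have io := integrable_osc zeta iu iv.
apply: le_trans (le_normr_Rintegral measurableT io) _.
rewrite -lee_fin fineK; last first.
  by apply: integrable_fin_num => //; exact: (integrable_norm io).
apply: (@le_trans _ _ (\int[lam]_x ((2 * C)%:E * (Qdecay x)%:E))%E).
  apply: ge0_le_integral => //.
  - by apply/measurable_EFinP; apply: measurableT_comp => //; exact: measurable_osc_integrand.
  - apply: measurable_funeM; apply/measurable_EFinP; exact: measurable_Qdecay.
  move=> x _; rewrite -EFinM lee_fin; apply: le_trans (normr_osc_integrand u v zeta x) _.
  by rewrite -mulrA mulr_natl mulr2n lerD.
rewrite ge0_integralZl//; first last.
- by rewrite lee_fin mulr_ge0.
- by move=> x _; rewrite lee_fin Qdecay_ge0.
- by apply/measurable_EFinP; exact: measurable_Qdecay.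
apply: le_trans (lee_pmul _ _ (lexx _) (integral_Qdecay R n)) _ => //.
- by rewrite lee_fin mulr_ge0.
- by apply: integral_ge0 => x _; rewrite lee_fin Qdecay_ge0.
by rewrite -EFinM lee_fin exprS mulrCA mulrA.
Qed.

Definition Qdominated u := exists C : R, forall x, `|u x| <= C * Qdecay x.

(** For [f = u + i v] this is the real part of the rule that [zeta_j f^] is the transform of
    [- i d_j f]: multiplication by [- i] turns the pair [(u', v')] into [(v', - u')]. The function
    [F] below is chosen such that its derivative is the difference of the two integrands. *)
Lemma osc_ibp j u v zeta : 
  (forall x, derivable u x (delta_mx ord0 j)) -> (forall x, derivable v x (delta_mx ord0 j)) ->
  continuous u -> continuous v -> continuous (pderiv j u) -> continuous (pderiv j v) ->
  Qdominated u -> Qdominated v -> Qdominated (pderiv j u) -> Qdominated (pderiv j v) ->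
  zeta ord0 j * osc u v zeta = osc (pderiv j v) (fun x => - pderiv j u x) zeta.
Proof.
move=> du dv cu cv cu' cv' [C uC] [D vD] [C' uC'] [D' vD'].
pose F x := sin (dot x zeta) * u x - cos (dot x zeta) * v x.
have [dc ec] := derivable_dot_trig j zeta (@is_derive_cos R).
have [ds es] := derivable_dot_trig j zeta (@is_derive_sin R).
have h1 x := derivable_rVM (ds x) (du x).
have h2 x := derivable_rVM (dc x) (dv x).
have dF x : derivable F x (delta_mx ord0 j) := derivable_rVB (h1 x) (h2 x).
have EF : pderiv j F = (fun x => zeta ord0 j * osc_integrand u v zeta x -
   osc_integrand (pderiv j v) (fun x => - pderiv j u x) zeta x).
  apply/funext => x.
  have := pderivB (h1 x) (h2 x); rewrite -/F => ->.
  rewrite (pderivM (ds x) (du x)) (pderivM (dc x) (dv x)).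
  have := congr1 (fun F => F x) ec; have := congr1 (fun F => F x) es; rewrite /= => -> ->.
  by rewrite /osc_integrand; ring.
have mu := continuous_measurable_rV cu; have mv := continuous_measurable_rV cv.
have mu' := continuous_measurable_rV cu'; have mv' := continuous_measurable_rV cv'.
have mNu' : measurable_fun setT (fun x => - pderiv j u x) by exact: measurableT_comp.
have io := integrable_osc zeta (Qdecay_integrable mu uC) (Qdecay_integrable mv vD).
have NuC' x : `|- pderiv j u x| <= C' * Qdecay x by rewrite normrN.
have io' := integrable_osc zeta (Qdecay_integrable mv' vD') (Qdecay_integrable mNu' NuC').
have I0 : (\int[lam]_x (pderiv j F x)%:E = 0)%E.
  pose B := `|zeta ord0 j| * (C + D) + (C' + D').
  have Q0 := @Qdecay_ge0 R n.
  have hF x : `|F x| <= (C + D) * Qdecay x.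
    have := normr_osc_integrand (fun x => - v x) u zeta x; rewrite /osc_integrand normrN.
    have -> : cos (dot x zeta) * - v x + sin (dot x zeta) * u x = F x by rewrite /F; ring.
    move=> h; apply: le_trans h _; rewrite addrC mulrDl; exact: lerD.
  have hF' x : `|pderiv j F x| <= B * Qdecay x.
    rewrite EF; apply: le_trans (ler_normB _ _) _; rewrite /B mulrDl; apply: lerD.
      rewrite normrM -mulrA ler_wpM2l//; apply: le_trans (normr_osc_integrand _ _ _ _) _.
      by rewrite mulrDl; exact: lerD.
    apply: le_trans (normr_osc_integrand _ _ _ _) _.
    by rewrite addrC mulrDl; exact: lerD.
  apply: (@integral_pderiv0 R n j F (`|C + D| + `|B|) dF) => [|x|x].
  - rewrite EF; apply: continuous_rVD.
      apply: continuous_rVM; first exact: cst_continuous.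
      exact: continuous_osc_integrand.
    apply: continuous_rVN; apply: continuous_osc_integrand => //.
    exact: continuous_rVN.
  - apply: le_trans (hF x) _; apply: ler_wpM2r => //.
    by apply: le_trans (ler_norm _) _; rewrite lerDl.
  - apply: le_trans (hF' x) _; apply: ler_wpM2r => //.
    by apply: le_trans (ler_norm _) _; rewrite lerDr.
have : (\int[lam]_x (pderiv j F x) = 0)%R by rewrite /Rintegral I0.
rewrite EF RintegralB//; last first.
  exact: (integrableZl measurableT (zeta ord0 j) io).
by rewrite RintegralZl// => /eqP; rewrite subr_eq0 => /eqP.
Qed.

Lemma iter_pderivZ (c : R) s u : smooth u ->
  iter_pderiv s (fun x => c * u x) = fun x => c * iter_pderiv s u x.
Proof.
move=> su.
have E : (fun x => c * u x) = (fun x => c * u x + 0 * (cst 0 x)).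
  by apply/funext => x; rewrite mul0r addr0.
rewrite E iter_pderiv_lin//; last exact: smooth_cst.
by apply/funext => x; rewrite mul0r addr0.
Qed.

Lemma smoothZ (c : R) u : smooth u -> smooth (fun x => c * u x).
Proof. by move=> su; apply: smoothM => //; exact: smooth_cst. Qed.

Lemma smoothN u : smooth u -> smooth (fun x => - u x).
Proof. by move=> su; under eq_fun do rewrite -mulN1r; exact: smoothZ. Qed.

Lemma iter_pderivN s u : smooth u ->
  iter_pderiv s (fun x => - u x) = fun x => - iter_pderiv s u x.
Proof.
move=> su; under eq_fun do rewrite -mulN1r.
by rewrite iter_pderivZ//; apply/funext => x; rewrite mulN1r.
Qed.

(** Repeated integration by parts in one variable. Only the derivatives of order [k] enter the
    constant; those of lower order have to be dominated so that the integrals of derivatives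
    vanish. *)
Lemma osc_decay k j u v zeta C : smooth u -> smooth v ->
  (forall l, (l < k)%N -> Qdominated (iter_pderiv (nseq l j) u)) ->
  (forall l, (l < k)%N -> Qdominated (iter_pderiv (nseq l j) v)) ->
  (forall x, `|iter_pderiv (nseq k j) u x| <= C * Qdecay x) ->
  (forall x, `|iter_pderiv (nseq k j) v x| <= C * Qdecay x) ->
  `|zeta ord0 j| ^+ k * `|osc u v zeta| <= C * 2 ^+ n.+1.
Proof.
elim: k u v => [|k IH] u v su sv du dv uC vC.
  rewrite mul1r; apply: osc_bound => //; apply: continuous_measurable_rV; exact: smooth_continuous.
have E l (w : 'rV[R]_n -> R) : iter_pderiv (nseq l.+1 j) w = iter_pderiv (nseq l j) (pderiv j w).
  have -> : nseq l.+1 j = nseq l j ++ [:: j] by rewrite -[l.+1]addn1 nseqD.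
  by rewrite iter_pderiv_cat.
have su' := smooth_pderiv j su; have sv' := smooth_pderiv j sv.
(* When a single integration by parts remains, the first derivative is the top one and is covered by
   the bound with [C]. *)
have Du : Qdominated (pderiv j u).
  by case: k uC du {dv vC IH} => [|k] uC du; [exists C|apply: (du 1%N)].
have Dv : Qdominated (pderiv j v).
  by case: k vC dv {du uC IH} => [|k] vC dv; [exists C|apply: (dv 1%N)].
rewrite exprSr -mulrA -normrM osc_ibp//.
- apply: (IH _ _ sv' (smoothN su')).
  + by move=> l lk; rewrite -E; exact: dv.
  + move=> l lk; have [B HB] := du l.+1 lk; exists B => x.
    by rewrite iter_pderivN// normrN -E.
  + by move=> x; rewrite -E.
  + by move=> x; rewrite iter_pderivN// normrN -E.
- by move=> x; exact: smooth_derivable.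
- by move=> x; exact: smooth_derivable.
- exact: smooth_continuous.
- exact: smooth_continuous.
- exact: smooth_continuous.
- exact: smooth_continuous.
- exact: (du 0%N).
- exact: (dv 0%N).
Qed.

Lemma dot_deltar (h : R) j x zeta :
  dot x (h *: delta_mx ord0 j + zeta) = h * x ord0 j + dot x zeta.
Proof. by rewrite dotC dot_deltal dotC. Qed.

Lemma is_derive_affine (g : R -> R) (dg b c t : R) :
  is_derive (t * b + c) (1 : R) g dg -> is_derive t (1 : R) (fun t => g (t * b + c)) (b * dg).
Proof.
move=> /(is_derive_dir b) [d e].
have H (h : R) : (h *: (1 : R) + t) * b + c = h *: b + (t * b + c).
  by rewrite /GRing.scale/= mulr1; ring.
split; first exact: (@derivable_comp_affine R _ _ (fun t : R => t * b + c) g t (1 : R) b H d).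
by rewrite (@derive_comp_affine R _ _ (fun t : R => t * b + c) g t (1 : R) b H).
Qed.

Lemma is_derive_osc_integrand j u v zeta x (t : R) :
  is_derive t (1 : R) (fun t : R => osc_integrand u v (t *: delta_mx ord0 j + zeta) x)
    (osc_integrand (fun x => x ord0 j * v x) (fun x => - (x ord0 j * u x))
      (t *: delta_mx ord0 j + zeta) x).
Proof.
pose p := t * x ord0 j + dot x zeta.
have h1 := is_derive_affine (is_derive_cos p).
have h2 := is_derive_affine (is_derive_sin p).
have [d1 e1] := h1; have [d2 e2] := h2.
have E : (fun t : R => osc_integrand u v (t *: delta_mx ord0 j + zeta) x) =
   (fun t => u x * cos (t * x ord0 j + dot x zeta) + v x * sin (t * x ord0 j + dot x zeta)).
  by apply/funext => r; rewrite /osc_integrand dot_deltar mulrC [sin _ * _]mulrC.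
rewrite E; apply: (is_derive_eq (is_deriveD (is_deriveZ (u x) h1) (is_deriveZ (v x) h2))).
by rewrite /osc_integrand dot_deltar /GRing.scale/= -/p; ring.
Qed.

(** The real part of the rule that [d_j f^] is the transform of [- i x_j f]. One differentiates
    under the integral along [t -> t e_j + zeta] at [t = 0]; as [cos] and [sin] are bounded by 1,
    the majorant of the derivative is independent of [t]. *)
Lemma is_derive_osc j u v zeta :
  measurable_fun setT u -> measurable_fun setT v -> Qdominated u -> Qdominated v ->
  Qdominated (fun x => x ord0 j * u x) -> Qdominated (fun x => x ord0 j * v x) ->
  is_derive zeta (delta_mx ord0 j : 'rV[R]_n) (osc u v)
    (osc (fun x => x ord0 j * v x) (fun x => - (x ord0 j * u x)) zeta).
Proof.
move=> mu mv [A uA] [B vB] [C uC] [D vD].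
pose f (t : R) x := osc_integrand u v (t *: delta_mx ord0 j + zeta) x.
pose g (t : R) x := osc_integrand (fun x => x ord0 j * v x) (fun x => - (x ord0 j * u x))
   (t *: delta_mx ord0 j + zeta) x.
have dfE t x : partial1of2 f t x = g t x.
  by rewrite partial1of2E; have [_] := is_derive_osc_integrand j u v zeta x t.
have I0 : (`]-1, 1[%classic : set R) 0 by rewrite /= in_itv/= ltrN10 ltr01.
have iu := Qdecay_integrable mu uA; have iv := Qdecay_integrable mv vB.
have Q0 := @Qdecay_ge0 R n.
have := @cvg_differentiation_under_integral R _ _ lam f setT measurableT 0 (-1) 1 I0
  (fun t _ => integrable_osc _ iu iv)
  (fun t x _ _ => let: DeriveDef d _ := is_derive_osc_integrand j u v zeta x t in d)
  (fun x => `|D + C| * Qdecay x)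
  (fun x => mulr_ge0 (normr_ge0 _) (Q0 x)) (integrable_Qdecay n _).
have H x t : `|partial1of2 f t x| <= `|D + C| * Qdecay x.
  rewrite dfE; apply: le_trans (normr_osc_integrand _ _ _ _) _; rewrite normrN.
  apply: (@le_trans _ _ ((D + C) * Qdecay x)); first by rewrite mulrDl; exact: lerD.
  by apply: ler_wpM2r => //; exact: ler_norm.
move=> /(_ (fun t x _ _ => H x t)).
under [X in _ --> X]eq_Rintegral do rewrite dfE.
rewrite /g; under [X in _ --> X]eq_Rintegral do rewrite scale0r add0r.
rewrite -/(osc _ _ zeta) => L.
have E : (fun h : R => h^-1 *: ((\int[lam]_y f (h + 0) y) - (\int[lam]_y f 0 y))) =
    (fun h : R => h^-1 *: ((osc u v \o shift zeta) (h *: delta_mx ord0 j) - osc u v zeta)).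
  by apply/funext => h; rewrite addr0 /f scale0r add0r.
rewrite E in L.
split; last exact/cvg_lim.
by apply/cvg_ex; eexists; exact: L.
Qed.

(** Dominated convergence is a statement on sequences; this reduces the continuity of a parameter
    integral to it. If continuity fails, a bad point exists in each ball of radius [1 / (k + 1)],
    and these points converge to [p]. *)
Lemma continuous_at_seq (V : pseudoMetricType R) (f : V -> R) (p : V) :
  (forall w : nat -> V, w k @[k --> \oo] --> p -> f (w k) @[k --> \oo] --> f p) ->
  {for p, continuous f}.
Proof.
move=> H; suff : f x @[x --> p] --> f p by [].
apply/cvg_ballP => e e0; apply: contrapT => N.
have W k : exists y : V, ball p k.+1%:R^-1 y /\ ~ ball (f p) e (f y).
  apply: contrapT => K; apply: N.
  apply/nbhs_ballP; exists k.+1%:R^-1 => /=; first by rewrite invr_gt0.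
  by move=> y bx; apply: contrapT => h; apply: K; exists y.
have [w hw] := choice W.
have wp : w k @[k --> \oo] --> p.
  apply/cvg_ballP => d d0.
  have [M _ HM] := @near_infty_natSinv_lt R (PosNum d0).
  exists M => // k /= Mk; apply: (@le_ball _ _ _ k.+1%:R^-1); last exact: (hw k).1.
  by apply/ltW; exact: (HM k Mk).
have /cvg_ballP/(_ _ e0)[M _ HM] := H w wp.
exact: (hw M).2 (HM M (leqnn M)).
Qed.

Lemma continuous_osc u v :
  lam.-integrable setT (fun x => (u x)%:E) -> lam.-integrable setT (fun x => (v x)%:E) ->
  continuous (osc u v).
Proof.
move=> iu iv zeta.
have mu : measurable_fun setT u by apply/measurable_EFinP; exact: measurable_int iu.
have mv : measurable_fun setT v by apply/measurable_EFinP; exact: measurable_int iv.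
have io z := integrable_osc z iu iv.
apply: continuous_at_seq => w wz.
have H : (\int[lam]_x (osc_integrand u v (w k) x)%:E)%E @[k --> \oo] -->
    (\int[lam]_x (osc_integrand u v zeta x)%:E)%E.
  apply: (@dominated_cvg _ _ _ lam setT measurableT
    (fun k x => (osc_integrand u v (w k) x)%:E) _ (fun x => (`|u x| + `|v x|)%:E)) => //.
  - by move=> k; apply: measurable_int (io _).
  - move=> x _; apply: cvg_EFin; first exact: nearW.
    have cd : continuous (fun z => osc_integrand u v z x).
      rewrite (_ : (fun z => _) = osc_integrand (cst (u x)) (cst (v x)) x).
        by apply: continuous_osc_integrand; exact: cst_continuous.
      by apply/funext => z; rewrite /osc_integrand dotC.
    exact: (cvg_comp w (fun z => osc_integrand u v z x) wz (cd zeta)).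
  - exact: (integrableD measurableT (integrable_norm iu) (integrable_norm iv)).
  - by move=> k x _; rewrite abse_EFin lee_fin; exact: normr_osc_integrand.
have F : (\int[lam]_x (osc_integrand u v zeta x)%:E)%E = (osc u v zeta)%:E.
  by rewrite /osc /Rintegral fineK//; apply: integrable_fin_num => //; exact: io.
rewrite F in H; exact: fine_cvg H.
Qed.

Lemma rschwartz_Qdominated u : rschwartz u -> Qdominated u.
Proof.
move=> su; have [C HC] := rschwartz_Qdecay (fun=> 0%N) (fun=> 0%N) su.
by exists C => x; have := HC x; rewrite monom0 mderiv0 mul1r.
Qed.

Lemma rschwartz_integrable u : rschwartz u -> lam.-integrable setT (fun x => (u x)%:E).
Proof.
move=> su; have [C HC] := rschwartz_Qdominated su.
apply: Qdecay_integrable HC; apply: continuous_measurable_rV; apply: smooth_continuous.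
by case: su.
Qed.

Lemma rschwartzN u : rschwartz u -> rschwartz (fun x => - u x).
Proof. by move=> su; under eq_fun do rewrite -mulN1r; exact: rschwartzZ. Qed.

Lemma is_derive_osc_rschwartz j u v zeta : rschwartz u -> rschwartz v ->
  is_derive zeta (delta_mx ord0 j : 'rV[R]_n) (osc u v)
    (osc (fun x => x ord0 j * v x) (fun x => - (x ord0 j * u x)) zeta).
Proof.
move=> su sv; have [smu _] := su; have [smv _] := sv.
apply: is_derive_osc.
- by apply: continuous_measurable_rV; exact: smooth_continuous.
- by apply: continuous_measurable_rV; exact: smooth_continuous.
- exact: rschwartz_Qdominated.
- exact: rschwartz_Qdominated.
- by apply: rschwartz_Qdominated; exact: rschwartz_coordM.
- by apply: rschwartz_Qdominated; exact: rschwartz_coordM.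
Qed.

Lemma iter_pderiv_osc s u v : rschwartz u -> rschwartz v ->
  exists u' v', [/\ rschwartz u', rschwartz v' & iter_pderiv s (osc u v) = osc u' v'].
Proof.
move=> su sv; elim: s => [|j s [u' [v' [su' sv' IH]]]]; first by exists u, v.
exists (fun x => x ord0 j * v' x), (fun x => - (x ord0 j * u' x)).
split; [exact: rschwartz_coordM|by apply: rschwartzN; exact: rschwartz_coordM|].
rewrite /= -/(iter_pderiv s _) IH; apply/funext => x.
by have [_] := is_derive_osc_rschwartz j x su' sv'.
Qed.

Lemma rschwartz_iter_nseq l j u : rschwartz u -> Qdominated (iter_pderiv (nseq l j) u).
Proof.
move=> su; have [C HC] := rschwartz_Qdecay (fun=> 0%N) (mdelta l j) su.
by exists C => x; have := HC x; rewrite /mderiv mseq_mdelta monom0 mul1r.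
Qed.

(** Each factor is at most [max(1, |x_j|)] for the coordinate [x_j] largest in modulus. Pure powers
    thus control all monomials, and integration by parts in one variable at a time yields rapid
    decay. *)
Lemma normr_monom_le al (x : 'rV[R]_n) :
  `|monom al x| <= 1 + \sum_(j < n) `|x ord0 j| ^+ (\sum_(i < n) al i)%N.
Proof.
have S0 (P : pred 'I_n) : 0 <= \sum_(j < n | P j) `|x ord0 j| ^+ (\sum_(i < n) al i)%N.
  by apply: sumr_ge0 => j _; rewrite exprn_ge0.
have [j0 _|no] := pickP (@predT 'I_n); last first.
  rewrite /monom big1 ?normr1 ?lerDl//.
  by move=> i _; have := no i.
have [j _ jmax] := @arg_maxP _ _ _ j0 predT (fun i => `|x ord0 i|) isT.
set k := (\sum_(i < n) al i)%N.
have M0 : 0 <= Num.max 1 `|x ord0 j| by rewrite le_max ler01.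
apply: (@le_trans _ _ (Num.max 1 `|x ord0 j| ^+ k)).
  rewrite /k -prodrXr /monom normr_prod; apply: ler_prod => i _.
  rewrite normr_ge0 normrX; apply: lerXn2r; rewrite ?nnegrE//.
  by have /= h := jmax i isT; rewrite le_max h orbT.
apply: (@le_trans _ _ (1 + `|x ord0 j| ^+ k)).
  have [h|h] := leP 1 `|x ord0 j|; first by rewrite lerDr.
  by rewrite expr1n lerDl exprn_ge0.
by rewrite lerD2l (bigD1 j)//= lerDl; exact: S0.
Qed.

(** The derivatives of [osc u v] are of the form [osc u' v'] with [u'] and [v'] rapidly decreasing,
    so continuity and decay have to be proved only for functions of this form. *)
Lemma rschwartz_of_osc u v : rschwartz u -> rschwartz v -> rschwartz (osc u v).
Proof.
move=> su sv; split.
  move=> s; have [u' [v' [su' sv' ->]]] := iter_pderiv_osc s su sv.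
  split; first by apply: continuous_osc; exact: rschwartz_integrable.
  by move=> j x; have [] := is_derive_osc_rschwartz j x su' sv'.
move=> al be; rewrite /mderiv; have [u' [v' [su' sv' ->]]] := iter_pderiv_osc (mseq be) su sv.
have D k j : bnd (fun x => `|x ord0 j| ^+ k * `|osc u' v' x|).
  have [A HA] := rschwartz_iter_nseq k j su'; have [B HB] := rschwartz_iter_nseq k j sv'.
  exists (Num.max A B * 2 ^+ n.+1) => x; rewrite ger0_norm ?mulr_ge0 ?exprn_ge0//.
  apply: osc_decay => //.
  - by case: su'.
  - by case: sv'.
  - by move=> l _; exact: rschwartz_iter_nseq.
  - by move=> l _; exact: rschwartz_iter_nseq.
  - move=> y; apply: le_trans (HA y) _; apply: ler_wpM2r; first exact: Qdecay_ge0.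
    by rewrite le_max lexx.
  - move=> y; apply: le_trans (HB y) _; apply: ler_wpM2r; first exact: Qdecay_ge0.
    by rewrite le_max lexx orbT.
have [A HA] := rschwartz_Qdominated su'; have [B HB] := rschwartz_Qdominated sv'.
pose k := (\sum_(i < n) al i)%N.
have S1 : bnd (fun x => `|osc u' v' x| +
    \sum_(j <- index_enum 'I_n) `|x ord0 j| ^+ k * `|osc u' v' x|).
  apply: bndD; last by apply: bnd_sum => j _; exact: D.
  exists (Num.max A B * 2 ^+ n.+1) => x; rewrite normr_id.
  apply: osc_bound.
  - by apply: continuous_measurable_rV; apply: smooth_continuous; case: su'.
  - by apply: continuous_measurable_rV; apply: smooth_continuous; case: sv'.
  - move=> y; apply: le_trans (HA y) _; apply: ler_wpM2r; first exact: Qdecay_ge0.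
    by rewrite le_max lexx.
  - move=> y; apply: le_trans (HB y) _; apply: ler_wpM2r; first exact: Qdecay_ge0.
    by rewrite le_max lexx orbT.
have [C HC] := S1; exists C => x; apply: le_trans (HC x).
rewrite normrM [leRHS]ger0_norm; last first.
  by rewrite addr_ge0// sumr_ge0// => j _; rewrite mulr_ge0// exprn_ge0.
rewrite -mulr_suml -[X in X + _]mul1r -mulrDl; apply: ler_wpM2r => //.
exact: normr_monom_le.
Qed.

End osc.

Local Notation normcM := ComplexField.Normc.normcM.

(** * Complex-valued functions: measurability, integrals, Fubini's theorem *)

Section complex_integral.
Context (R : realType).

Lemma normc_ge0 (z : R[i]) : 0 <= normc z.
Proof. by case: z => a b; exact: sqrtr_ge0. Qed.

Lemma normr_Re_le (z : R[i]) : `|complex.Re z| <= normc z.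
Proof.
case: z => a b /=; rewrite -sqrtr_sqr ler_wsqrtr// lerDl sqr_ge0 //.
Qed.

Lemma normr_Im_le (z : R[i]) : `|complex.Im z| <= normc z.
Proof. by case: z => a b /=; rewrite -sqrtr_sqr ler_wsqrtr// lerDr sqr_ge0. Qed.

Lemma normc_le_ReIm (z : R[i]) : normc z <= `|complex.Re z| + `|complex.Im z|.
Proof.
case: z => a b /=; rewrite -[leRHS]ger0_norm ?addr_ge0// -sqrtr_sqr ler_wsqrtr//.
by rewrite sqrrD !real_normK ?num_real// addrAC lerDl mulrn_wge0// mulr_ge0.
Qed.

Lemma normc_expi (t : R) : normc (expi t) = 1.
Proof. by rewrite /= cos2Dsin2 sqrtr1. Qed.

Lemma normc_expiM (t : R) (z : R[i]) : normc (expi t * z) = normc z.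
Proof. by rewrite normcM normc_expi mul1r. Qed.

Lemma expiD (s t : R) : expi (s + t) = expi s * expi t.
Proof. by rewrite /expi cosD sinD; congr (_ +i* _); rewrite addrC. Qed.

Lemma eq_complexRI (z w : R[i]) :
  complex.Re z = complex.Re w -> complex.Im z = complex.Im w -> z = w.
Proof. by case: z w => a b [c d] /= -> ->. Qed.

Lemma ReM (z w : R[i]) : complex.Re (z * w) =
  complex.Re z * complex.Re w - complex.Im z * complex.Im w.
Proof. by case: z w => a b [c d]. Qed.

Lemma ImM (z w : R[i]) : complex.Im (z * w) =
  complex.Re z * complex.Im w + complex.Im z * complex.Re w.
Proof. by case: z w => a b [c d]. Qed.

Lemma ReD (z w : R[i]) : complex.Re (z + w) = complex.Re z + complex.Re w.
Proof. by case: z w => a b [c d]. Qed.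

Lemma ImD (z w : R[i]) : complex.Im (z + w) = complex.Im z + complex.Im w.
Proof. by case: z w => a b [c d]. Qed.

Section measurable.
Context d (T : measurableType d).
Implicit Types f g : T -> R[i].

Definition cmeasurable f := measurable_fun setT (fun x => complex.Re (f x)) /\
  measurable_fun setT (fun x => complex.Im (f x)).

Lemma cmeasurableM f g : cmeasurable f -> cmeasurable g ->
  cmeasurable (fun x => f x * g x).
Proof.
move=> [f1 f2] [g1 g2]; split.
  by under eq_fun do rewrite ReM; apply: measurable_funB; apply: measurable_funM.
by under eq_fun do rewrite ImM; apply: measurable_funD; apply: measurable_funM.
Qed.

Lemma cmeasurableD f g : cmeasurable f -> cmeasurable g ->
  cmeasurable (fun x => f x + g x).
Proof.
move=> [f1 f2] [g1 g2]; split.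
  by under eq_fun do rewrite ReD; apply: measurable_funD.
by under eq_fun do rewrite ImD; apply: measurable_funD.
Qed.

Lemma cmeasurable_cst (c : R[i]) : cmeasurable (fun=> c).
Proof. by split; exact: measurable_cst. Qed.

Lemma measurable_sqrt : measurable_fun setT (@Num.sqrt R).
Proof. by apply: continuous_measurable_fun; exact: sqrt_continuous. Qed.

Lemma cmeasurable_normc f : cmeasurable f -> measurable_fun setT (fun x => normc (f x)).
Proof.
move=> [f1 f2].
have -> : (fun x => normc (f x)) =
   (fun x => Num.sqrt (complex.Re (f x) ^+ 2 + complex.Im (f x) ^+ 2)).
  by apply/funext => x; case: (f x).
apply: (measurableT_comp measurable_sqrt).
by apply: measurable_funD; apply: measurable_funX.
Qed.

Lemma cmeasurable_expi (h : T -> R) : measurable_fun setT h ->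
  cmeasurable (fun x => expi (h x)).
Proof.
move=> mh; split.
  exact: (measurableT_comp (continuous_measurable_fun (@continuous_cos R)) mh).
exact: (measurableT_comp (continuous_measurable_fun (@continuous_sin R)) mh).
Qed.
End measurable.

Lemma cmeasurable_comp d (T : measurableType d) d' (T' : measurableType d')
    (f : T -> R[i]) (h : T' -> T) :
  cmeasurable f -> measurable_fun setT h -> cmeasurable (fun x => f (h x)).
Proof.
move=> [f1 f2] mh; split.
  exact: (measurableT_comp f1 mh).
exact: (measurableT_comp f2 mh).
Qed.

Section cint_theory.
Context (n : nat).
Local Notation lam n := (lebesgue_rV R n).
Implicit Types f g : 'rV[R]_n -> R[i].

Definition cintegrable f := cmeasurable f /\
  (\int[lam n]_x (normc (f x))%:E < +oo)%E.

Lemma le_cintegrable f (g : 'rV[R]_n -> R) : cmeasurable f ->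
  measurable_fun setT g ->
  (forall x, normc (f x) <= g x) -> (\int[lam n]_x (g x)%:E < +oo)%E -> cintegrable f.
Proof.
move=> mf mg fg ig; split=> //; apply: le_lt_trans ig.
apply: ge0_le_integral => //.
- by move=> x _; rewrite lee_fin normc_ge0.
- by apply/measurable_EFinP; exact: cmeasurable_normc.
- exact/measurable_EFinP.
- by move=> x _; rewrite lee_fin.
Qed.

Lemma cintegrable_normc f : cintegrable f ->
  (lam n).-integrable setT (fun x => (normc (f x))%:E).
Proof.
move=> [mf fi]; apply/integrableP; split.
  by apply/measurable_EFinP; exact: cmeasurable_normc.
by under eq_integral do rewrite gee0_abs ?lee_fin ?normc_ge0//.
Qed.

Lemma cintegrable_Re f : cintegrable f ->
  (lam n).-integrable setT (fun x => (complex.Re (f x))%:E).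
Proof.
move=> fi; apply: le_integrable (cintegrable_normc fi) => //.
  by apply/measurable_EFinP; have [[]] := fi.
by move=> x _; rewrite /= lee_fin (ger0_norm (normc_ge0 _)) normr_Re_le.
Qed.

Lemma cintegrable_Im f : cintegrable f ->
  (lam n).-integrable setT (fun x => (complex.Im (f x))%:E).
Proof.
move=> fi; apply: le_integrable (cintegrable_normc fi) => //.
  by apply/measurable_EFinP; have [[]] := fi.
by move=> x _; rewrite /= lee_fin (ger0_norm (normc_ge0 _)) normr_Im_le.
Qed.

Lemma cintegrableZ c f : cintegrable f -> cintegrable (fun x => c * f x).
Proof.
move=> [mf fi]; split; first by apply: cmeasurableM => //; exact: cmeasurable_cst.
under eq_integral do rewrite normcM EFinM.
rewrite ge0_integralZl//.
- by rewrite lte_mul_pinfty// lee_fin normc_ge0.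
- by apply/measurable_EFinP; exact: cmeasurable_normc.
- by move=> x _; rewrite lee_fin normc_ge0.
- by rewrite lee_fin normc_ge0.
Qed.

Lemma cintegrableD f g : cintegrable f -> cintegrable g ->
  cintegrable (fun x => f x + g x).
Proof.
move=> fi gi; have [mf lf] := fi; have [mg lg] := gi.
apply: (@le_cintegrable _ (fun x => normc (f x) + normc (g x))).
- exact: cmeasurableD.
- by apply: measurable_funD; exact: cmeasurable_normc.
- by move=> x; exact: le_normcD.
- under eq_integral do rewrite EFinD.
  rewrite ge0_integralD//; first exact: lte_add_pinfty.
  + by move=> x _; rewrite lee_fin normc_ge0.
  + by apply/measurable_EFinP; exact: cmeasurable_normc.
  + by move=> x _; rewrite lee_fin normc_ge0.
  + by apply/measurable_EFinP; exact: cmeasurable_normc.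
Qed.

Lemma cintD f g : cintegrable f -> cintegrable g ->
  cint (fun x => f x + g x) = cint f + cint g.
Proof.
move=> fi gi; apply: eq_complexRI => /=.
  under eq_Rintegral do rewrite ReD.
  by rewrite RintegralD//; exact: cintegrable_Re.
under eq_Rintegral do rewrite ImD.
by rewrite RintegralD//; exact: cintegrable_Im.
Qed.

Lemma cintZ c f : cintegrable f -> cint (fun x => c * f x) = c * cint f.
Proof.
move=> fi; have iR := cintegrable_Re fi; have iI := cintegrable_Im fi.
have iZ (r : R) (h : 'rV[R]_n -> R) : (lam n).-integrable setT (fun x => (h x)%:E) ->
   (lam n).-integrable setT (fun x => (r * h x)%:E).
  by move=> hi; exact: (integrableZl measurableT r hi).
apply: eq_complexRI; rewrite /cint.
  rewrite ReM/=; under eq_Rintegral do rewrite ReM.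
  by rewrite RintegralB ?RintegralZl//; exact: iZ.
rewrite ImM/=; under eq_Rintegral do rewrite ImM.
by rewrite RintegralD ?RintegralZl//; exact: iZ.
Qed.

Lemma eq_cint f g : f =1 g -> cint f = cint g.
Proof. by move=> /funext ->. Qed.

(** The factor 2 comes from estimating the real and the imaginary part separately; it only affects
    constants. *)
Lemma normc_cint_le f : cintegrable f ->
  ((normc (cint f))%:E <= 2%:E * \int[lam n]_x (normc (f x))%:E)%E.
Proof.
move=> fi; have iN := cintegrable_normc fi.
have iR := cintegrable_Re fi; have iI := cintegrable_Im fi.
have h (k : R[i] -> R) : (lam n).-integrable setT (fun x => (k (f x))%:E) ->
    (forall z, `|k z| <= normc z) ->
    (`|\int[lam n]_x k (f x)|%:E <= \int[lam n]_x (normc (f x))%:E)%E.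
  move=> ik kn; rewrite EFin_normr_Rintegral//.
  apply: le_trans (le_abse_integral _ _ _) _ => //; first exact: measurable_int ik.
  apply: ge0_le_integral => //.
  - by apply: measurableT_comp => //; exact: measurable_int ik.
  - exact: measurable_int iN.
  - by move=> x _; rewrite lee_fin.
apply: le_trans (_ : _ <= (`|complex.Re (cint f)| + `|complex.Im (cint f)|)%:E)%E _.
  by rewrite lee_fin normc_le_ReIm.
rewrite EFinD mule_natl mule2n; apply: leeD.
  exact: (h (@complex.Re R) iR normr_Re_le).
exact: (h (@complex.Im R) iI normr_Im_le).
Qed.
End cint_theory.

Lemma cmeasurable_cint n d (T : measurableType d) (f : T -> 'rV[R]_n -> R[i]) :
  cmeasurable (fun z : T * 'rV[R]_n => f z.1 z.2) ->
  cmeasurable (fun x => cint (f x)).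
Proof.
have H (g : T -> 'rV[R]_n -> R) : measurable_fun setT (fun z : T * 'rV[R]_n => g z.1 z.2) ->
    measurable_fun setT (fun x => \int[lebesgue_rV R n]_y g x y).
  move=> mg; have mg' : measurable_fun setT (fun z : T * 'rV[R]_n => (g z.1 z.2)%:E).
    exact/measurable_EFinP.
  apply: measurableT_comp; first exact: fine_measurable.
  have -> : (fun x => (\int[lebesgue_rV R n]_y (g x y)%:E)%E) =
     (fun x => \int[lebesgue_rV R n]_y ((fun z => (g z.1 z.2)%:E)^\+ (x, y)) -
        \int[lebesgue_rV R n]_y ((fun z => (g z.1 z.2)%:E)^\- (x, y)))%E.
    apply/funext => x; rewrite integralE; congr (_ - _)%E.
      by apply: eq_integral => y _; rewrite !funeposE.
    by apply: eq_integral => y _; rewrite !funenegE.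
  apply: emeasurable_funB.
    apply: (@measurable_Tonelli_rV R n _ T
      (fun x y => ((fun z => (g z.1 z.2)%:E)^\+ (x, y))%E)) => //.
    rewrite (_ : (fun z => _) = (fun z : T * 'rV[R]_n => (g z.1 z.2)%:E)^\+%E).
      exact: measurable_funepos.
    by apply/funext => -[].
  apply: (@measurable_Tonelli_rV R n _ T
    (fun x y => ((fun z => (g z.1 z.2)%:E)^\- (x, y))%E)) => //.
  rewrite (_ : (fun z => _) = (fun z : T * 'rV[R]_n => (g z.1 z.2)%:E)^\-%E).
    exact: measurable_funeneg.
  by apply/funext => -[].
move=> [m1 m2]; split; first exact: (H (fun x y => complex.Re (f x y))).
exact: (H (fun x y => complex.Im (f x y))).
Qed.

(** Integrability is asked of every section, not of almost every one: the inner integrals are real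
    numbers, and they agree with the extended real integrals of Fubini's theorem where these are
    finite. *)
Lemma cint_Fubini n p (f : 'rV[R]_n -> 'rV[R]_p -> R[i]) :
  cmeasurable (fun z : 'rV[R]_n * 'rV[R]_p => f z.1 z.2) ->
  (\int[lebesgue_rV R n]_x \int[lebesgue_rV R p]_y (normc (f x y))%:E < +oo)%E ->
  (forall x, cintegrable (f x)) -> (forall y, cintegrable (f ^~ y)) ->
  cint (fun x => cint (f x)) = cint (fun y => cint (f ^~ y)).
Proof.
move=> mf fi f1 f2.
have H (k : R[i] -> R) : (forall z, `|k z| <= normc z) ->
    measurable_fun setT (fun z : 'rV[R]_n * 'rV[R]_p => k (f z.1 z.2)) ->
    (forall x, (lebesgue_rV R p).-integrable setT (fun y => (k (f x y))%:E)) ->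
    (forall y, (lebesgue_rV R n).-integrable setT (fun x => (k (f x y))%:E)) ->
    \int[lebesgue_rV R n]_x \int[lebesgue_rV R p]_y k (f x y) =
    \int[lebesgue_rV R p]_y \int[lebesgue_rV R n]_x k (f x y).
  move=> kn mk i1 i2; rewrite /Rintegral.
  have mk' : measurable_fun setT (fun z : 'rV[R]_n * 'rV[R]_p => (k (f z.1 z.2))%:E).
    exact/measurable_EFinP.
  under eq_integral do (rewrite fineK; last exact: integrable_fin_num).
  under [in RHS]eq_integral do (rewrite fineK; last exact: integrable_fin_num).
  congr fine; apply: Fubini_rV => //.
  apply: le_lt_trans fi; apply: ge0_le_integral => //.
  - by move=> x _; exact: integral_ge0.
  - apply: (@measurable_Tonelli_rV R p _ _ (fun x y => `|(k (f x y))%:E|%E)) => //.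
    exact: measurableT_comp.
  - apply: (@measurable_Tonelli_rV R p _ _ (fun x y => (normc (f x y))%:E)) => //.
      by apply/measurable_EFinP; exact: (cmeasurable_normc mf).
    by move=> x y; rewrite lee_fin normc_ge0.
  - move=> x _; apply: ge0_le_integral => //.
    + apply: measurableT_comp => //; exact: measurable_int (i1 x).
    + by apply/measurable_EFinP; apply: cmeasurable_normc; have [] := f1 x.
    + by move=> y _; rewrite abse_EFin lee_fin.
apply: eq_complexRI => /=.
  apply: (H (@complex.Re R)) => //.
  - exact: normr_Re_le.
  - by case: mf.
  - by move=> x; exact: cintegrable_Re.
  - by move=> y; exact: (cintegrable_Re (f2 y)).
apply: (H (@complex.Im R)) => //.
- exact: normr_Im_le.
- by case: mf.
- by move=> x; exact: cintegrable_Im.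
- by move=> y; exact: (cintegrable_Im (f2 y)).
Qed.

End complex_integral.

Section dominated.
Context (R : realType) (n : nat).
Local Notation lam := (lebesgue_rV R n).

Lemma integralZ_real (f : 'rV[R]_n -> R) c :
  measurable_fun setT f -> (forall x, 0 <= f x) -> 0 <= c ->
  (\int[lam]_x (c * f x)%:E = c%:E * \int[lam]_x (f x)%:E)%E.
Proof.
move=> mf f0 c0; under eq_integral do rewrite EFinM.
rewrite ge0_integralZl ?lee_fin//; first exact/measurable_EFinP.
by move=> x _; rewrite lee_fin.
Qed.

Lemma le_integral_real (f g : 'rV[R]_n -> R) :
  measurable_fun setT f -> measurable_fun setT g ->
  (forall x, 0 <= f x) -> (forall x, f x <= g x) ->
  (\int[lam]_x (f x)%:E <= \int[lam]_x (g x)%:E)%E.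
Proof.
move=> mf mg f0 fg; apply: ge0_le_integral => //; try exact/measurable_EFinP.
- by move=> x _; rewrite lee_fin.
- by move=> x _; rewrite lee_fin.
Qed.

Lemma cint_dominated (f : 'rV[R]_n -> R[i]) (g : 'rV[R]_n -> R) C :
  cmeasurable f -> measurable_fun setT g -> (forall x, 0 <= g x) ->
  (\int[lam]_x (g x)%:E < +oo)%E -> 0 <= C -> (forall x, normc (f x) <= C * g x) ->
  cintegrable f /\ normc (cint f) <= 2 * (C * fine (\int[lam]_x (g x)%:E)).
Proof.
move=> mf mg g0 ig C0 fg; set I := (\int[lam]_x _)%E in ig *.
have If : I \is a fin_num by rewrite ge0_fin_numE// integral_ge0// => x _; rewrite lee_fin.
have mCg : measurable_fun setT (fun x => C * g x).
  by apply: measurable_funM => //; exact: measurable_cst.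
have fi : cintegrable f.
  apply: (@le_cintegrable _ _ _ _ mf mCg fg).
  by rewrite integralZ_real// lte_mul_pinfty// lee_fin.
split=> //; rewrite -lee_fin !EFinM (fineK If).
apply: le_trans (normc_cint_le fi) _; apply: lee_wpmul2l; first by rewrite lee_fin.
rewrite -integralZ_real//; apply: le_integral_real => //; first exact: cmeasurable_normc.
by move=> x; exact: normc_ge0.
Qed.

End dominated.

(** * The Fourier transform on the Schwartz space *)

Section fourier_schwartz.
Context (R : realType) (n : nat).
Implicit Types (f : 'rV[R]_n -> R[i]) (zeta : 'rV[R]_n).
Local Notation lam := (lebesgue_rV R n).

Lemma is_schwartzP f : is_schwartz f <->
  rschwartz (fun x => complex.Re (f x)) /\ rschwartz (fun x => complex.Im (f x)).
Proof.
split=> [[[s1 s2] b]|[[s1 b1] [s2 b2]]].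
  split; split=> // al be; have [C HC] := b al be; exists C => x;
    apply: le_trans (HC x); rewrite normrM; apply: ler_wpM2l => //.
    exact: (normr_Re_le (cmderiv be f x)).
  exact: (normr_Im_le (cmderiv be f x)).
split=> [//|al be]; have [A HA] := b1 al be; have [B HB] := b2 al be.
exists (A + B) => x; apply: le_trans (ler_wpM2l (normr_ge0 _) (normc_le_ReIm _)) _.
by rewrite mulrDr -!normrM; apply: lerD; [exact: HA|exact: HB].
Qed.

Lemma fourierE f zeta : fourier f zeta =
  osc (fun x => complex.Re (f x)) (fun x => complex.Im (f x)) zeta +i*
  osc (fun x => complex.Im (f x)) (fun x => - complex.Re (f x)) zeta.
Proof.
rewrite /fourier /cint /osc; congr (_ +i* _); apply: eq_Rintegral => x _.
  by rewrite ReM /osc_integrand/= cosN sinN mulNr opprK.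
by rewrite ImM /osc_integrand/= cosN sinN mulrN mulNr.
Qed.

Lemma is_schwartz_fourier f : is_schwartz f -> is_schwartz (fourier f).
Proof.
move=> /is_schwartzP[s1 s2]; apply/is_schwartzP; split.
  rewrite (_ : (fun x => _) = osc (fun x => complex.Re (f x)) (fun x => complex.Im (f x))).
    exact: rschwartz_of_osc.
  by apply/funext => z; rewrite fourierE.
rewrite (_ : (fun x => _) = osc (fun x => complex.Im (f x)) (fun x => - complex.Re (f x))).
  by apply: rschwartz_of_osc => //; exact: rschwartzN.
by apply/funext => z; rewrite fourierE.
Qed.

Lemma schwartzP (phi : schwartz R n) : is_schwartz phi.
Proof. by have := schwartz_funP phi; rewrite inE. Qed.

Lemma schwartz_fourierE (phi : schwartz R n) :
  schwartz_fourier phi = fourier phi :> ('rV[R]_n -> R[i]).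
Proof.
rewrite /schwartz_fourier -[LHS]/(\val _) insubdK//.
by rewrite inE; apply: is_schwartz_fourier; exact: schwartzP.
Qed.

Lemma schwartz_cmeasurable (phi : schwartz R n) : cmeasurable phi.
Proof.
have [[s1 s2] _] := schwartzP phi.
by split; apply: continuous_measurable_rV; exact: smooth_continuous.
Qed.

Lemma schwartz_Qdecay (phi : schwartz R n) al :
  exists2 C : R, 0 <= C & forall x, `|monom al x| * normc (phi x) <= C * Qdecay x.
Proof.
have [s1 s2] := (is_schwartzP phi).1 (schwartzP phi).
have [A HA] := rschwartz_Qdecay al (fun=> 0%N) s1.
have [B HB] := rschwartz_Qdecay al (fun=> 0%N) s2.
exists `|A + B| => // x.
apply: le_trans (ler_wpM2l (normr_ge0 _) (normc_le_ReIm _)) _.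
rewrite mulrDr -!normrM.
apply: (@le_trans _ _ ((A + B) * Qdecay x)); last first.
  by apply: ler_wpM2r; [exact: Qdecay_ge0|exact: ler_norm].
rewrite mulrDl; apply: lerD; first by have := HA x; rewrite mderiv0.
by have := HB x; rewrite mderiv0.
Qed.

Lemma schwartz_cintegrable (phi : schwartz R n) : cintegrable phi.
Proof.
have [C _ HC] := schwartz_Qdecay phi (fun=> 0%N).
apply: (@le_cintegrable _ _ _ (fun x => C * Qdecay x)).
- exact: schwartz_cmeasurable.
- by apply: measurable_funM; [exact: measurable_cst|exact: measurable_Qdecay].
- by move=> x; have := HC x; rewrite monom0 normr1 mul1r.
- have /integrableP[_] := @integrable_Qdecay R n C.
  apply: le_lt_trans; apply: ge0_le_integral => //.
  + move=> x _; rewrite lee_fin; apply: le_trans (HC x).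
    by rewrite mulr_ge0 ?normc_ge0.
  + apply/measurable_EFinP.
    by apply: measurable_funM; [exact: measurable_cst|exact: measurable_Qdecay].
  + apply: measurableT_comp => //; apply/measurable_EFinP.
    by apply: measurable_funM; [exact: measurable_cst|exact: measurable_Qdecay].
  + by move=> x _; rewrite abse_EFin lee_fin ler_norm.
Qed.
End fourier_schwartz.

(** * A locally integrable function is determined by its pairing with S(R^n) *)

Section schwartz1.
Context (R : realType).

(** [F k] is the [k]-th derivative of [F 0]. Carrying the whole sequence along lets a derivative of
    a tensor product be written by raising an index. *)
Definition schwartz_jet (F : nat -> R -> R) :=
  (forall k (t : R), is_derive t (1 : R) (F k) (F k.+1 t)) /\
  (forall k l, exists C : R, forall t, `|t ^+ l * F k t| <= C).

Section cutoff.
Variables b c d : R.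
Hypothesis b0 : 0 <= b.

(* The functions exp(-t^2 - b exp(d - c t)) are Schwartz; with b = 1,
   c = k^2 and d = k + k^2 r they converge to exp(-t^2) 1_(t > r) as k grows,
   also at t = r, which is why d contains the extra term k. *)
Definition cutoff_exp (t : R) : R := b * expR (d - c * t).
Definition cutoff_term (p : nat * nat) (t : R) : R :=
  t ^+ p.1 * cutoff_exp t ^+ p.2 * expR (- t ^+ 2 - cutoff_exp t).
Definition cutoff_comb (L : seq (R * (nat * nat))) (t : R) : R :=
  \sum_(q <- L) q.1 * cutoff_term q.2 t.

(** With [y = cutoff_exp t], so that [y' = - c y], this lists the terms in the derivative of
    [r t^i y^j exp(- t^2 - y)]. They have the same shape, so the combinations are closed under
    differentiation. For [i = 0] the truncated predecessor is harmless, its coefficient being 0. *)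
Definition cutoff_dterm (q : R * (nat * nat)) : seq (R * (nat * nat)) :=
  let: (r, (i, j)) := q in
  [:: (r * i%:R, (i.-1, j)); (- (r * c * j%:R), (i, j));
      (- (2 * r), (i.+1, j)); (r * c, (i, j.+1))].

Lemma is_derive_cutoff_exp (t : R) : is_derive t (1 : R) cutoff_exp (- c * cutoff_exp t).
Proof.
have h := @is_derive_affine R expR _ (- c) d t (is_derive_expR _).
have := is_deriveZ b h.
rewrite /GRing.scale/= => h2.
have E : cutoff_exp = b \*: (fun t : R => expR (t * - c + d)).
  by apply/funext => s; rewrite /cutoff_exp /GRing.scale/=; congr (b * expR _); ring.
rewrite E; apply: (is_derive_eq h2).
change (b * (- c * expR (t * - c + d)) = - c * (b * expR (t * - c + d))).
by ring.
Qed.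

Lemma is_derive_cutoff_term (p : nat * nat) (t : R) :
  is_derive t (1 : R) (cutoff_term p) (cutoff_comb (cutoff_dterm (1, p)) t).
Proof.
case: p => i j.
have hy := is_derive_cutoff_exp t.
have h1 := is_deriveX i (is_derive_id t (1 : R)).
have h2 := is_deriveX j hy.
have h3 : is_derive t (1 : R) (fun t : R => - t ^+ 2 - cutoff_exp t) (- 2 * t + c * cutoff_exp t).
  apply: (is_derive_eq (is_deriveB (is_deriveN (is_deriveX 2 (is_derive_id t (1 : R)))) hy)).
  by rewrite /GRing.scale/=; ring.
have h4 := @is_derive1_comp R expR _ t _ _ (is_derive_expR _) h3.
have E : cutoff_term (i, j) = (id ^+ i) * (cutoff_exp ^+ j) *
    (expR \o (fun t : R => - t ^+ 2 - cutoff_exp t)).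
  by apply/funext => s; rewrite !fctE.
rewrite E; apply: (is_derive_eq (is_deriveM (is_deriveM h1 h2) h4)).
rewrite /cutoff_comb !big_cons big_nil /cutoff_term /= /GRing.scale/= !fctE mulr1.
set y := cutoff_exp t; set e := expR _.
case: i {h1 E} => [|i]; case: j {h2} => [|j]; rewrite /= ?expr0 ?exprS; ring.
Qed.

Lemma is_derive_cutoff_comb L (t : R) : is_derive t (1 : R) (cutoff_comb L)
  (cutoff_comb (flatten [seq cutoff_dterm q | q <- L]) t).
Proof.
elim: L => [|[r p] L IH] /=.
  rewrite /cutoff_comb big_nil (_ : (fun t => _) = cst 0); first exact: is_derive_cst.
  by apply/funext => s; rewrite big_nil.
have h := is_deriveD (is_deriveZ r (is_derive_cutoff_term p t)) IH.
have E : cutoff_comb ((r, p) :: L) = (r \*: cutoff_term p) + cutoff_comb L.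
  by apply/funext => s; rewrite /cutoff_comb big_cons.
rewrite E; apply: (is_derive_eq h).
rewrite /cutoff_comb big_cat/=; congr (_ + _).
by case: p {h E} => i j; rewrite !big_cons !big_nil /GRing.scale/=; ring.
Qed.

(** Write [exp u] as the power [k + 1] of [exp(u / (k + 1))], which is at least 1 and at least
    [u / (k + 1)]. *)
Lemma pow_expRN_bounded (k : nat) : exists C : R, forall u, 0 <= u -> u ^+ k * expR (- u) <= C.
Proof.
exists (k.+1%:R ^+ k) => u u0.
have h := expR_ge1Dx (u / k.+1%:R).
have k0 : 0 < k.+1%:R :> R by [].
have uk : 0 <= u / k.+1%:R by rewrite divr_ge0// ltW.
have e1 : expR u = expR (u / k.+1%:R) ^+ k.+1.
  by rewrite -expRM_natl mulrC divfK// gt_eqF.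
rewrite expRN ler_pdivrMr ?expR_gt0// e1 -ler_pdivrMl ?exprn_gt0// mulrC -exprVn -exprMn.
apply: le_trans (_ : _ <= expR (u / k.+1%:R) ^+ k) _.
  apply: lerXn2r; rewrite ?nnegrE ?expR_ge0//.
  by apply: le_trans h; rewrite lerDr.
by rewrite exprS ler_peMl ?exprn_ge0 ?expR_ge0// (le_trans _ h)// lerDl.
Qed.

Lemma cutoff_exp_ge0 t : 0 <= cutoff_exp t.
Proof. by rewrite mulr_ge0 ?expR_ge0. Qed.

(** The bound splits into one for [|t|^(l + i) exp(- t^2)] and one for [y^j exp(- y)] with [y >= 0].
    In the first, [|t| <= 1] is trivial, and for larger [|t|] the power is at most the same power of
    [t^2]. *)
Lemma cutoff_term_bounded l p : exists C : R, forall t, `|t ^+ l * cutoff_term p t| <= C.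
Proof.
case: p => i j.
have [A HA] := pow_expRN_bounded (l + i)%N; have [B HB] := pow_expRN_bounded j.
have B0 : 0 <= B.
  by apply: le_trans (HB 0 (lexx _)); rewrite mulr_ge0 ?exprn_ge0 ?expR_ge0.
have A0 : 0 <= A.
  by apply: le_trans (HA 0 (lexx _)); rewrite mulr_ge0 ?exprn_ge0 ?expR_ge0.
exists ((1 + A) * B) => t; rewrite /cutoff_term/=.
have y0 := cutoff_exp_ge0 t.
rewrite expRD !mulrA -exprD !normrM !normrX.
rewrite (ger0_norm (expR_ge0 _)) (ger0_norm (expR_ge0 _)) (ger0_norm y0).
have -> : `|t| ^+ (l + i) * cutoff_exp t ^+ j * expR (- t ^+ 2) * expR (- cutoff_exp t) =
    (`|t| ^+ (l + i) * expR (- t ^+ 2)) * (cutoff_exp t ^+ j * expR (- cutoff_exp t)) by ring.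
apply: ler_pM.
- by rewrite !mulr_ge0 ?exprn_ge0 ?expR_ge0.
- by rewrite !mulr_ge0 ?exprn_ge0 ?expR_ge0.
- have [t1|t1] := lerP `|t| 1.
    apply: (@le_trans _ _ 1); last by rewrite lerDl.
    rewrite mulr_ile1 ?exprn_ge0 ?expR_ge0 ?exprn_ile1//.
    by rewrite -expR0 ler_expR lerNl oppr0 sqr_ge0.
  apply: (@le_trans _ _ A); last by rewrite lerDr.
  have := HA (t ^+ 2) (sqr_ge0 _); apply: le_trans.
  apply: ler_wpM2r; first exact: expR_ge0.
  rewrite -(real_normK (num_real t)) exprAC -exprM muln2 -addnn [leRHS]exprD.
  by rewrite ler_peMr ?exprn_ge0// exprn_ege1// ltW.
- exact: HB.
Qed.

Lemma cutoff_comb_bounded l L : exists C : R, forall t, `|t ^+ l * cutoff_comb L t| <= C.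
Proof.
elim: L => [|[r p] L [A HA]].
  by exists 0 => t; rewrite /cutoff_comb big_nil mulr0 normr0.
have [B HB] := cutoff_term_bounded l p.
exists (`|r| * B + A) => t; rewrite /cutoff_comb big_cons mulrDr.
apply: le_trans (ler_normD _ _) _; apply: lerD; last exact: HA.
by rewrite mulrCA normrM ler_wpM2l.
Qed.

Lemma schwartz_jet_cutoff : exists2 F, schwartz_jet F &
  F 0%N = fun t => expR (- t ^+ 2 - cutoff_exp t).
Proof.
pose L := fix L k := if k is k'.+1 then flatten [seq cutoff_dterm q | q <- L k']
  else [:: ((1 : R), (0%N, 0%N))].
exists (fun k => cutoff_comb (L k)); first split=> [k t|k l].
- exact: is_derive_cutoff_comb.
- exact: cutoff_comb_bounded.
apply/funext => t.
by rewrite /cutoff_comb big_seq1 /cutoff_term/= expr0 !mul1r.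
Qed.
End cutoff.
End schwartz1.

Section tensor.
Context (R : realType) (n : nat).
Implicit Types (F : 'I_n -> nat -> R -> R).

Lemma is_derive_tensor j (g : 'I_n -> R -> R) (dg : R) (x : 'rV[R]_n) :
  is_derive (x ord0 j) (1 : R) (g j) dg ->
  is_derive x (delta_mx ord0 j : 'rV[R]_n) (fun x : 'rV[R]_n => \prod_(i < n) g i (x ord0 i))
    (dg * \prod_(i < n | i != j) g i (x ord0 i)).
Proof.
move=> [d1 e1].
have H1 (h : R) : (h *: delta_mx ord0 j + x : 'rV[R]_n) ord0 j = h *: (1 : R) + x ord0 j.
  by rewrite add_scale_deltaE eqxx.
pose G (y : 'rV[R]_n) := \prod_(i < n | i != j) g i (y ord0 i).
have H2 (h : R) : G (h *: delta_mx ord0 j + x) = h *: (0 : R) + G x.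
  rewrite scaler0 add0r; apply: eq_bigr => i /negbTE ij.
  by rewrite add_scale_deltaE ij mulr0 add0r.
have dA := @derivable_comp_affine R _ _ (fun y : 'rV[R]_n => y ord0 j) (g j) x
  (delta_mx ord0 j) (1 : R) H1 d1.
have eA := @derive_comp_affine R _ _ (fun y : 'rV[R]_n => y ord0 j) (g j) x
  (delta_mx ord0 j) (1 : R) H1.
have dB : derivable G x (delta_mx ord0 j).
  apply: (@derivable_comp_affine R _ _ G id x (delta_mx ord0 j) (0 : R) H2).
  exact: derivable_id.
have eB : 'D_(delta_mx ord0 j) G x = 0.
  rewrite (@derive_comp_affine R _ _ G id x (delta_mx ord0 j) (0 : R) H2).
  exact: derive_id.
have E : (fun x : 'rV[R]_n => \prod_(i < n) g i (x ord0 i)) =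
   (fun x => g j (x ord0 j) * G x).
  by apply/funext => y; rewrite (bigD1 j).
rewrite E; split; first exact: (derivable_rVM dA dB).
have := pderivM dA dB; rewrite /pderiv => ->.
by rewrite eA eB e1 mulr0 addr0.
Qed.

Lemma continuous_tensor (g : 'I_n -> R -> R) : (forall i, continuous (g i)) ->
  continuous (fun x : 'rV[R]_n => \prod_(i < n) g i (x ord0 i)).
Proof.
move=> cg; elim: (index_enum 'I_n) => [|i L IH].
  rewrite (_ : (fun _ => _) = cst 1); first exact: cst_continuous.
  by apply/funext => x; rewrite big_nil.
rewrite (_ : (fun _ => _) = (fun x : 'rV[R]_n => g i (x ord0 i) *
    \prod_(i <- L) g i (x ord0 i))).
  apply: continuous_rVM => // x.
  by apply: (@continuous_comp _ _ _ (fun x : 'rV[R]_n => x ord0 i) (g i));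
    [exact: continuous_coord|exact: cg].
by apply/funext => x; rewrite big_cons.
Qed.

(** An iterated derivative replaces [F i 0] by [F i k], where [k] counts the occurrences of [i] in
    the list; the bounds in the single variables then multiply. *)
Lemma tensor_rschwartz F : (forall i, schwartz_jet (F i)) ->
  rschwartz (fun x : 'rV[R]_n => \prod_(i < n) F i 0%N (x ord0 i)).
Proof.
move=> sF.
have E s : iter_pderiv s (fun x : 'rV[R]_n => \prod_(i < n) F i 0%N (x ord0 i)) =
    fun x => \prod_(i < n) F i (count_mem i s) (x ord0 i).
  elim: s => [//|j s IH] /=; rewrite -/(iter_pderiv s _) IH; apply/funext => x.
  have [h _] := sF j.
  have [_ e] := @is_derive_tensor j (fun i => F i (count_mem i s)) _ x (h _ (x ord0 j)).
  apply: (etrans e); rewrite [RHS](bigD1 j)//= eqxx add1n; congr (_ * _).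
  by apply: eq_bigr => i ij; rewrite eq_sym (negbTE ij).
split=> [s|al be].
  rewrite E; split=> [|j x].
    apply: (@continuous_tensor (fun i => F i (count_mem i s))) => i t; have [h _] := sF i.
    by have [/derivable1_diffP/differentiable_continuous] := h (count_mem i s) t.
  have [h _] := sF j.
  by have [] := @is_derive_tensor j (fun i => F i (count_mem i s)) _ x (h _ (x ord0 j)).
have /choice[C HC] : forall i, exists C : R, forall t, `|t ^+ (al i) * F i (be i) t| <= C.
  by move=> i; have [_ h] := sF i; exact: h.
exists (\prod_(i < n) C i) => x; rewrite /mderiv E /monom -big_split/= normr_prod.
apply: ler_prod => i _; rewrite normr_ge0/= count_mseq; exact: HC.
Qed.
End tensor.

Section orthants.
Context (R : realType) (n : nat).

(** [None] stands for the bound minus infinity. It makes the whole space and the open half-spaces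
    into orthants, so that these form a family stable under intersection which generates the
    sigma-algebra. *)
Definition above (o : option R) (t : R) : bool := if o is Some c then c < t else true.
Definition orthant (a : 'I_n -> option R) : set 'rV[R]_n :=
  [set x | forall i, above (a i) (x ord0 i)].

Lemma measurable_orthant a : measurable (orthant a).
Proof.
rewrite (_ : orthant a = \big[setI/setT]_(i < n) [set x : 'rV[R]_n | above (a i) (x ord0 i)]).
  apply: bigsetI_measurable => i _; rewrite /above; case: (a i) => [c|].
    have := @measurable_rV_itv R n i `]c, +oo[%R.
    by congr measurable; apply/seteqP; split=> x /=; rewrite in_itv/= andbT.
  by rewrite (_ : [set _ | _] = setT)//; apply/seteqP; split.
rewrite -bigcap_seq; apply/seteqP; split=> x /= h => [i _|i]; first exact: h.
by apply: h => /=; rewrite mem_index_enum.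
Qed.

Lemma setI_closed_orthant : setI_closed (range orthant).
Proof.
move=> _ _ [a _ <-] [b _ <-].
exists (fun i => match a i, b i with
  | Some c, Some d => Some (Num.max c d) | Some c, None => Some c | None, o => o end) => //.
apply/seteqP; split=> x /=.
  move=> h; split=> i; have := h i; case: (a i) => [c|]; case: (b i) => [d|] //=.
    by rewrite gt_max => /andP[].
  by rewrite gt_max => /andP[].
move=> [h1 h2] i; have := h1 i; have := h2 i; case: (a i) => [c|]; case: (b i) => [d|] //=.
by rewrite gt_max => -> ->.
Qed.

Lemma measurable_orthantsE : @measurable _ 'rV[R]_n = <<s range orthant >>.
Proof.
apply/seteqP; split; last first.
  apply: smallest_sub; first exact: sigma_algebra_measurable.
  by move=> _ [a _ <-]; exact: measurable_orthant.
apply: smallest_sub; first exact: smallest_sigma_algebra.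
rewrite -bigcup_seq => A [i /= _ [B mB <-]].
have mi : measurable_fun [set: g_sigma_algebraType (range orthant)]
    (fun x : g_sigma_algebraType (range orthant) => (x : 'rV[R]_n) ord0 i).
  apply: (@measurability _ _ (g_sigma_algebraType (range orthant)) (measurableTypeR R)
    setT _ _ (RGenOInfty.measurableE R)) => _ [_ [c ->] <-].
  rewrite setTI; apply: sub_sigma_algebra.
  exists (fun k => if k == i then Some c else None) => //.
  apply/seteqP; split=> x /=; rewrite in_itv/= andbT.
    by move=> /(_ i); rewrite eqxx.
  by move=> h k; case: eqP => // ->.
exact: (mi measurableT B mB).
Qed.
End orthants.

Section uniqueness.
Context (R : realType) (n : nat).
Local Notation lam := (lebesgue_rV R n).

Definition cut_b (o : option R) : R := if o is Some _ then 1 else 0.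
Definition cut_fun (o : option R) (k : nat) (t : R) : R :=
  expR (- t ^+ 2 - cutoff_exp (cut_b o) (k%:R ^+ 2) (k%:R + k%:R ^+ 2 * odflt 0 o) t).

Lemma cut_fun_le o k t : 0 <= cut_fun o k t <= expR (- t ^+ 2).
Proof.
rewrite expR_ge0/= ler_expR lerBlDr lerDl; apply: cutoff_exp_ge0.
by rewrite /cut_b; case: o.
Qed.

(** For [o = Some a] the inner exponent is [k - k^2 (t - a)]: it tends to minus infinity for
    [t > a], and it is at least [k] for [t <= a]. *)
Lemma cut_fun_cvg o t : cut_fun o k t @[k --> \oo] -->
  expR (- t ^+ 2) * (above o t)%:R.
Proof.
pose y k := cutoff_exp (cut_b o) (k%:R ^+ 2) (k%:R + k%:R ^+ 2 * odflt 0 o) t.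
have E k : cut_fun o k t = expR (- t ^+ 2) * expR (- y k) by rewrite -expRD.
under eq_fun do rewrite E.
apply: cvgMr; rewrite /y /cutoff_exp; case: o {y E} => [a|] /=; last first.
  under eq_fun do rewrite mul0r oppr0 expR0; exact: cvg_cst.
have yE k : k%:R + k%:R ^+ 2 * a - k%:R ^+ 2 * t = k%:R - k%:R ^+ 2 * (t - a) :> R by ring.
under eq_fun do rewrite mul1r yE.
have [at_|ta] := ltP a t.
  have e0 : 0 < t - a by rewrite subr_gt0.
  apply: (@squeeze_cvgr _ \oo _ R (fun k => 1 - expR (- k%:R)) (cst 1)); last 2 first.
  - rewrite -[X in _ --> X](subr0 (1:R)); apply: cvgB; first exact: cvg_cst.
    exact: cvgn_expR.
  - exact: cvg_cst.
  near=> k.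
  (* With this, [k - k^2 (t - a) <= k - 2 k = - k]. *)
  have h : 2 <= k%:R * (t - a).
    rewrite -ler_pdivrMr//; near: k.
    exists (Num.truncn (2 / (t - a))).+1 => // m /= hm.
    by apply: le_trans (ltW (truncnS_gt _)) _; rewrite ler_nat.
  have yk : expR (k%:R - k%:R ^+ 2 * (t - a)) <= expR (- k%:R).
    rewrite ler_expR expr2 -mulrA lerBlDr -[leLHS]subr0 -mulrN1.
    have := ler_wpM2l (ler0n R k) h; lra.
  apply/andP; split; last by rewrite -expR0 ler_expR lerNl oppr0 expR_ge0.
  apply: le_trans (expR_ge1Dx _); rewrite lerD2l lerN2; exact: yk.
apply: (@squeeze_cvgr _ \oo _ R (cst 0) (fun k => expR (- k%:R))); last 2 first.
- exact: cvg_cst.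
- exact: cvgn_expR.
near=> k; rewrite expR_ge0/= ler_expR lerN2.
have h := expR_ge1Dx (k%:R : R).
apply: (@le_trans _ _ (expR k%:R)); first by apply: le_trans h; rewrite lerDr.
rewrite ler_expR lerBrDr -[leRHS]addr0 lerD2l.
by rewrite mulr_ge0_le0// ?sqr_ge0// subr_le0.
Unshelve. all: end_near. Qed.

Definition gauss_rV (x : 'rV[R]_n) : R := \prod_(i < n) expR (- x ord0 i ^+ 2).
Definition cut_rV (a : 'I_n -> option R) k (x : 'rV[R]_n) : R :=
  \prod_(i < n) cut_fun (a i) k (x ord0 i).

Lemma cut_rV_rschwartz a k : rschwartz (cut_rV a k).
Proof.
have H i : exists F, schwartz_jet F /\ F 0%N = cut_fun (a i) k.
  have [|F sF F0] := @schwartz_jet_cutoff R (cut_b (a i)) (k%:R ^+ 2)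
    (k%:R + k%:R ^+ 2 * odflt 0 (a i)).
    by rewrite /cut_b; case: (a i).
  by exists F.
have [F HF] := choice H.
have := @tensor_rschwartz R n F (fun i => (HF i).1).
congr rschwartz; apply/funext => x; apply: eq_bigr => i _.
by rewrite (HF i).2.
Qed.

Lemma gauss_rV_gt0 x : 0 < gauss_rV x.
Proof. by apply: prodr_gt0 => i _; exact: expR_gt0. Qed.

Lemma gauss_rV_cut : gauss_rV = cut_rV (fun=> None) 0.
Proof.
apply/funext => x; apply: eq_bigr => i _.
by rewrite /cut_fun /cutoff_exp mul0r subr0.
Qed.

Lemma cut_rV_cvg a x : cut_rV a k x @[k --> \oo] -->
  gauss_rV x * (x \in orthant a)%:R.
Proof.
have -> : gauss_rV x * (x \in orthant a)%:R =
    \prod_(i < n) (expR (- x ord0 i ^+ 2) * (above (a i) (x ord0 i))%:R).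
  rewrite big_split/=; congr (_ * _).
  have [xa|xa] := pselect (orthant a x).
    rewrite mem_set// big1// => i _; by rewrite (xa i).
  rewrite memNset//; have /existsNP[i hi] := xa.
  by rewrite (bigD1 i)//= (negbTE (introN idP hi)) mul0r.
rewrite /cut_rV; elim: (index_enum 'I_n) => [|i L IH].
  by rewrite big_nil; under eq_fun do rewrite big_nil; exact: cvg_cst.
rewrite big_cons; under eq_fun do rewrite big_cons.
by apply: cvgM => //; exact: cut_fun_cvg.
Qed.

Lemma cut_rV_le a k x : 0 <= cut_rV a k x <= gauss_rV x.
Proof.
apply/andP; split.
  by apply: prodr_ge0 => i _; have /andP[] := cut_fun_le (a i) k (x ord0 i).
by apply: ler_prod => i _; exact: cut_fun_le.
Qed.

(** Testing against [cut_rV a k] and letting [k] grow shows that [r] times a Gaussian has integral 0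
    over each orthant, hence over each measurable set by Dynkin's theorem. The product therefore
    vanishes almost everywhere, and the Gaussian is positive. Its presence provides integrability,
    which [r] alone need not have. *)
Lemma rschwartz_test_eq0 (r : 'rV[R]_n -> R) : measurable_fun setT r ->
  (forall u, rschwartz u -> lam.-integrable setT (fun x => (r x * u x)%:E) /\
     (\int[lam]_x (r x * u x)%:E = 0)%E) ->
  {ae lam, forall x, r x = 0}.
Proof.
move=> mr Hr.
have mG : measurable_fun setT gauss_rV.
  rewrite gauss_rV_cut; apply: continuous_measurable_rV; apply: smooth_continuous.
  by case: (cut_rV_rschwartz (fun=> None) 0).
pose h x : \bar R := (r x * gauss_rV x)%:E.
have ih : lam.-integrable setT h.
  by rewrite /h gauss_rV_cut; exact: (Hr _ (cut_rV_rschwartz _ _)).1.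
have mh := measurable_int _ ih.
have P0 a : (\int[lam]_(x in orthant a) h x = 0)%E.
  have L : (\int[lam]_x (r x * cut_rV a k x)%:E)%E @[k --> \oo] -->
      (\int[lam]_x (h \_ (orthant a)) x)%E.
    apply: (@dominated_cvg _ _ _ lam setT measurableT
       (fun k x => (r x * cut_rV a k x)%:E) _ (abse \o h)) => //.
    - by move=> k; have [i1 _] := Hr _ (cut_rV_rschwartz a k); exact: measurable_int i1.
    - move=> x _.
      rewrite (_ : (h \_ (orthant a)) x = (r x * (gauss_rV x * (x \in orthant a)%:R))%:E).
        apply: cvg_EFin; first exact: nearW.
        by apply: cvgMr; exact: cut_rV_cvg.
      by rewrite patchE; case: ifPn => _; rewrite ?mulr1 ?mulr0.
    - exact: integrable_abse.
    - move=> k x _; rewrite /h /= lee_fin !normrM ler_wpM2l//.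
      have /andP[c0 c1] := cut_rV_le a k x.
      by rewrite !ger0_norm// (le_trans c0).
  rewrite integral_mkcond; apply/esym.
  have E : (fun k => (\int[lam]_x (r x * cut_rV a k x)%:E)%E) = cst 0%E.
    by apply/funext => k; have [_] := Hr _ (cut_rV_rschwartz a k).
  rewrite E in L; exact: (cvg_unique _ (cvg_cst _) L).
have PA A : measurable A -> (\int[lam]_(x in A) h x = 0)%E.
  have PT : (\int[lam]_x h x = 0)%E.
    rewrite -(P0 (fun=> None)); congr (integral _ _ _).
    by apply/seteqP; split.
  rewrite measurable_orthantsE.
  apply: (@dynkin_induction _ _ (range (@orthant R n))
    (fun A => (\int[lam]_(x in A) h x = 0)%E)) => //.
  - exact: measurable_orthantsE.
  - exact: setI_closed_orthant.
  - by move=> _ [a _ <-]; exact: P0.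
  - move=> S mS S0.
    have := PT; rewrite -(setUv S) integral_setU//.
    + by rewrite S0 add0e.
    + exact: measurableC.
    + by rewrite setUv.
    + by apply/disj_setPCl.
  - move=> F mF tF F0.
    rewrite integral_bigcup//; first by apply: eseries0 => k _ _; exact: F0.
    by apply: integrableS ih => //; exact: bigcupT_measurable.
have := @integral_ae_eq _ _ _ lam setT measurableT (cst 0%E) h ih.
move=> /(_ (measurable_cst _)) H.
have /H : forall E, E `<=` setT -> measurable E ->
    (\int[lam]_(x in E) h x = \int[lam]_(x in E) cst 0%E x)%E.
  by move=> E _ mE; rewrite integral0 PA.
apply: filterS => x /(_ I) [/eqP]; rewrite mulf_eq0 => /orP[/eqP //|].
by rewrite gt_eqF// gauss_rV_gt0.
Qed.
End uniqueness.

Section is_function_theory.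
Context (R : realType) (n : nat).
Local Notation lam := (lebesgue_rV R n).
Implicit Types (f g : 'rV[R]_n -> R[i]) (v w : schwartz R n -> R[i]).

Lemma ReZC (z : R[i]) (r : R) : complex.Re (z * r%:C) = complex.Re z * r.
Proof. by case: z => x y /=; rewrite mulr0 subr0. Qed.

Lemma ImZC (z : R[i]) (r : R) : complex.Im (z * r%:C) = complex.Im z * r.
Proof. by case: z => x y /=; rewrite mulr0 add0r. Qed.

Lemma is_schwartz_real (u : 'rV[R]_n -> R) : rschwartz u -> is_schwartz (fun x => (u x)%:C).
Proof.
move=> su; apply/is_schwartzP; split; first exact: su.
exact: rschwartz0.
Qed.

Lemma is_function_cmeasurable v f : is_function v f -> cmeasurable f.
Proof. by case. Qed.

Lemma is_function_cintegrable v f (phi : schwartz R n) : is_function v f ->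
  cintegrable (fun x => f x * phi x).
Proof.
move=> [m1 m2 H]; split.
  by apply: cmeasurableM; [split|exact: schwartz_cmeasurable].
have /integrableP[_] := (H phi).1.
by under eq_integral do rewrite gee0_abs ?lee_fin ?normc_ge0//.
Qed.

Lemma is_functionE v f (phi : schwartz R n) : is_function v f ->
  v phi = cint (fun x => f x * phi x).
Proof. by move=> [_ _ H]; exact: (H phi).2. Qed.

(** In the proof [k] is the real or the imaginary part. Both commute with multiplication by a real
    test function, which reduces the claim to real functions. *)
Lemma is_function_unique v f g : is_function v f -> is_function v g ->
  {ae lam, forall x, f x = g x}.
Proof.
move=> vf vg.
have H (k : R[i] -> R) (km : forall (z : R[i]) (r : R), k (z * r%:C) = k z * r) :
   (forall h : 'rV[R]_n -> R[i], cintegrable h -> lam.-integrable setT (fun x => (k (h x))%:E)) ->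
   (forall h : 'rV[R]_n -> R[i], k (cint h) = \int[lam]_x k (h x)) ->
   measurable_fun setT (fun x => k (f x)) -> measurable_fun setT (fun x => k (g x)) ->
   {ae lam, forall x, k (f x) = k (g x)}.
  move=> ki kc mf mg.
  have : {ae lam, forall x, k (f x) - k (g x) = 0}.
    apply: rschwartz_test_eq0; first exact: measurable_funB.
    move=> u su.
    have hphi : (fun x => (u x)%:C) \in @schwartz_pred R n.
      by rewrite inE; exact: is_schwartz_real.
    pose phi := Schwartz hphi.
    have i1 := ki _ (is_function_cintegrable phi vf).
    have i2 := ki _ (is_function_cintegrable phi vg).
    have e1 := is_functionE phi vf; have e2 := is_functionE phi vg.
    have E : (fun x => ((k (f x) - k (g x)) * u x)%:E) =
      ((fun x => (k (f x * phi x))%:E) \- (fun x => (k (g x * phi x))%:E))%E.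
      by apply/funext => x; rewrite !km -EFinB mulrBl.
    rewrite E; split; first exact: integrableB.
    rewrite integralB_EFin//.
    have F1 h (ih : lam.-integrable setT (fun x => (k (h x))%:E)) :
        (\int[lam]_x (k (h x))%:E)%E = (k (cint h))%:E.
      by rewrite kc /Rintegral fineK//; apply: integrable_fin_num.
    by rewrite (F1 _ i1) (F1 _ i2) -e1 -e2 -EFinB subrr.
  by apply: filterS => x /eqP; rewrite subr_eq0 => /eqP.
have [mf1 mf2] := is_function_cmeasurable vf; have [mg1 mg2] := is_function_cmeasurable vg.
have hR := H (@complex.Re R) ReZC (@cintegrable_Re R n) (fun=> erefl) mf1 mg1.
have hI := H (@complex.Im R) ImZC (@cintegrable_Im R n) (fun=> erefl) mf2 mg2.
apply: filterS2 hR hI => x; exact: eq_complexRI.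
Qed.

Lemma ae_eq_cint f g : cmeasurable f -> cmeasurable g ->
  {ae lam, forall x, f x = g x} -> cint f = cint g.
Proof.
move=> [mf1 mf2] [mg1 mg2] fg; rewrite /cint /Rintegral.
congr (fine _ +i* fine _); apply: ae_eq_integral => //; try exact/measurable_EFinP.
  by apply: filterS fg => x -> _.
by apply: filterS fg => x -> _.
Qed.

Lemma is_function_lin (c : R[i]) v w f g :
  is_function v f -> is_function w g ->
  is_function (fun phi => c * v phi + w phi) (fun x => c * f x + g x).
Proof.
move=> vf wg.
have mfg : cmeasurable (fun x => c * f x + g x).
  apply: cmeasurableD; last exact: is_function_cmeasurable wg.
  by apply: cmeasurableM; [exact: cmeasurable_cst|exact: is_function_cmeasurable vf].
have [m1 m2] := mfg.
split => // phi.
have i1 := is_function_cintegrable phi vf; have i2 := is_function_cintegrable phi wg.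
have E x : (c * f x + g x) * phi x = c * (f x * phi x) + g x * phi x.
  by rewrite mulrDl mulrA.
have i3 := cintegrableD (cintegrableZ c i1) i2.
split.
  have := cintegrable_normc i3.
  by under eq_fun do rewrite -E.
rewrite (eq_cint E) cintD ?cintZ//; last exact: cintegrableZ.
by rewrite (is_functionE phi vf) (is_functionE phi wg).
Qed.

Lemma fourier_funP (u : tempered R n) :
  (exists f, is_function (tempered_fourier u) f) ->
  is_function (tempered_fourier u) (fourier_fun u).
Proof. by move=> H; rewrite /fourier_fun; exact: (xgetPex (cst 0) H). Qed.

Lemma fourier_fun_unique (u : tempered R n) f :
  is_function (tempered_fourier u) f -> {ae lam, forall x, fourier_fun u x = f x}.
Proof.
by move=> uf; exact: (is_function_unique (fourier_funP (ex_intro _ f uf)) uf).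
Qed.
End is_function_theory.

(** * Quasi-homogeneous weights *)

Section weights.
Context (R : realType) (n : nat) (mu : 'I_n -> nat).
Hypothesis n0 : (0 < n)%N.
Hypothesis mu0 : forall j, (0 < mu j)%N.
Local Notation B := (@Mbracket R n mu).
Implicit Types x y z : 'rV[R]_n.

Lemma MbracketE z : B z = Num.sqrt (1 + \sum_(j < n) (`|z ord0 j| ^+ mu j) ^+ 2).
Proof.
rewrite /Mbracket /Mnorm sqr_sqrtr; last first.
  by apply: sumr_ge0 => j _; rewrite exprn_ge0.
by congr (Num.sqrt (1 + _)); apply: eq_bigr => j _; rewrite mulnC exprM.
Qed.

Lemma Mbracket_sqr z : B z ^+ 2 = 1 + \sum_(j < n) (`|z ord0 j| ^+ mu j) ^+ 2.
Proof.
rewrite MbracketE sqr_sqrtr// addr_ge0// sumr_ge0//.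
Qed.

Lemma Mbracket_ge1 z : 1 <= B z.
Proof.
rewrite MbracketE -[leLHS]sqrtr1 ler_wsqrtr// lerDl sumr_ge0//.
Qed.

Lemma Mbracket_gt0 z : 0 < B z.
Proof. exact: lt_le_trans (Mbracket_ge1 z). Qed.

Lemma MbracketN z : B (- z) = B z.
Proof.
by rewrite !MbracketE; congr (Num.sqrt (1 + _)); apply: eq_bigr => j _; rewrite mxE normrN.
Qed.

(** Rests on [|t + u| <= 2 max(|t|, |u|)], raised to the power [mu_j]; this is where the constant
    [2 ^ L] with [mu_j <= L] originates. *)
Lemma Mbracket_quasi_triangle : exists2 C : R, 1 <= C &
  forall x y, B (x + y) <= C * (B x + B y).
Proof.
pose L := (\sum_(j < n) mu j)%N.
have muL j : (mu j <= L)%N by rewrite /L (bigD1 j)//= leq_addr.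
have L1 : 1 <= 2 ^+ L :> R by rewrite exprn_ege1// ler1n.
exists (2 ^+ L * 2) => [|x y]; first by rewrite mulr_ege1// ler1n.
have Bx := Mbracket_ge1 x; have By := Mbracket_ge1 y.
rewrite -(@ler_pXn2r _ 2)// ?nnegrE; [|exact: ltW (Mbracket_gt0 _)|]; last first.
  by rewrite !mulr_ge0 ?exprn_ge0// addr_ge0// ltW// Mbracket_gt0.
have h t u j : (`|t + u| ^+ mu j) ^+ 2 <=
    (2 ^+ L * 2) ^+ 2 * ((`|t| ^+ mu j) ^+ 2 + (`|u| ^+ mu j) ^+ 2) :> R.
  have m0 : 0 <= Num.max `|t| `|u| by rewrite le_max normr_ge0.
  apply: (@le_trans _ _ (((2 * Num.max `|t| `|u|) ^+ mu j) ^+ 2)).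
    rewrite -!exprM; apply: lerXn2r; rewrite ?nnegrE ?mulr_ge0//.
    apply: le_trans (ler_normD _ _) _; rewrite mulr_natl mulr2n.
    by apply: lerD; rewrite le_max lexx ?orbT.
  rewrite exprMn exprMn; apply: ler_pM.
  - by rewrite exprn_ge0// exprn_ge0.
  - by rewrite exprn_ge0// exprn_ge0.
  - apply: lerXn2r; rewrite ?nnegrE ?mulr_ge0 ?exprn_ge0//.
    apply: le_trans (_ : _ <= 2 ^+ L) _; first by rewrite ler_eXn2l ?ltr1n.
    by rewrite ler_peMr ?exprn_ge0// ler1n.
  - have [tu|ut] := leP `|t| `|u|; first by rewrite lerDr exprn_ge0// exprn_ge0.
    by rewrite lerDl exprn_ge0// exprn_ge0.
rewrite Mbracket_sqr exprMn.
apply: (@le_trans _ _ ((2 ^+ L * 2) ^+ 2 * (B x ^+ 2 + B y ^+ 2))).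
  rewrite !Mbracket_sqr addrACA -big_split mulrDr mulr_sumr; apply: lerD.
    rewrite -[leLHS]mulr1; apply: ler_pM => //; last by rewrite lerDl.
    by rewrite exprn_ege1// mulr_ege1// ler1n.
  by apply: ler_sum => j _; rewrite mxE; exact: h.
rewrite ler_pM2l; last by rewrite exprn_gt0// mulr_gt0// exprn_gt0.
have h0 : 0 <= B x * B y *+ 2 by rewrite mulrn_wge0// mulr_ge0 ?(ltW (Mbracket_gt0 _)).
by rewrite sqrrD; lra.
Qed.

Lemma Mbracket_le_sum z : B z <= 1 + \sum_(j < n) `|z ord0 j| ^+ mu j.
Proof.
have S0 : 0 <= \sum_(j < n) `|z ord0 j| ^+ mu j by apply: sumr_ge0 => j _; rewrite exprn_ge0.
rewrite -(@ler_pXn2r _ 2)// ?nnegrE; [|exact: ltW (Mbracket_gt0 _)|by rewrite addr_ge0].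
rewrite Mbracket_sqr sqrrD expr1n.
have : \sum_(j < n) (`|z ord0 j| ^+ mu j) ^+ 2 <= (\sum_(j < n) `|z ord0 j| ^+ mu j) ^+ 2.
  rewrite [leRHS]expr2 mulr_suml; apply: ler_sum => j _.
  rewrite expr2; apply: ler_wpM2l; first by rewrite exprn_ge0.
  by rewrite (bigD1 j)//= lerDl sumr_ge0// => i _; rewrite exprn_ge0.
by rewrite mul1r => h; move: S0 h; lra.
Qed.

(** Converts [N mu_j] integrations by parts in each single variable into decay of order [N] in the
    bracket. A sum of [n + 1] terms is at most [n + 1] times the largest one, whence the
    constant. *)
Lemma MbracketX_le N : exists2 C : R, 0 <= C & forall z,
  B z ^+ N <= C * (1 + \sum_(j < n) `|z ord0 j| ^+ (N * mu j)).
Proof.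
exists (n.+1%:R ^+ N) => [|z]; first by rewrite exprn_ge0.
pose b j := `|z ord0 j| ^+ mu j.
have b0 j : 0 <= b j by rewrite exprn_ge0.
have [j _ jmax] := @arg_maxP _ _ _ (Ordinal n0) predT b isT.
pose M := Num.max 1 (b j).
have M1 : 1 <= M by rewrite le_max lexx.
have bM i : b i <= M by have /= h := jmax i isT; rewrite le_max h orbT.
have h1 : B z <= n.+1%:R * M.
  apply: le_trans (Mbracket_le_sum z) _; rewrite -natr1 mulrDl mul1r addrC; apply: lerD => //.
  apply: (@le_trans _ _ (\sum_(i < n) M)); first by apply: ler_sum => i _; exact: bM.
  by rewrite sumr_const card_ord mulr_natl.
apply: (@le_trans _ _ ((n.+1%:R * M) ^+ N)).
  have B0 := ltW (Mbracket_gt0 z).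
  by apply: lerXn2r => //; rewrite nnegrE (le_trans B0).
rewrite exprMn; apply: ler_wpM2l; first by rewrite exprn_ge0.
rewrite /M; have [h|h] := leP 1 (b j); last first.
  by rewrite expr1n lerDl sumr_ge0// => i _; rewrite exprn_ge0.
rewrite (bigD1 j)//= mulnC exprM addrCA lerDl addr_ge0// sumr_ge0//.
Qed.

(* A product weight replaces <z>_M in integrals, which then factor by
   Tonelli's theorem. *)
Definition Pgrowth z : R := \prod_(j < n) (1 + `|z ord0 j|).

Lemma Pgrowth_ge1 z : 1 <= Pgrowth z.
Proof.
rewrite /Pgrowth; elim: (index_enum 'I_n) => [|j L IH]; first by rewrite big_nil.
by rewrite big_cons mulr_ege1// lerDl.
Qed.

Lemma Pgrowth_gt0 z : 0 < Pgrowth z.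
Proof. exact: lt_le_trans (Pgrowth_ge1 z). Qed.

Lemma le_Pgrowth z j : 1 + `|z ord0 j| <= Pgrowth z.
Proof.
rewrite /Pgrowth (bigD1 j)//= ler_peMr ?addr_ge0//.
elim: (index_enum 'I_n) => [|i L IH]; first by rewrite big_nil.
by rewrite big_cons; case: ifP => // _; rewrite mulr_ege1// lerDl.
Qed.

Lemma Mbracket_le_Pgrowth : exists2 C : R, 1 <= C & exists L : nat,
  forall z, B z <= C * Pgrowth z ^+ L.
Proof.
exists n.+1%:R; first by rewrite ler1n.
exists (\sum_(j < n) mu j)%N => z; set L := (\sum_(j < n) mu j)%N.
apply: le_trans (Mbracket_le_sum z) _.
rewrite -natr1 mulrDl mul1r addrC; apply: lerD; last by rewrite exprn_ege1// Pgrowth_ge1.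
apply: (@le_trans _ _ (\sum_(i < n) Pgrowth z ^+ L)); last first.
  by rewrite sumr_const card_ord mulr_natl.
apply: ler_sum => j _; apply: (@le_trans _ _ (Pgrowth z ^+ mu j)).
  have P0 := ltW (Pgrowth_gt0 z); apply: lerXn2r; rewrite ?nnegrE//.
  by apply: le_trans (le_Pgrowth z j); rewrite lerDr.
by rewrite ler_weXn2l ?Pgrowth_ge1// /L (bigD1 j)//= leq_addr.
Qed.

Lemma Mmin_le j : (Mmin mu <= mu j)%N.
Proof.
rewrite /Mmin; move: (\max_(j < n) mu j)%N => K.
have : j \in index_enum 'I_n by rewrite mem_index_enum.
elim: (index_enum 'I_n) => //= i L IH; rewrite inE big_cons => /predU1P[<-|/IH h].
  exact: geq_minl.
exact: leq_trans (geq_minr _ _) h.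
Qed.

Lemma Mmin_gt0 : (0 < Mmin mu)%N.
Proof.
rewrite /Mmin; apply: (big_ind (fun m => 0 < m)%N) => //.
- by apply: leq_trans (mu0 (Ordinal n0)) _; exact: (leq_bigmax (Ordinal n0)).
- by move=> a b a0 b0; rewrite leq_min a0.
Qed.

(* An exponent > 1 with n tau = n + 1 <= N mu_* as soon as N mu_* > n. *)
Definition tau : R := n.+1%:R / n%:R.

Lemma tau_gt1 : 1 < tau.
Proof. by rewrite /tau ltr_pdivlMr ?ltr0n// mul1r ltr_nat. Qed.

(** In each variable [(1 + |z_j|)^mu_* <= D <z>]; multiplying over [j] gives
    [Pgrowth z ^ mu_* <= (D <z>)^n]. Raised to the power [tau / mu_*], the right side has exponent
    [q = (n + 1) / mu_* <= N]. *)
Lemma Pgrowth_Mbracket N : (n.+1 <= N * Mmin mu)%N -> exists2 C : R, 0 <= C &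
  forall z, B z ^- N <= C * Pgrowth z `^ (- tau).
Proof.
move=> nN; have m0 := Mmin_gt0.
pose L := (\sum_(j < n) mu j)%N; pose D : R := 2 ^+ L.
have D1 : 1 <= D by rewrite exprn_ege1// ler1n.
pose q : R := n.+1%:R / (Mmin mu)%:R.
have q0 : 0 <= q by rewrite divr_ge0.
exists (D `^ q) => [|z]; first exact: powR_ge0.
have P0 := Pgrowth_gt0 z; have B0 := Mbracket_gt0 z.
have h j : (1 + `|z ord0 j|) ^+ Mmin mu <= D * B z.
  have z0 := normr_ge0 (z ord0 j).
  pose M := Num.max 1 `|z ord0 j|.
  have M1 : 1 <= M by rewrite le_max lexx.
  apply: (@le_trans _ _ ((2 * M) ^+ mu j)).
    apply: (@le_trans _ _ ((1 + `|z ord0 j|) ^+ mu j)).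
      by rewrite ler_weXn2l ?lerDl// Mmin_le.
    apply: lerXn2r; rewrite ?nnegrE ?addr_ge0 ?mulr_ge0// ?(le_trans ler01 M1)//.
    by rewrite mulr_natl mulr2n; apply: lerD => //; rewrite le_max lexx orbT.
  rewrite exprMn; apply: ler_pM; rewrite ?exprn_ge0// ?(le_trans ler01 M1)//.
    by rewrite ler_weXn2l ?ler1n// /L (bigD1 j)//= leq_addr.
  rewrite -(@ler_pXn2r _ 2)// ?nnegrE ?exprn_ge0 ?(le_trans ler01 M1) ?(ltW B0)//.
  rewrite Mbracket_sqr (bigD1 j)//= /M.
  have S0 : 0 <= \sum_(i < n | i != j) (`|z ord0 i| ^+ mu i) ^+ 2.
    by apply: sumr_ge0 => i _; rewrite exprn_ge0// exprn_ge0.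
  have T0 : 0 <= (`|z ord0 j| ^+ mu j) ^+ 2 by rewrite exprn_ge0// exprn_ge0.
  by have [_|_] := leP 1 `|z ord0 j|; rewrite ?expr1n; lra.
have hP : Pgrowth z ^+ Mmin mu <= (D * B z) ^+ n.
  rewrite /Pgrowth -prodrXl -[X in (D * B z) ^+ X](card_ord n) -prodr_const.
  by apply: ler_prod => j _; rewrite h exprn_ge0 ?addr_ge0.
have hT : Pgrowth z `^ tau <= (D * B z) `^ q.
  have -> : Pgrowth z `^ tau = (Pgrowth z ^+ Mmin mu) `^ (tau / (Mmin mu)%:R).
    rewrite -powR_mulrn ?ltW// -powRrM mulrCA divff ?mulr1//.
    by rewrite pnatr_eq0 -lt0n.
  have -> : (D * B z) `^ q = ((D * B z) ^+ n) `^ (tau / (Mmin mu)%:R).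
    rewrite -powR_mulrn; last by rewrite mulr_ge0 ?(ltW B0)// (le_trans ler01).
    rewrite -powRrM; congr (_ `^ _); rewrite /q /tau mulrA mulrCA divff ?mulr1//.
    by rewrite pnatr_eq0 -lt0n.
  apply: ge0_ler_powR => //.
  - by rewrite divr_ge0// ltW// (lt_trans ltr01 tau_gt1).
  - by rewrite nnegrE exprn_ge0// ltW.
  - by rewrite nnegrE exprn_ge0// mulr_ge0 ?(ltW B0)// (le_trans ler01).
have qN : q <= N%:R.
  by rewrite /q ler_pdivrMr ?ltr0n// -natrM ler_nat.
rewrite powRN -powR_mulrn ?(ltW B0)//.
rewrite -[leLHS]mul1r ler_pdivrMr ?powR_gt0// mulrAC ler_pdivlMr ?powR_gt0// mul1r.
apply: le_trans hT _; rewrite powRM ?(ltW B0)// ?(le_trans ler01)//.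
apply: ler_wpM2l; first exact: powR_ge0.
by apply: ler_powR => //; exact: Mbracket_ge1.
Qed.

End weights.

Section decay_weight.
Context (R : realType) (n : nat).
Hypothesis n0 : (0 < n)%N.
Local Notation lam := (lebesgue_rV R n).
Implicit Types x y : 'rV[R]_n.

Definition Wdecay x : R := Pgrowth x `^ (- tau R n).

Lemma WdecayE x : Wdecay x = \prod_(i < n) decay (tau R n) (x ord0 i).
Proof.
rewrite /Wdecay /Pgrowth /decay; elim: (index_enum 'I_n) => [|j L IH].
  by rewrite !big_nil powR1.
rewrite !big_cons powRM ?IH// ?addr_ge0//.
by apply: prodr_ge0 => i _; rewrite addr_ge0.
Qed.

Lemma Wdecay_gt0 x : 0 < Wdecay x.
Proof. by rewrite powR_gt0// Pgrowth_gt0. Qed.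

Lemma Wdecay_ge0 x : 0 <= Wdecay x.
Proof. exact: ltW (Wdecay_gt0 x). Qed.

Lemma tau_ge0 : 0 <= tau R n.
Proof. by rewrite /tau divr_ge0. Qed.

Lemma Wdecay_le1 x : Wdecay x <= 1.
Proof.
rewrite -(powRr0 (Pgrowth x)); apply: ler_powR; first exact: Pgrowth_ge1.
by rewrite oppr_le0; exact: tau_ge0.
Qed.

Lemma PgrowthN x : Pgrowth (- x) = Pgrowth x.
Proof. by rewrite /Pgrowth; apply: eq_bigr => j _; rewrite mxE normrN. Qed.

Lemma WdecayN x : Wdecay (- x) = Wdecay x.
Proof. by rewrite /Wdecay PgrowthN. Qed.

Lemma PgrowthD x y : Pgrowth (x + y) <= Pgrowth x * Pgrowth y.
Proof.
rewrite /Pgrowth -big_split/=; apply: ler_prod => j _; rewrite addr_ge0//=.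
rewrite mxE; have := ler_normD (x ord0 j) (y ord0 j).
have : 0 <= `|x ord0 j| * `|y ord0 j| by rewrite mulr_ge0.
by move: `|_ + _| `|_| `|_| => a b c h1 h2; rewrite mulrDl mul1r mulrDr mulr1; lra.
Qed.

(** A Peetre inequality for the product weight. It separates the variables at the cost of polynomial
    growth in [x], which Schwartz functions absorb. *)
Lemma WdecayB x y : Wdecay (x - y) <= Wdecay y * Pgrowth x `^ tau R n.
Proof.
have h : Pgrowth y <= Pgrowth (x - y) * Pgrowth x.
  rewrite -(PgrowthN (x - y)) -{1}(addrNK x y) -opprB; exact: PgrowthD.
have := @ge0_ler_powR _ _ tau_ge0 _ _ _ _ h.
rewrite !nnegrE => /(_ (ltW (Pgrowth_gt0 _))).
move=> /(_ (mulr_ge0 (ltW (Pgrowth_gt0 _)) (ltW (Pgrowth_gt0 _)))).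
rewrite powRM ?(ltW (Pgrowth_gt0 _))// /Wdecay !powRN => h2.
rewrite -[leLHS]mul1r ler_pdivrMr ?powR_gt0 ?Pgrowth_gt0//.
rewrite -mulrA mulrC ler_pdivlMr ?powR_gt0 ?Pgrowth_gt0// mul1r.
by rewrite mulrC.
Qed.

Lemma measurable_Wdecay : measurable_fun setT Wdecay.
Proof.
rewrite (funext WdecayE); apply: measurable_prod => i.
have := measurableT_comp (@measurable_decay R (tau R n) 0) (@measurable_rV_coord R n i).
by under [X in measurable_fun _ X -> _]eq_fun do rewrite /= subr0.
Qed.

Definition cW : R := (2 / (tau R n - 1)) ^+ n.

Lemma integral_Wdecay_l y : (\int[lam]_x (Wdecay (x - y))%:E <= cW%:E)%E.
Proof.
have E x : Wdecay (x - y) = \prod_(i < n) decay (tau R n) (x ord0 i - y ord0 i).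
  by rewrite WdecayE; apply: eq_bigr => i _; rewrite !mxE.
under eq_integral do rewrite E.
have := @integral_tensor_le R n (fun i t => decay (tau R n) (t - y ord0 i))
  (fun=> 2 / (tau R n - 1)).
rewrite prodr_const card_ord; apply.
- by move=> i; exact: measurable_decay.
- by move=> i t; exact: decay_ge0.
- by move=> i; apply: integral_decay_le; exact: tau_gt1.
Qed.

Lemma integral_Wdecay_r x : (\int[lam]_y (Wdecay (x - y))%:E <= cW%:E)%E.
Proof.
under eq_integral do rewrite -WdecayN opprB.
exact: integral_Wdecay_l.
Qed.

Lemma schwartz_Pdecay (phi : schwartz R n) k :
  exists2 C : R, 0 <= C & forall x, Pgrowth x ^+ k * normc (phi x) <= C * Qdecay x.
Proof.
have H (L : seq 'I_n) : forall al, exists2 C : R, 0 <= C & forall x,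
    (\prod_(j <- L) (1 + `|x ord0 j|)) * (`|monom al x| * normc (phi x)) <= C * Qdecay x.
  elim: L => [|j L IH] al.
    have [C C0 HC] := schwartz_Qdecay phi al.
    by exists C => // x; rewrite big_nil mul1r.
  have [C C0 HC] := IH al; have [D D0 HD] := IH (fun i => al i + mdelta 1 j i)%N.
  exists (C + D); first exact: addr_ge0.
  move=> x; rewrite big_cons [leRHS]mulrDl; apply: le_trans (lerD (HC x) (HD x)).
  by rewrite -monomM expr1 normrM; apply: eqW; ring.
(* [Pgrowth x ^ k] is the product of the factors [1 + |x_j|] over [k] concatenated copies of the
   index list. *)
have [C C0 HC] := H (flatten (nseq k (index_enum 'I_n))) (fun=> 0%N).
exists C => // x; apply: le_trans (HC x).
rewrite monom0 normr1 mul1r; apply: ler_wpM2r; first exact: normc_ge0.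
apply: eqW.
by elim: k {C C0 HC} => [|k IH] /=; rewrite ?big_nil ?big_cat ?exprS -?IH.
Qed.

End decay_weight.

(** * Schur's test in L^p *)

Section schur.
Context (R : realType) (n : nat).
Local Notation lam := (lebesgue_rV R n).
Variables (w : 'rV[R]_n -> 'rV[R]_n -> R) (c : R).
Hypothesis w0 : forall x y, 0 <= w x y.
Hypothesis mw : measurable_fun setT (fun z : 'rV[R]_n * 'rV[R]_n => w z.1 z.2).
Hypothesis wl : forall y, (\int[lam]_x (w x y)%:E <= c%:E)%E.
Hypothesis wr : forall x, (\int[lam]_y (w x y)%:E <= c%:E)%E.
Hypothesis c0 : 0 < c.
Variable F : 'rV[R]_n -> R.
Hypothesis F0 : forall x, 0 <= F x.
Hypothesis mF : measurable_fun setT F.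

Let mwr x : measurable_fun setT (w x).
Proof. exact: (measurableT_comp mw (measurable_pair1 x)). Qed.

Let mwl y : measurable_fun setT (w ^~ y).
Proof. exact: (measurableT_comp mw (measurable_pair2 y)). Qed.

(** Hölder's inequality for [w = w^(1/q) w^(1/p)] with [q = p / (p - 1)]: the first factor has
    integral at most [c] after taking the power [q], and [p / q = p - 1]. The case [p = 1], where
    [q] is infinite, is an identity. *)
Lemma schur_jensen (p : R) x : 1 <= p ->
  ((\int[lam]_y (w x y * F y)%:E) `^ p <=
   (c `^ (p - 1))%:E * \int[lam]_y (w x y * F y `^ p)%:E)%E.
Proof.
move=> p1; have p0 : 0 < p by rewrite (lt_le_trans _ p1).
have mFp : measurable_fun setT (fun y => F y `^ p).
  exact: (measurableT_comp (measurable_powR p) mF).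
have [->|pn1] := eqVneq p 1.
  rewrite poweRe1; last by apply: integral_ge0 => y _; rewrite lee_fin mulr_ge0.
  rewrite subrr powRr0 mul1e.
  by under [leRHS]eq_integral do rewrite powRr1//.
have {}p1 : 1 < p by rewrite lt_neqAle eq_sym pn1.
have pm : 0 < p - 1 by rewrite subr_gt0.
pose q := p / (p - 1); have q0 : 0 < q by rewrite divr_gt0.
have qp : q^-1 * p = p - 1 by rewrite /q invf_div divfK// gt_eqF.
have pq : q^-1 + p^-1 = 1.
  by apply: (mulIf (lt0r_neq0 p0)); rewrite mulrDl qp mulVf ?lt0r_neq0//; lra.
pose f y := w x y `^ q^-1; pose g y := w x y `^ p^-1 * F y.
have mf : measurable_fun setT f by exact: (measurableT_comp (measurable_powR _) (mwr x)).
have mg : measurable_fun setT g.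
  by apply: measurable_funM => //; exact: (measurableT_comp (measurable_powR _) (mwr x)).
have f0 y : 0 <= f y by exact: powR_ge0.
have g0 y : 0 <= g y by rewrite mulr_ge0// powR_ge0.
have h := hoelder lam mf mg q0 p0 pq.
have E1 : (\int[lam]_y (w x y * F y)%:E = 'N[lam]_1[EFin \o (f \* g)%R])%E.
  rewrite Lnorm1; apply: eq_integral => y _ /=.
  apply: (etrans _ (congr1 EFin (esym (ger0_norm (mulr_ge0 (f0 y) (g0 y)))))); congr (_%:E).
  rewrite -[in LHS](powRr1 (w0 x y)) -pq powRD ?pq ?oner_eq0//; exact: (esym (mulrA _ _ _)).
rewrite E1; apply: (@le_trans _ _ (('N[lam]_q%:E[EFin \o f] * 'N[lam]_p%:E[EFin \o g]) `^ p)%E).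
  apply: gt0_ler_poweR => //; first exact: ltW.
  - by rewrite in_itv/= leey Lnorm_ge0.
  - by rewrite in_itv/= leey mule_ge0// Lnorm_ge0.
rewrite poweRM ?Lnorm_ge0// poweR_Lnorm ?gt_eqF//.
apply: lee_pmul.
- exact: poweR_ge0.
- by apply: integral_ge0 => y _; exact: poweR_ge0.
- rewrite unlock -poweRrM qp.
  apply: (@le_trans _ _ (c%:E `^ (p - 1))%E) => //.
  have E2 : (\int[lam]_y (`|(EFin \o f) y| `^ q) = \int[lam]_y (w x y)%:E)%E.
    apply: eq_integral => y _ /=; rewrite ger0_norm// /f -powRrM mulVf ?gt_eqF//.
    by rewrite powRr1.
  rewrite E2; apply: gt0_ler_poweR => //; first exact: ltW.
  - by rewrite in_itv/= leey integral_ge0// => y _; rewrite lee_fin.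
  - by rewrite in_itv/= leey lee_fin ltW.
- apply: eqW.
  apply: eq_integral => y _ /=; rewrite ger0_norm// /g powRM ?powR_ge0//.
  by rewrite -powRrM mulVf ?gt_eqF// powRr1.
Qed.

(** The endpoint [p = +oo]. Positivity of the total measure selects the branch of [Lnorm] that is
    the essential supremum. *)
Lemma schur_ess_sup x : (0 < lam setT)%E ->
  (\int[lam]_y (w x y * F y)%:E <= c%:E * 'N[lam]_+oo[EFin \o F])%E.
Proof.
move=> lam0; rewrite unlock lam0.
have := ess_sup_ge lam (abse \o (EFin \o F)).
have : (0 <= ess_sup lam (abse \o (EFin \o F)))%E.
  by apply: ess_sup_gee => //; apply: nearW => y; exact: abse_ge0.
case: (ess_sup _ _) => [e||//] e0 He; last by rewrite gt0_muley ?leey// lte_fin.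
rewrite lee_fin in e0.
apply: (@le_trans _ _ (\int[lam]_y (e * w x y)%:E)%E).
  apply: ae_ge0_le_integral => //.
  - by move=> y _; rewrite lee_fin mulr_ge0.
  - by apply/measurable_EFinP; apply: measurable_funM.
  - by move=> y _; rewrite lee_fin mulr_ge0.
  - by apply/measurable_EFinP; apply: measurable_funM.
  - apply: filterS He => y /= + _; rewrite !lee_fin ger0_norm// => h.
    by rewrite mulrC ler_wpM2r.
under eq_integral do rewrite EFinM.
rewrite ge0_integralZl//.
- by rewrite muleC; apply: lee_wpmul2r => //; rewrite lee_fin.
- exact/measurable_EFinP.
- by move=> y _; rewrite lee_fin.
Qed.

(** For finite [p] the constant is assembled as [c^p = c^(p - 1) c]: the first factor is that of
    [schur_jensen], the second bounds the integral of the kernel in [x] once Tonelli's theorem has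
    exchanged the integrals. *)
Lemma schur_test (p : \bar R) (G : 'rV[R]_n -> R) : (1 <= p)%E ->
  measurable_fun setT G -> (forall x, 0 <= G x) ->
  (forall x, (G x)%:E <= \int[lam]_y (w x y * F y)%:E)%E ->
  ('N[lam]_p[EFin \o G] <= c%:E * 'N[lam]_p[EFin \o F])%E.
Proof.
case: p => [p||//] p1 mG G0 GF; last first.
  have [l0|l0] := ltP 0%E (lam setT); last first.
    by rewrite unlock !ltNge l0 /= mule0.
  rewrite [in leLHS]unlock l0; apply/ess_supP; apply: nearW => x.
  by rewrite /= ger0_norm//; apply: le_trans (GF x) _; exact: schur_ess_sup.
rewrite lee_fin in p1; have p0 : 0 < p by rewrite (lt_le_trans _ p1).
have mFp : measurable_fun setT (fun y => F y `^ p).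
  exact: (measurableT_comp (measurable_powR p) mF).
rewrite unlock.
rewrite [X in (X * _)%E](_ : c%:E = (c `^ p)%:E `^ p^-1)%E; last first.
  by rewrite poweR_EFin -powRrM mulfV ?gt_eqF// powRr1// ltW.
rewrite -poweRM ?lee_fin ?powR_ge0//; last first.
  by apply: integral_ge0 => y _; exact: poweR_ge0.
apply: gt0_ler_poweR; first by rewrite invr_ge0 ltW.
- by rewrite in_itv/= leey integral_ge0// => y _; exact: poweR_ge0.
- rewrite in_itv/= leey mule_ge0 ?lee_fin ?powR_ge0//.
  by rewrite integral_ge0// => y _; exact: poweR_ge0.
have mJ : measurable_fun setT (fun x => \int[lam]_y (w x y * F y `^ p)%:E)%E.
  apply: (@measurable_Tonelli_rV _ _ _ _ (fun x y => (w x y * F y `^ p)%:E)).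
    apply/measurable_EFinP; apply: measurable_funM => //.
    exact: (measurableT_comp mFp measurable_snd).
  by move=> x y; rewrite lee_fin mulr_ge0// powR_ge0.
apply: (@le_trans _ _ (\int[lam]_x ((c `^ (p - 1))%:E * \int[lam]_y (w x y * F y `^ p)%:E))%E).
  apply: ge0_le_integral => //.
  - by move=> x _; exact: poweR_ge0.
  - rewrite (_ : (fun x => _) = (fun x => (G x `^ p)%:E)); last first.
      by apply/funext => x /=; rewrite ger0_norm.
    by apply/measurable_EFinP; exact: (measurableT_comp (measurable_powR p) mG).
  - by apply: emeasurable_funM => //; exact: measurable_cst.
  - move=> x _; apply: le_trans (schur_jensen x p1).
    apply: gt0_ler_poweR; first exact: ltW.
    + by rewrite in_itv/= leey lee_fin normr_ge0.
    + by rewrite in_itv/= leey integral_ge0// => y _; rewrite lee_fin mulr_ge0.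
    + by rewrite /= ger0_norm.
rewrite ge0_integralZl//; last 2 first.
- by move=> x _; apply: integral_ge0 => y _; rewrite lee_fin mulr_ge0// powR_ge0.
- by rewrite lee_fin powR_ge0.
rewrite (@Tonelli_rV _ _ _ (fun x y => (w x y * F y `^ p)%:E)); last 2 first.
- apply/measurable_EFinP; apply: measurable_funM => //.
  exact: (measurableT_comp mFp measurable_snd).
- by move=> x y; rewrite lee_fin mulr_ge0// powR_ge0.
have -> : c `^ p = c `^ (p - 1) * c.
  by rewrite -[X in _ * X](powRr1 (ltW c0)) -powRD ?subrK// gt_eqF ?implybT.
rewrite EFinM -muleA; apply: lee_wpmul2l; first by rewrite lee_fin powR_ge0.
rewrite -ge0_integralZl//; last 3 first.
- rewrite (_ : (fun x => _) = (fun x => (F x `^ p)%:E)); last first.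
    by apply/funext => x /=; rewrite ger0_norm.
  exact/measurable_EFinP.
- by move=> y _; exact: poweR_ge0.
- by rewrite lee_fin ltW.
apply: ge0_le_integral; first exact: measurableT.
- by move=> y _; apply: integral_ge0 => x _; rewrite lee_fin mulr_ge0// powR_ge0.
- apply: (@measurable_Tonelli_rV _ _ _ _ (fun y x => (w x y * F y `^ p)%:E)).
    apply/measurable_EFinP; apply: measurable_funM => //.
      exact: (measurableT_comp mw (@measurable_swap _ _ 'rV[R]_n 'rV[R]_n)).
    exact: (measurableT_comp mFp measurable_fst).
  by move=> x y; rewrite lee_fin mulr_ge0// powR_ge0.
- rewrite (_ : (fun x => _) = (fun x => (c * F x `^ p)%:E)); last first.
    by apply/funext => x /=; rewrite ger0_norm.
  by apply/measurable_EFinP; apply: measurable_funM.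
- move=> y _ /=; rewrite ger0_norm//.
  under eq_integral do rewrite mulrC EFinM.
  rewrite ge0_integralZl ?lee_fin ?powR_ge0//.
  + by rewrite muleC; apply: lee_wpmul2r => //; rewrite lee_fin powR_ge0.
  + exact/measurable_EFinP.
  + by move=> x _; rewrite lee_fin.
Qed.

(** A weight that is integrable and bounded by 1 pairs with every L^p. For finite [p], after
    [schur_jensen] the bound [w <= 1] leaves just the integral of [F^p]. *)
Lemma schur_finite (p : \bar R) x : (1 <= p)%E -> (forall y, w x y <= 1) ->
  ('N[lam]_p[EFin \o F] < +oo)%E -> (\int[lam]_y (w x y * F y)%:E < +oo)%E.
Proof.
case: p => [p||//] p1 w1 Fp; last first.
  have [l0|l0] := ltP 0%E (lam setT).
    by apply: le_lt_trans (schur_ess_sup x l0) _; rewrite lte_mul_pinfty// lee_fin ltW.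
  rewrite null_set_integral ?ltry//; last by apply/eqP; rewrite eq_le l0 measure_ge0.
  by apply/measurable_EFinP; exact: measurable_funM.
rewrite lee_fin in p1; have p0 : 0 < p by rewrite (lt_le_trans _ p1).
have mFp : measurable_fun setT (fun y => F y `^ p).
  exact: (measurableT_comp (measurable_powR p) mF).
apply: (@lty_poweRy _ _ p); first by rewrite gt_eqF.
apply: le_lt_trans (schur_jensen x p1) _.
apply: lte_mul_pinfty; rewrite ?lee_fin ?powR_ge0//.
apply: (@le_lt_trans _ _ (\int[lam]_y (F y `^ p)%:E)%E).
  apply: ge0_le_integral => //.
  - by move=> y _; rewrite lee_fin mulr_ge0// powR_ge0.
  - by apply/measurable_EFinP; apply: measurable_funM.
  - exact/measurable_EFinP.
  - by move=> y _; rewrite lee_fin ler_piMl// powR_ge0.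
have E : (\int[lam]_y (F y `^ p)%:E = \int[lam]_y (`|(EFin \o F) y| `^ p))%E.
  by apply: eq_integral => y _ /=; rewrite ger0_norm.
move: Fp; rewrite unlock E => /lty_poweRy; rewrite invr_eq0 gt_eqF// => /(_ isT).
exact.
Qed.

End schur.

(** * Fourier transform of the symbol *)

Section slices.
Context (R : realType) (n p : nat).

Lemma iter_pderiv_slice (F : 'rV[R]_(n + p) -> R) (xi : 'rV[R]_p) s :
  iter_pderiv s (fun x : 'rV[R]_n => F (row_mx x xi)) =
  (fun x => iter_pderiv (map (@lshift n p) s) F (row_mx x xi)).
Proof.
elim: s => [//|j s IH]; rewrite /= IH; apply/funext => x; rewrite /pderiv.
apply: (@derive_comp_affine R _ _ (fun x : 'rV[R]_n => row_mx x xi)) => h.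
by rewrite delta_mx_lshift scale_row_mx add_row_mx scaler0 add0r.
Qed.

Lemma continuous_row_mxl (xi : 'rV[R]_p) : continuous (fun x : 'rV[R]_n => row_mx x xi).
Proof.
apply: continuous_rV => i.
rewrite (_ : (fun x : 'rV[R]_n => _) = fun x : 'rV[R]_n =>
    match fintype.split i with inl k => x ord0 k | inr k => xi ord0 k end).
  by case: (fintype.split i) => k; [exact: continuous_coord|exact: cst_continuous].
by apply/funext => x; rewrite mxE.
Qed.

Lemma smooth_slice (F : 'rV[R]_(n + p) -> R) (xi : 'rV[R]_p) :
  smooth F -> smooth (fun x : 'rV[R]_n => F (row_mx x xi)).
Proof.
move=> sF s; rewrite iter_pderiv_slice; have [cF dF] := sF (map (@lshift n p) s).
split.
  move=> x; apply: (@continuous_comp _ _ _ (fun x : 'rV[R]_n => row_mx x xi)).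
    exact: continuous_row_mxl.
  exact: cF.
move=> j x.
apply: (@derivable_comp_affine R _ _ (fun x : 'rV[R]_n => row_mx x xi) _ x _
  (delta_mx ord0 (lshift p j))); last exact: dF.
move=> h; by rewrite delta_mx_lshift scale_row_mx add_row_mx scaler0 add0r.
Qed.

End slices.

Section fourier_decay.
Context (R : realType) (n : nat).
Local Notation lam := (lebesgue_rV R n).
Implicit Types f g : 'rV[R]_n -> R[i].

Lemma cmderiv0 f : cmderiv (fun=> 0%N) f = f.
Proof. by apply/funext => x; rewrite /cmderiv !mderiv0; case: (f x). Qed.

Lemma cmderiv_mdeltaE l j f x : cmderiv (mdelta l j) f x =
  iter_pderiv (nseq l j) (fun y => complex.Re (f y)) x +i*
  iter_pderiv (nseq l j) (fun y => complex.Im (f y)) x.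
Proof. by rewrite /cmderiv /mderiv mseq_mdelta. Qed.

Lemma normr_Re_cmderiv l j f x : `|iter_pderiv (nseq l j) (fun y => complex.Re (f y)) x| <=
  normc (cmderiv (mdelta l j) f x).
Proof. by rewrite cmderiv_mdeltaE; exact: (normr_Re_le (_ +i* _)). Qed.

Lemma normr_Im_cmderiv l j f x : `|iter_pderiv (nseq l j) (fun y => complex.Im (f y)) x| <=
  normc (cmderiv (mdelta l j) f x).
Proof. by rewrite cmderiv_mdeltaE; exact: (normr_Im_le (_ +i* _)). Qed.

Lemma csmoothM f g : csmooth f -> csmooth g -> csmooth (fun x => f x * g x).
Proof.
move=> [f1 f2] [g1 g2]; split.
  rewrite (_ : (fun x => _) = (fun x => complex.Re (f x) * complex.Re (g x) +
    (- (complex.Im (f x) * complex.Im (g x))))); last by apply/funext => x; rewrite ReM.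
  have := smooth_lin 1 1 (smoothM f1 g1) (smoothN (smoothM f2 g2)).
  by congr smooth; apply/funext => x; rewrite !mul1r.
rewrite (_ : (fun x => _) = (fun x => complex.Re (f x) * complex.Im (g x) +
    (complex.Im (f x) * complex.Re (g x)))); last by apply/funext => x; rewrite ImM.
have := smooth_lin 1 1 (smoothM f1 g2) (smoothM f2 g1).
by congr smooth; apply/funext => x; rewrite !mul1r.
Qed.

Lemma size_splits (s : seq 'I_n) : size (splits s) = (2 ^ size s)%N.
Proof.
elim: s => [//|j s IH] /=; rewrite size_cat !size_map IH expnS.
by rewrite mul2n addnn.
Qed.

Lemma iter_pderivM_le k j (u v : 'rV[R]_n -> R) (x : 'rV[R]_n) (A D : R) :
  smooth u -> smooth v -> 0 <= A -> 0 <= D ->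
  (forall l, (l <= k)%N -> `|iter_pderiv (nseq l j) u x| <= A) ->
  (forall l, (l <= k)%N -> `|iter_pderiv (nseq l j) v x| <= D) ->
  `|iter_pderiv (nseq k j) (fun x => u x * v x) x| <= 2 ^+ k * (A * D).
Proof.
move=> su sv A0 D0 hu hv; rewrite iter_pderivM//.
apply: le_trans (ler_norm_sum _ _ _) _.
apply: (@le_trans _ _ (\sum_(p <- splits (nseq k j)) A * D)); last first.
  by rewrite big_const_seq count_predT iter_addr_0 size_splits size_nseq -natrX mulr_natl.
have nseqE t : subseq t (nseq k j) -> t = nseq (size t) j /\ (size t <= k)%N.
  move=> tk; split; last by have := size_subseq tk; rewrite size_nseq.
  apply/all_pred1P; apply/allP => i /(mem_subseq tk).
  by rewrite mem_nseq => /andP[_].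
rewrite big_seq [leRHS]big_seq; apply: ler_sum => q /splits_subseq[/nseqE[e1 q1] /nseqE[e2 q2]].
by rewrite e1 e2 normrM; apply: ler_pM => //; [exact: hu|exact: hv].
Qed.

(** Each of the four real products contributes [2 ^ k] Leibniz terms, whence [2 ^ (k + 2)]. *)
Lemma cmderivM_le k j f g (x : 'rV[R]_n) (A D : R) :
  csmooth f -> csmooth g -> 0 <= A -> 0 <= D ->
  (forall l, (l <= k)%N -> normc (cmderiv (mdelta l j) f x) <= A) ->
  (forall l, (l <= k)%N -> normc (cmderiv (mdelta l j) g x) <= D) ->
  normc (cmderiv (mdelta k j) (fun x => f x * g x) x) <= 2 ^+ k.+2 * (A * D).
Proof.
move=> [f1 f2] [g1 g2] A0 D0 hf hg.
have F1 l : (l <= k)%N -> _ := fun h => le_trans (normr_Re_cmderiv l j f x) (hf l h).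
have F2 l : (l <= k)%N -> _ := fun h => le_trans (normr_Im_cmderiv l j f x) (hf l h).
have G1 l : (l <= k)%N -> _ := fun h => le_trans (normr_Re_cmderiv l j g x) (hg l h).
have G2 l : (l <= k)%N -> _ := fun h => le_trans (normr_Im_cmderiv l j g x) (hg l h).
have b11 := iter_pderivM_le f1 g1 A0 D0 F1 G1.
have b12 := iter_pderivM_le f1 g2 A0 D0 F1 G2.
have b21 := iter_pderivM_le f2 g1 A0 D0 F2 G1.
have b22 := iter_pderivM_le f2 g2 A0 D0 F2 G2.
apply: le_trans (normc_le_ReIm _) _; rewrite cmderiv_mdeltaE.
rewrite [complex.Re _]/= [complex.Im _]/=.
rewrite (_ : (fun y => complex.Re (f y * g y)) = (fun x =>
    1 * (complex.Re (f x) * complex.Re (g x)) +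
    -1 * (complex.Im (f x) * complex.Im (g x)))); last first.
  by apply/funext => y; rewrite ReM mul1r mulN1r.
rewrite (_ : (fun y => complex.Im (f y * g y)) = (fun x =>
    1 * (complex.Re (f x) * complex.Im (g x)) +
    1 * (complex.Im (f x) * complex.Re (g x)))); last first.
  by apply/funext => y; rewrite ImM !mul1r.
rewrite !iter_pderiv_lin; try exact: smoothM.
rewrite !mul1r mulN1r !exprS -!mulrA.
apply: le_trans (lerD (ler_normB _ _) (ler_normD _ _)) _.
by move: b11 b12 b21 b22; move: (_ ^+ _ * _) => z; lra.
Qed.

Context (mu : 'I_n -> nat).
Hypothesis n0 : (0 < n)%N.
Local Notation B := (@Mbracket R n mu).

(** [D] is chosen before [f], and the bound is linear in [C]. It can therefore be applied to
    [a(., xi)] with a constant that carries the power of [<xi>], uniformly in [xi]. *)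
Lemma fourier_decay N : exists2 D : R, 0 <= D & forall f C, csmooth f -> 0 <= C ->
  (forall j l x, (l <= N * mu j)%N -> normc (cmderiv (mdelta l j) f x) <= C * Qdecay x) ->
  forall zeta, normc (fourier f zeta) <= D * C * B zeta `^ (- N%:R).
Proof.
have [D D0 HD] := @MbracketX_le R n mu n0 N.
(* The factor [n + 1] counts the terms [1] and [|zeta_j|^(N mu_j)], the 2 the real and imaginary
   parts, and [2 ^ (n + 1)] is the constant of [osc_decay]. *)
exists (D * n.+1%:R * (2 * 2 ^+ n.+1)) => [|f C [s1 s2] C0 Hf zeta].
  by rewrite !mulr_ge0 ?exprn_ge0.
have F1 j l x : (l <= N * mu j)%N ->
    `|iter_pderiv (nseq l j) (fun y => complex.Re (f y)) x| <= C * Qdecay x.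
  by move=> lk; exact: le_trans (normr_Re_cmderiv l j f x) (Hf j l x lk).
have F2 j l x : (l <= N * mu j)%N ->
    `|iter_pderiv (nseq l j) (fun y => complex.Im (f y)) x| <= C * Qdecay x.
  by move=> lk; exact: le_trans (normr_Im_cmderiv l j f x) (Hf j l x lk).
have F3 j l x : (l <= N * mu j)%N ->
    `|iter_pderiv (nseq l j) (fun y => - complex.Re (f y)) x| <= C * Qdecay x.
  by move=> lk; rewrite iter_pderivN// normrN; exact: F1.
have main (u v : 'rV[R]_n -> R) : smooth u -> smooth v ->
    (forall j l x, (l <= N * mu j)%N -> `|iter_pderiv (nseq l j) u x| <= C * Qdecay x) ->
    (forall j l x, (l <= N * mu j)%N -> `|iter_pderiv (nseq l j) v x| <= C * Qdecay x) ->
    (1 + \sum_(j < n) `|zeta ord0 j| ^+ (N * mu j)) * `|osc u v zeta| <= n.+1%:R * (C * 2 ^+ n.+1).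
  move=> su sv hu hv.
  have bj j : `|zeta ord0 j| ^+ (N * mu j) * `|osc u v zeta| <= C * 2 ^+ n.+1.
    apply: osc_decay => //.
    - by move=> l lk; exists C => x; apply: hu; exact: ltnW.
    - by move=> l lk; exists C => x; apply: hv; exact: ltnW.
    - by move=> x; exact: hu.
    - by move=> x; exact: hv.
  rewrite mulrDl mul1r mulr_suml -natr1 [leRHS]mulrDl mul1r [leRHS]addrC; apply: lerD.
    have j := Ordinal n0.
    have := @osc_decay R n 0 j u v zeta C su sv; rewrite expr0 mul1r; apply => //.
    - by move=> x; exact: (hu j 0%N).
    - by move=> x; exact: (hv j 0%N).
  apply: (@le_trans _ _ (\sum_(i < n) (C * 2 ^+ n.+1))); first by apply: ler_sum => i _; exact: bj.
  by rewrite sumr_const card_ord mulr_natl.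
have B0 : 0 < B zeta := Mbracket_gt0 mu zeta.
rewrite powRN powR_mulrn ?(ltW B0)//.
rewrite ler_pdivlMr ?exprn_gt0// mulrC.
apply: (@le_trans _ _ (D * (1 + \sum_(j < n) `|zeta ord0 j| ^+ (N * mu j)) *
    normc (fourier f zeta))).
  by apply: ler_wpM2r; [exact: normc_ge0|exact: HD].
rewrite -!mulrA; apply: ler_wpM2l => //.
apply: (@le_trans _ _ ((1 + \sum_(j < n) `|zeta ord0 j| ^+ (N * mu j)) *
   (`|complex.Re (fourier f zeta)| + `|complex.Im (fourier f zeta)|))).
  apply: ler_wpM2l; last exact: normc_le_ReIm.
  by rewrite addr_ge0// sumr_ge0// => i _; rewrite exprn_ge0.
rewrite mulrDr fourierE [complex.Re _]/= [complex.Im _]/=.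
have h1 := main _ _ s1 s2 F1 F2.
have h2 := main _ _ s2 (smoothN s1) F2 F3.
apply: le_trans (lerD h1 h2) _.
by apply: eqW; ring.
Qed.

End fourier_decay.

Section symbol.
Context (R : realType) (n : nat) (mu : 'I_n -> nat) (m delta kappa : R).
Context (a : 'rV[R]_n -> 'rV[R]_n -> R[i]) (K : set 'rV[R]_n).
Hypothesis n0 : (0 < n)%N.
Hypothesis mu0 : forall j, (0 < mu j)%N.
Hypothesis delta01 : 0 <= delta <= 1.
Hypothesis ha : symbol_class mu m delta kappa a.
Hypothesis cK : compact K.
Hypothesis aK : forall xi, closure [set x | a x xi != 0] `<=` K.
Local Notation lam := (lebesgue_rV R n).
Local Notation B := (@Mbracket R n mu).
Implicit Types (x y z xi eta zeta : 'rV[R]_n) (phi : schwartz R n).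

Lemma csmooth_symbol xi : csmooth (a ^~ xi).
Proof.
have [[h1 h2] _] := ha.
have E x : a (lsubmx (row_mx x xi)) (rsubmx (row_mx x xi)) = a x xi.
  by rewrite row_mxKl row_mxKr.
split; [have := smooth_slice xi h1|have := smooth_slice xi h2];
  by congr smooth; apply/funext => x; rewrite E.
Qed.

Lemma cmeasurable_symbol : cmeasurable (fun z : 'rV[R]_n * 'rV[R]_n => a z.1 z.2).
Proof.
have [[h1 h2] _] := ha; split.
  apply: (@continuous_measurable_rV2 R n n (fun x xi => complex.Re (a x xi))).
  exact: smooth_continuous h1.
apply: (@continuous_measurable_rV2 R n n (fun x xi => complex.Im (a x xi))).
exact: smooth_continuous h2.
Qed.

Lemma Mweight_mdelta l j : Mweight R mu (mdelta l j) = l%:R / (mu j)%:R.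
Proof.
rewrite /Mweight (bigD1 j)//= /mdelta eqxx big1 ?addr0// => i /negbTE ->.
by rewrite mul0r.
Qed.

(** It is the closure of the set where [a(., xi)] is non-zero that lies in [K]. Hence outside [K]
    the function vanishes in a whole neighbourhood, and so do its derivatives. *)
Lemma symbol_off be x xi : ~ K x -> cmderiv be (a ^~ xi) x = 0.
Proof.
move=> Kx; pose U := ~` closure [set x | a x xi != 0].
have oU : open U by rewrite openC; exact: closed_closure.
have Ux : U x by move=> /aK.
have U0 y : U y -> a y xi = 0.
  by move=> Uy; apply/eqP; apply: contrapT => /negP h; apply: Uy; exact: subset_closure.
rewrite /cmderiv /mderiv.
rewrite (iter_pderiv0_on _ oU _ Ux); last by move=> y /U0 ->.
by rewrite (iter_pderiv0_on _ oU _ Ux)// => y /U0 ->.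
Qed.

Lemma Qdecay_lower_bound : exists2 C : R, 0 <= C & forall x, K x -> 1 <= C * Qdecay x.
Proof.
have [M0 [M0r HM]] := compact_bounded cK.
pose M := `|M0| + 1.
have M1 : 0 <= M by rewrite addr_ge0.
exists (((1 + M) ^+ 2) ^+ n); first by rewrite !exprn_ge0// addr_ge0.
move=> x Kx; have xM : `|x| <= M by apply: HM => //; rewrite (le_lt_trans (ler_norm _))// ltrDl.
have xj j : `|x ord0 j| <= M.
  apply: le_trans xM; rewrite /Num.norm/= mx_normrE.
  exact: (@le_bigmax _ _ _ 0 (fun ij : 'I_1 * 'I_n => `|x ij.1 ij.2|) (ord0, j)).
rewrite -[X in _ ^+ X * _](card_ord n) -prodr_const /Qdecay -big_split/=.
have := @ler_prod R 'I_n (index_enum 'I_n) xpredT (fun=> 1)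
  (fun i => (1 + M) ^+ 2 * decay 2 (x ord0 i)).
rewrite big1_eq; apply => j _; rewrite ler01/=.
have t0 : 0 < 1 + `|x ord0 j| by rewrite ltr_pwDl.
rewrite /decay powRN powR_mulrn ?(ltW t0)// ler_pdivlMr ?exprn_gt0// mul1r.
by apply: lerXn2r; rewrite ?nnegrE ?(ltW t0)// ?addr_ge0// lerD2l.
Qed.

(** Compactness of the support is retained as the factor [Qdecay x], bounded below on [K], with a
    constant uniform in [xi]. The orders [l <= N mu_j] are those of weight at most [N]. *)
Definition symbol_bound (N : nat) (e : R) := exists2 C : R, 0 <= C &
  forall j l x xi, (l <= N * mu j)%N ->
    normc (cmderiv (mdelta l j) (a ^~ xi) x) <= C * B xi `^ e * Qdecay x.

Lemma symbol_boundI N e : (forall j l, (l <= N * mu j)%N -> exists2 C : R, 0 <= C &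
    forall x xi, normc (cmderiv (mdelta l j) (a ^~ xi) x) <= C * B xi `^ e) ->
  symbol_bound N e.
Proof.
move=> H.
have [c Hc] : {c : 'I_n -> nat -> R & forall j l, (l <= N * mu j)%N -> 0 <= c j l /\
    forall x xi, normc (cmderiv (mdelta l j) (a ^~ xi) x) <= c j l * B xi `^ e}.
  have /choice[c Hc] : forall p : 'I_n * nat, exists C : R, (p.2 <= N * mu p.1)%N -> 0 <= C /\
    forall x xi, normc (cmderiv (mdelta p.2 p.1) (a ^~ xi) x) <= C * B xi `^ e.
    move=> [j l] /=; have [/H[C C0 HC]|_] := boolP (l <= N * mu j)%N; first by exists C.
    by exists 0.
  by exists (fun j l => c (j, l)) => j l; exact: Hc (j, l).
have [D D0 HD] := Qdecay_lower_bound.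
pose d j l : R := `|c j l|.
pose C : R := \sum_(j < n) \sum_(l < (N * mu j).+1) d j l.
have C0 : 0 <= C by apply: sumr_ge0 => j _; apply: sumr_ge0 => l _; exact: normr_ge0.
exists (C * D) => [|j l x xi lN]; first exact: mulr_ge0.
have [Kx|Kx] := pselect (K x); last first.
  rewrite symbol_off// ComplexField.Normc.normc0.
  by rewrite !mulr_ge0 ?powR_ge0 ?Qdecay_ge0.
have [c0 h] := Hc j l lN; apply: le_trans (h x xi) _.
rewrite -[leLHS]mulr1 (mulrAC C) -(mulrA _ D).
apply: ler_pM => //; [by rewrite mulr_ge0 ?powR_ge0| |by rewrite HD].
apply: ler_wpM2r; first exact: powR_ge0.
apply: (@le_trans _ _ (d j l)); first exact: ler_norm.
rewrite /C (bigD1 j)//= (bigD1 (Ordinal (lN : (l < (N * mu j).+1)%N)))//= -addrA lerDl.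
apply: addr_ge0; apply: sumr_ge0 => i _; first exact: normr_ge0.
by apply: sumr_ge0 => l0 _; exact: normr_ge0.
Qed.

(** All weights [l / mu_j <= N] lie strictly below [kappa], where the symbol class allows neither a
    logarithm nor a loss in [<xi>]. *)
Lemma symbol_bound_low N : N%:R < kappa -> symbol_bound N m.
Proof.
move=> Nk; apply: symbol_boundI => j l lN.
have [_ /(_ (fun=> 0%N) (mdelta l j))[C C0 HC]] := ha.
exists C => [|x xi]; first exact: ltW.
have [h _] := HC x xi; move: h; rewrite cmderiv0 Mweight_mdelta.
have lk : l%:R / (mu j)%:R < kappa.
  apply: le_lt_trans Nk; rewrite ler_pdivrMr ?ltr0n// -natrM ler_nat//.
rewrite lt_eqF// => /(_ isT).
have -> : Mweight R mu (fun=> 0%N) = 0 :> R by rewrite /Mweight big1// => i _; rewrite mul0r.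
rewrite (_ : Num.max _ _ = 0) ?mulr0 ?addr0 ?subr0//.
by apply/max_idPr; rewrite subr_le0 ltW.
Qed.

(** The gap of 1 absorbs the logarithm that occurs at weight exactly [kappa]: [ln(1 + b) <= b] for
    [b = <xi>^delta], and [delta <= delta (N - kappa)]. *)
Lemma symbol_bound_high N : kappa + 1 <= N%:R ->
  symbol_bound N (m + delta * (N%:R - kappa)).
Proof.
move=> Nk; apply: symbol_boundI => j l lN; have /andP[d0 d1] := delta01.
have [_ /(_ (fun=> 0%N) (mdelta l j))[C C0 HC]] := ha.
exists C => [|x xi]; first exact: ltW.
have B1 := Mbracket_ge1 mu xi.
have [h1 h2] := HC x xi; move: h1 h2; rewrite cmderiv0 Mweight_mdelta.
have lk : l%:R / (mu j)%:R <= N%:R :> R.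
  by rewrite ler_pdivrMr ?ltr0n// -natrM ler_nat.
have -> : Mweight R mu (fun=> 0%N) = 0 :> R by rewrite /Mweight big1// => i _; rewrite mul0r.
rewrite subr0; have [e _|ne] := eqVneq (l%:R / (mu j)%:R) kappa.
  move=> /(_ e) /le_trans; apply; rewrite ler_pM2l//.
  rewrite powRD; last by rewrite (gt_eqF (lt_le_trans ltr01 B1)) implybT.
  apply: ler_wpM2l; first exact: powR_ge0.
  have P0 : 0 <= B xi `^ delta by exact: powR_ge0.
  apply: le_trans (_ : _ <= B xi `^ delta) _.
    by have := @le_ln1Dx R (B xi `^ delta); apply; exact: lt_le_trans P0.
  by apply: ler_powR => //; rewrite ler_peMr//; lra.
move=> /(_ isT) /le_trans h _; apply: h; rewrite ler_pM2l//; apply: ler_powR => //.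
rewrite lerD2l ler_wpM2l// ge_max; apply/andP; split; lra.
Qed.

Definition symbol_fourier zeta xi : R[i] := fourier (a ^~ xi) zeta.

Lemma symbol_fourier_le N e : symbol_bound N e -> exists2 C : R, 0 <= C &
  forall zeta xi, normc (symbol_fourier zeta xi) <= C * B zeta `^ (- N%:R) * B xi `^ e.
Proof.
move=> [C C0 HC]; have [D D0 HD] := @fourier_decay R n mu n0 N.
exists (D * C) => [|zeta xi]; first exact: mulr_ge0.
have := HD (a ^~ xi) (C * B xi `^ e) (csmooth_symbol xi).
rewrite mulr_ge0 ?powR_ge0// => /(_ isT) h.
apply: le_trans (h _ zeta) _; first by move=> j l x lN; exact: HC.
have E (p q r s : R) : p * (q * r) * s = p * q * s * r by rewrite mulrA mulrAC.
by rewrite E.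
Qed.

End symbol.

(** * Pointwise bounds for the kernel and for the pairing *)

Section scalar.
Context (R : realType).
Implicit Types k r x y : R.

Lemma ler_powR_scaled k r x y : 0 <= r -> 0 <= k -> 0 <= x -> 0 <= y -> x <= k * y ->
  x `^ r <= k `^ r * y `^ r.
Proof.
by move=> r0 k0 x0 y0 h; rewrite -powRM//; apply: ge0_ler_powR => //; rewrite nnegrE mulr_ge0.
Qed.

Lemma ler_powRN_scaled k r x y : r <= 0 -> 0 < k -> 0 < x -> 0 < y -> x <= k * y ->
  y `^ r <= k `^ (- r) * x `^ r.
Proof.
have [q ->] : exists q, r = - q by exists (- r); rewrite opprK.
rewrite oppr_le0 opprK !powRN => q0 k0 x0 y0 h.
have := ler_powR_scaled q0 (ltW k0) (ltW x0) (ltW y0) h.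
move: (powR_gt0 q x0) (powR_gt0 q y0) (powR_gt0 q k0).
move: (x `^ _) (y `^ _) (k `^ _) => u v w u0 v0 w0 huv.
by rewrite ler_pdivlMr// mulrC ler_pdivrMr.
Qed.

(** Here [x], [y], [z] are the brackets of [eta], [xi] and [eta - xi], and [A] is the modulus of the
    kernel. The power [x^s] has to become [y^s]: for [s >= 0] this needs [x] bounded by [y], true if
    [z <= y]; for [s < 0] it needs [y] bounded by [x], true if [z <= x]. Then the bound with [C0]
    suffices. In the other regions [z] dominates, the bound with [C1] is used, and negative powers
    of [z] are traded for powers of [y]. *)
Lemma kernel_scalar (x y z k A C0 C1 s m e N N0 : R) :
  1 <= x -> 1 <= y -> 1 <= z -> 1 <= k -> 0 <= A -> 0 <= C0 -> 0 <= C1 ->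
  N0 <= N -> N0 + s <= N -> e - N + N0 <= m -> e - N + N0 <= s + m ->
  x <= k * Num.max y z -> y <= k * Num.max x z ->
  A <= C0 * z `^ (- N0) * y `^ m -> A <= C1 * z `^ (- N) * y `^ e ->
  x `^ s * A <= (k `^ `|s| * C0 + (k `^ `|s| + k `^ (N - N0)) * C1) *
    (y `^ (s + m) * z `^ (- N0)).
Proof.
move=> x1 y1 z1 k1 A0 C00 C10 NN Ns em esm xk yk A_low A_high.
have x0 := lt_le_trans ltr01 x1; have y0 := lt_le_trans ltr01 y1.
have z0 := lt_le_trans ltr01 z1; have k0 := lt_le_trans ltr01 k1.
have DD (u r t : R) : 0 < u -> u `^ (r + t) = u `^ r * u `^ t.
  by move=> u0; rewrite powRD// (gt_eqF u0) implybT.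
set T := y `^ (s + m) * z `^ (- N0).
have T0 : 0 <= T by rewrite mulr_ge0 ?powR_ge0.
have weak c : c <= k `^ `|s| * C0 + (k `^ `|s| + k `^ (N - N0)) * C1 -> x `^ s * A <= c * T ->
    x `^ s * A <= (k `^ `|s| * C0 + (k `^ `|s| + k `^ (N - N0)) * C1) * T.
  by move=> h /le_trans; apply; exact: ler_wpM2r.
have p1 : 0 <= k `^ `|s| * C0 by rewrite mulr_ge0 ?powR_ge0.
have p2 : 0 <= k `^ `|s| * C1 by rewrite mulr_ge0 ?powR_ge0.
have p3 : 0 <= k `^ (N - N0) * C1 by rewrite mulr_ge0 ?powR_ge0.
have low : x `^ s <= k `^ `|s| * y `^ s -> x `^ s * A <= k `^ `|s| * C0 * T.
  move=> h; apply: le_trans (ler_pM (powR_ge0 _ _) A0 h A_low) _.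
  rewrite /T DD// le_eqVlt; apply/orP; left; apply/eqP.
  by move: (k `^ _) (y `^ s) (y `^ m) (z `^ _) => ? ? ? ?; ring.
have [s0|s0] := leP 0 s.
  rewrite (ger0_norm s0) in weak p1 p2 low *.
  have [zy|yz] := leP z y.
    apply: (weak (k `^ s * C0)); first by rewrite mulrDl; lra.
    rewrite (max_idPl zy) in xk; apply: low; apply: ler_powR_scaled => //; exact: ltW.
  rewrite (max_idPr (ltW yz)) in xk.
  apply: (weak (k `^ s * C1)); first by rewrite mulrDl; lra.
  have h : x `^ s <= k `^ s * z `^ s by apply: ler_powR_scaled => //; exact: ltW.
  apply: le_trans (ler_pM (powR_ge0 _ _) A0 h A_high) _.
  (* The factor [z^(- N0)] is kept for integrability. The remaining exponent is non-positive, so [z]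
     may be replaced there by the smaller [y]; the hypothesis on [e - N + N0 <= m] then closes the
     estimate. *)
  have E : z `^ s * z `^ (- N) = z `^ (- N0) * z `^ (s - N + N0).
    by rewrite -!DD//; congr (_ `^ _); ring.
  have h2 : z `^ (s - N + N0) <= y `^ (s - N + N0).
    have := @ler_powRN_scaled 1 (s - N + N0) y z.
    by rewrite powR1 !mul1r; apply => //; [lra|exact: ltW].
  have h3 : y `^ (s - N + N0) * y `^ e <= y `^ (s + m).
    by rewrite -DD//; apply: ler_powR => //; lra.
  have {h2}h3 : z `^ (s - N + N0) * y `^ e <= y `^ (s + m).
    by apply: le_trans h3; apply: ler_wpM2r => //; exact: powR_ge0.
  rewrite (_ : k `^ s * z `^ s * (C1 * z `^ (- N) * y `^ e) =
     k `^ s * C1 * ((z `^ s * z `^ (- N)) * y `^ e)); last first.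
    by move: (k `^ _) (y `^ _) (z `^ _) (z `^ (- N)) => ? ? ? ?; ring.
  rewrite E -mulrA -mulrA; rewrite -(mulrA (k `^ s)); apply: ler_wpM2l; first exact: powR_ge0.
  apply: ler_wpM2l => //; rewrite /T [leRHS]mulrC; apply: ler_wpM2l => //; exact: powR_ge0.
have sN : `|s| = - s by rewrite ltr0_norm.
rewrite sN in weak p1 p2 low *.
have [zx|xz] := leP z x.
  apply: (weak (k `^ (- s) * C0)); first by rewrite mulrDl; lra.
  by apply: low; apply: ler_powRN_scaled => //; [exact: ltW|rewrite (max_idPl zx) in yk].
rewrite (max_idPr (ltW xz)) in yk.
apply: (weak (k `^ (N - N0) * C1)); first by rewrite mulrDl; lra.
(* Nothing is gained from [x] for negative [s]; the missing power [y^s] is paid for by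
   [e - N + N0 <= s + m]. *)
have h : x `^ s <= 1 by rewrite -(powRr0 x); apply: ler_powR => //; exact: ltW.
apply: le_trans (ler_pM (powR_ge0 _ _) A0 h A_high) _.
rewrite mul1r.
have E : z `^ (- N) = z `^ (- N0) * z `^ (N0 - N).
  by rewrite -!DD//; congr (_ `^ _); ring.
have h2 : z `^ (N0 - N) <= k `^ (N - N0) * y `^ (N0 - N).
  have := @ler_powRN_scaled k (N0 - N) y z; rewrite opprB; apply => //.
  by rewrite subr_le0.
have h3 : y `^ (N0 - N) * y `^ e <= y `^ (s + m).
  by rewrite -DD//; apply: ler_powR => //; lra.
have {h2}h3 : z `^ (N0 - N) * y `^ e <= k `^ (N - N0) * y `^ (s + m).
  apply: (@le_trans _ _ (k `^ (N - N0) * y `^ (N0 - N) * y `^ e)).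
    by apply: ler_wpM2r => //; exact: powR_ge0.
  by rewrite -mulrA; apply: ler_wpM2l => //; exact: powR_ge0.
rewrite E.
apply: (@le_trans _ _ (C1 * z `^ (- N0) * (k `^ (N - N0) * y `^ (s + m)))).
  rewrite mulrA -(mulrA _ (z `^ _)); apply: ler_wpM2l => //.
  by rewrite mulr_ge0 ?powR_ge0.
rewrite /T le_eqVlt; apply/orP; left; apply/eqP.
by move: (k `^ _) (y `^ _) (z `^ _) => ? ? ?; ring.
Qed.

End scalar.

Lemma ler_seminorm (R : realType) (n : nat) al be (phi : schwartz R n) x :
  `|monom al x| * normc (cmderiv be phi x) <= seminorm al be phi.
Proof.
apply: ub_le_sup; last by exists x.
have [_ /(_ al be)[C HC]] := schwartzP phi.
by exists C => _ [y _ <-].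
Qed.

Lemma ler_sum_mem (R : realDomainType) (I : eqType) (L : seq I) (f : I -> R) (q : I) :
  (forall i, 0 <= f i) -> q \in L -> f q <= \sum_(i <- L) f i.
Proof.
move=> f0; elim: L => //= i L IH; rewrite inE big_cons => /predU1P[->|/IH h].
  by rewrite lerDl sumr_ge0.
by rewrite ler_wpDl.
Qed.

Section kernel.
Context (R : realType) (n : nat) (mu : 'I_n -> nat) (m delta kappa s e : R) (N0 N : nat).
Context (a : 'rV[R]_n -> 'rV[R]_n -> R[i]).
Hypothesis n0 : (0 < n)%N.
Hypothesis mu0 : forall j, (0 < mu j)%N.
Hypothesis ha : symbol_class mu m delta kappa a.
Hypothesis a_low : symbol_bound mu a N0 m.
Hypothesis a_high : symbol_bound mu a N e.
Hypothesis NN : (N0 <= N)%N.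
Hypothesis Ns : N0%:R + s <= N%:R.
Hypothesis em : e - N%:R + N0%:R <= m.
Hypothesis esm : e - N%:R + N0%:R <= s + m.
Hypothesis N0M : (n.+1 <= N0 * Mmin mu)%N.
Local Notation lam := (lebesgue_rV R n).
Local Notation B := (@Mbracket R n mu).
Implicit Types (x y z xi eta zeta : 'rV[R]_n) (phi : schwartz R n).

Lemma Mbracket_Wdecay : exists2 C : R, 0 <= C & forall z, B z `^ (- N0%:R) <= C * Wdecay z.
Proof.
have [C C0 HC] := @Pgrowth_Mbracket R n mu n0 mu0 N0 N0M.
exists C => // z; apply: le_trans (HC z).
by rewrite powRN powR_mulrn// ltW// Mbracket_gt0.
Qed.

Lemma symbol_kernel : exists2 C : R, 0 <= C & forall eta xi,
  B eta `^ s * normc (symbol_fourier a (eta - xi) xi) <=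
  C * (B xi `^ (s + m) * Wdecay (eta - xi)).
Proof.
have [C0 C00 H0] := symbol_fourier_le n0 ha a_low.
have [C1 C10 H1] := symbol_fourier_le n0 ha a_high.
have [CW CW0 HW] := Mbracket_Wdecay.
have [k k1 Hk] := @Mbracket_quasi_triangle R n mu.
(* The constant is doubled because [kernel_scalar] wants a maximum in place of the sum in the
   quasi-triangle inequality. *)
have k21 : 1 <= 2 * k by rewrite mulr_ege1// ler1n.
pose c := (2 * k) `^ `|s| * C0 + ((2 * k) `^ `|s| + (2 * k) `^ (N%:R - N0%:R)) * C1.
have c0 : 0 <= c by rewrite addr_ge0 ?mulr_ge0 ?addr_ge0 ?powR_ge0.
have maxle (u v : R) : k * (u + v) <= 2 * k * Num.max u v.
  rewrite (mulrC 2) -mulrA; apply: ler_wpM2l; first exact: le_trans ler01 k1.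
  by rewrite mulr_natl mulr2n; apply: lerD; rewrite le_max lexx ?orbT.
exists (c * CW) => [|eta xi]; first exact: mulr_ge0.
apply: (@le_trans _ _ (c * (B xi `^ (s + m) * B (eta - xi) `^ (- N0%:R)))); last first.
  rewrite -[leRHS]mulrA; apply: ler_wpM2l => //; rewrite mulrCA.
  by apply: ler_wpM2l; [exact: powR_ge0|exact: HW].
apply: (@kernel_scalar R (B eta) (B xi) (B (eta - xi)) (2 * k) _ C0 C1 s m e N%:R N0%:R);
  rewrite ?Mbracket_ge1 ?normc_ge0 ?ler_nat//.
- by apply: le_trans (maxle _ _); have := Hk xi (eta - xi); rewrite (addrC xi) subrK.
- apply: le_trans (maxle _ _); rewrite -(MbracketN mu (eta - xi)).
  by apply: le_trans (Hk _ _); rewrite opprB addrC subrK.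
Qed.

(** The function [A_phi] of the duality formula: at the frequency [- xi] the Fourier transform
    integrates against [exp(i x.xi)]. *)
Definition symbol_pairing phi xi : R[i] := fourier (fun x => a x xi * phi x) (- xi).

(** The growth [<xi>^e] of the symbol and the decay [<xi>^(- N)] of the transform concern the same
    variable, so their product is controlled by [e - N + N0 <= s + m]. The sum of seminorms, with a
    list independent of [xi], provides the continuity of [T u] on the Schwartz space. *)
Lemma symbol_pairing_le : exists2 C : R, 0 <= C &
  exists L : seq (('I_n -> nat) * ('I_n -> nat)), forall phi xi,
  normc (symbol_pairing phi xi) <=
  C * (\sum_(q <- L) seminorm q.1 q.2 phi) * (B xi `^ (s + m) * Wdecay xi).
Proof.
have [Ca Ca0 Ha] := a_high.
have [D D0 HD] := @fourier_decay R n mu n0 N.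
have [CW CW0 HW] := Mbracket_Wdecay.
pose S := (N * \sum_(j < n) mu j)%N.
have muS j : (N * mu j <= S)%N by rewrite leq_mul2l /S (bigD1 j)//= leq_addr orbT.
have [P2 P20 HP2] : exists2 P2 : R, 0 <= P2 & forall l, (l <= S)%N -> 2 ^+ l.+2 <= P2.
  by exists (2 ^+ S.+2) => [|l lS]; [exact: exprn_ge0|rewrite ler_weXn2l ?ler1n].
exists (D * (P2 * Ca) * CW); first exact: (mulr_ge0 (mulr_ge0 D0 (mulr_ge0 P20 Ca0)) CW0).
(* The derivatives that the Leibniz rule may put on [phi]: in one variable, of order at most [S],
   where [S] exceeds or equals every [N mu_j]. *)
exists [seq ((fun=> 0%N), mdelta q.2 q.1) |
  q <- [seq (j, l) | j <- enum 'I_n, l <- iota 0 S.+1]] => phi xi.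
set Sem := \sum_(q <- _) _.
have S0 : 0 <= Sem by apply: sumr_ge0 => q _; exact: seminorm_ge0.
have hphi j l x : (l <= S)%N -> normc (cmderiv (mdelta l j) phi x) <= Sem.
  move=> lS; apply: (@le_trans _ _ (seminorm (fun=> 0%N) (mdelta l j) phi)).
    by apply: le_trans (ler_seminorm (fun=> 0%N) (mdelta l j) phi x); rewrite monom0 normr1 mul1r.
  rewrite /Sem big_map.
  apply: (@ler_sum_mem R _ _ (fun q => seminorm (fun=> 0%N) (mdelta q.2 q.1) phi) (j, l)).
    by move=> q; exact: seminorm_ge0.
  by apply: allpairs_f; rewrite ?mem_enum// mem_iota.
have B0 := Mbracket_gt0 mu xi.
pose C := P2 * Ca * Sem * B xi `^ e.
have C0 : 0 <= C by rewrite !mulr_ge0 ?powR_ge0.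
have sm : csmooth (fun x => a x xi * phi x).
  by apply: csmoothM; [exact: csmooth_symbol ha xi|have [] := schwartzP phi].
have := HD _ C sm C0; rewrite /symbol_pairing => H.
apply: le_trans (H _ (- xi)) _.
  move=> j l x lN.
  have A0 : 0 <= Ca * B xi `^ e * Qdecay x by rewrite !mulr_ge0 ?powR_ge0 ?Qdecay_ge0.
  have := @cmderivM_le R n l j (a ^~ xi) phi x _ _ (csmooth_symbol ha xi) (schwartzP phi).1 A0 S0.
  move=> h; apply: le_trans (h _ _) _.
  - by move=> l' l'l; apply: Ha; exact: leq_trans lN.
  - by move=> l' l'l; apply: hphi; apply: leq_trans (muS j); exact: leq_trans lN.
  apply: (@le_trans _ _ (P2 * (Ca * B xi `^ e * Qdecay x * Sem))).
    apply: ler_wpM2r; first exact: mulr_ge0.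
    by apply: HP2; exact: leq_trans lN (muS j).
  rewrite /C le_eqVlt; apply/orP; left; apply/eqP.
  by move: (_ `^ _) (Qdecay _) => ? ?; ring.
rewrite MbracketN.
have h1 : B xi `^ e * B xi `^ (- N%:R) <= CW * (B xi `^ (s + m) * Wdecay xi).
  apply: (@le_trans _ _ (B xi `^ (s + m) * B xi `^ (- N0%:R))).
    rewrite -!powRD ?(gt_eqF B0) ?implybT//; apply: ler_powR; first exact: Mbracket_ge1.
    by move: esm; lra.
  by rewrite mulrCA; apply: ler_wpM2l; [exact: powR_ge0|exact: HW].
have h2 : 0 <= D * (P2 * Ca) * Sem by rewrite !mulr_ge0.
have := ler_wpM2l h2 h1; rewrite /C.
move: (B xi `^ e) (B xi `^ (- N%:R)) (B xi `^ (s + m)) (Wdecay xi) => u1 u2 u3 u5 h3.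
by apply: (le_trans _ (le_trans h3 _)); apply: eqW; ring.
Qed.

End kernel.

Lemma nat_above (R : realType) (r : R) : exists k : nat, r <= k%:R.
Proof.
exists (Num.trunc `|r|).+1; apply: le_trans (ler_norm r) _.
by have /andP[_ /ltW] := truncn_itv (normr_ge0 r).
Qed.

Section weight_measurability.
Context (R : realType) (n : nat) (mu : 'I_n -> nat).
Local Notation B := (@Mbracket R n mu).

Lemma measurable_Mbracket : measurable_fun setT B.
Proof.
rewrite (funext (@MbracketE R n mu)).
apply: (measurableT_comp (@measurable_sqrt R)).
apply: measurable_funD; first exact: measurable_cst.
apply: measurable_sum => j; do 2 apply: measurable_funX.
apply: (measurableT_comp (@normr_measurable R setT)); exact: measurable_rV_coord.
Qed.

Lemma measurable_MbracketR r : measurable_fun setT (fun z => B z `^ r).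
Proof. exact: (measurableT_comp (measurable_powR r) measurable_Mbracket). Qed.

Lemma schwartz_weight_decay (phi : schwartz R n) (r t : R) : exists2 C : R, 0 <= C &
  forall x, normc (phi x) * (B x `^ r * Pgrowth x `^ t) <= C * Qdecay x.
Proof.
have [K K1 [L HL]] := @Mbracket_le_Pgrowth R n mu.
have [k rk] := nat_above r; have [l tl] := nat_above t.
have [C C0 HC] := schwartz_Pdecay phi (L * k + l).
exists (K ^+ k * C) => [|x].
  by rewrite mulr_ge0// exprn_ge0// (le_trans ler01).
have B1 := Mbracket_ge1 mu x; have P1 := Pgrowth_ge1 x.
have h1 : B x `^ r <= K ^+ k * Pgrowth x ^+ (L * k).
  apply: (@le_trans _ _ (B x `^ k%:R)); first exact: ler_powR.
  rewrite powR_mulrn ?(le_trans ler01 B1)// exprM -exprMn.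
  by apply: lerXn2r; rewrite ?nnegrE ?(le_trans ler01 B1)// mulr_ge0 ?exprn_ge0 ?(le_trans ler01).
have h2 : Pgrowth x `^ t <= Pgrowth x ^+ l.
  by rewrite -powR_mulrn ?(le_trans ler01 P1)//; exact: ler_powR.
have h3 := ler_pM (powR_ge0 _ _) (powR_ge0 _ _) h1 h2.
apply: le_trans (ler_wpM2l (normc_ge0 _) h3) _.
have K0 : 0 <= K ^+ k by rewrite exprn_ge0// (le_trans ler01).
have := ler_wpM2l K0 (HC x); rewrite exprD.
move: (K ^+ k) (Pgrowth x ^+ (L * k)) (Pgrowth x ^+ l) (normc _) (Qdecay x) => u v w d q h.
by rewrite (_ : d * (u * v * w) = u * (v * w * d)) 1?(_ : u * C * q = u * (C * q))//; ring.
Qed.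

End weight_measurability.

(** * The operator on the Fourier side *)

Section schwartz_extra.
Context (R : realType) (n : nat).
Local Notation lam := (lebesgue_rV R n).
Implicit Types (phi chi : schwartz R n).

Lemma normc_schwartz_le phi x : normc (phi x) <= seminorm (fun=> 0%N) (fun=> 0%N) phi.
Proof.
apply: le_trans (ler_seminorm (fun=> 0%N) (fun=> 0%N) phi x).
by rewrite monom0 normr1 mul1r cmderiv0.
Qed.

Lemma schwartz_linE (c : R[i]) phi chi x : (c *: phi + chi) x = c * phi x + chi x.
Proof. by []. Qed.

Lemma cintegrable_Qdecay (f : 'rV[R]_n -> R[i]) C : cmeasurable f ->
  (forall x, normc (f x) <= C * Qdecay x) -> cintegrable f.
Proof.
move=> mf fC; apply: (@le_cintegrable _ _ _ (fun x => C * Qdecay x)) => //.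
  by apply: measurable_funM; [exact: measurable_cst|exact: measurable_Qdecay].
exact: (integral_fune_lt_pinfty measurableT (@integrable_Qdecay R n C)).
Qed.

Lemma cmeasurable_expi_dot d (T : measurableType d) (f g : T -> 'rV[R]_n) :
  measurable_fun setT f -> measurable_fun setT g ->
  cmeasurable (fun t => expi (- dot (f t) (g t))).
Proof.
move=> mf mg; apply: cmeasurable_expi.
by apply: (measurableT_comp (@oppr_measurable R setT)); exact: measurable_dot.
Qed.

Lemma cintegrable_expi_schwartz phi xi : cintegrable (fun x => expi (- dot x xi) * phi x).
Proof.
apply: (@le_cintegrable _ _ _ (fun x => normc (phi x))).
- apply: cmeasurableM; last exact: schwartz_cmeasurable.
  by apply: cmeasurable_expi_dot; [exact: measurable_id|exact: measurable_cst].
- by apply: cmeasurable_normc; exact: schwartz_cmeasurable.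
- by move=> x; rewrite normc_expiM.
- by have [] := schwartz_cintegrable phi.
Qed.

End schwartz_extra.

(** A tensor product majorant settles joint integrability and the integrability of all sections
    together; every exchange of integrals below has one. *)
Lemma cint_Fubini_dom (R : realType) (n p : nat) (f : 'rV[R]_n -> 'rV[R]_p -> R[i])
    (g : 'rV[R]_n -> R) (h : 'rV[R]_p -> R) :
  cmeasurable (fun z : 'rV[R]_n * 'rV[R]_p => f z.1 z.2) ->
  measurable_fun setT g -> measurable_fun setT h ->
  (forall x, 0 <= g x) -> (forall y, 0 <= h y) ->
  (\int[lebesgue_rV R n]_x (g x)%:E < +oo)%E ->
  (\int[lebesgue_rV R p]_y (h y)%:E < +oo)%E ->
  (forall x y, normc (f x y) <= g x * h y) ->
  cint (fun x => cint (f x)) = cint (fun y => cint (f ^~ y)).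
Proof.
move=> mf mg mh g0 h0 ig ih fgh.
have mfx x : cmeasurable (f x) by exact: (cmeasurable_comp mf (measurable_pair1 x)).
have mfy y : cmeasurable (f ^~ y) by exact: (cmeasurable_comp mf (measurable_pair2 y)).
apply: cint_Fubini => //.
- pose H := (\int[lebesgue_rV R p]_y (h y)%:E)%E.
  have H0 : (0 <= H)%E by apply: integral_ge0 => y _; rewrite lee_fin.
  have HE : H = (fine H)%:E by rewrite fineK// ge0_fin_numE.
  have fH0 : 0 <= fine H by exact: fine_ge0.
  apply: (@le_lt_trans _ _ (\int[lebesgue_rV R n]_x (fine H * g x)%:E)%E).
    apply: ge0_le_integral => //.
    + by move=> x _; apply: integral_ge0 => y _; rewrite lee_fin normc_ge0.
    + apply: (@measurable_Tonelli_rV _ _ _ _ (fun x y => (normc (f x y))%:E)).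
        by apply/measurable_EFinP; exact: cmeasurable_normc mf.
      by move=> x y; rewrite lee_fin normc_ge0.
    + by apply/measurable_EFinP; apply: measurable_funM => //; exact: measurable_cst.
    + move=> x _; rewrite mulrC EFinM -HE /H -integralZ_real//.
      apply: le_integral_real => //; first exact: cmeasurable_normc.
        by apply: measurable_funM => //; exact: measurable_cst.
      by move=> y; exact: normc_ge0.
  by rewrite integralZ_real// lte_mul_pinfty// lee_fin.
- by move=> x; have [] := cint_dominated (mfx x) mh h0 ih (g0 x) (fgh x).
- move=> y; have [|//] := cint_dominated (mfy y) mg g0 ig (h0 y).
  by move=> x; rewrite mulrC.
Qed.

Section schwartz_weight.
Context (R : realType) (n : nat) (mu : 'I_n -> nat).
Local Notation lam := (lebesgue_rV R n).
Local Notation B := (@Mbracket R n mu).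

Lemma measurable_PgrowthR t : measurable_fun setT (fun x : 'rV[R]_n => Pgrowth x `^ t).
Proof.
apply: (measurableT_comp (measurable_powR t)); apply: measurable_prod => i _.
apply: measurable_funD; first exact: measurable_cst.
by apply: (measurableT_comp (@normr_measurable R setT)); exact: measurable_rV_coord.
Qed.

Lemma measurable_schwartz_weight (phi : schwartz R n) r t :
  measurable_fun setT (fun x => normc (phi x) * (B x `^ r * Pgrowth x `^ t)).
Proof.
apply: measurable_funM; first by apply: cmeasurable_normc; exact: schwartz_cmeasurable.
by apply: measurable_funM; [exact: measurable_MbracketR|exact: measurable_PgrowthR].
Qed.

Lemma schwartz_weight_lty (phi : schwartz R n) r t :
  (\int[lam]_x (normc (phi x) * (B x `^ r * Pgrowth x `^ t))%:E < +oo)%E.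
Proof.
have [C C0 HC] := schwartz_weight_decay mu phi r t.
apply: le_lt_trans (integral_fune_lt_pinfty measurableT (@integrable_Qdecay R n C)).
apply: le_integral_real => //; first exact: measurable_schwartz_weight.
  by apply: measurable_funM; [exact: measurable_cst|exact: measurable_Qdecay].
by move=> x; rewrite !mulr_ge0 ?normc_ge0 ?powR_ge0.
Qed.

Lemma cintegrable_schwartz_weight (phi : schwartz R n) r t (f : 'rV[R]_n -> R[i]) C :
  cmeasurable f -> 0 <= C ->
  (forall x, normc (f x) <= C * (normc (phi x) * (B x `^ r * Pgrowth x `^ t))) ->
  cintegrable f.
Proof.
move=> mf C0 fC.
have w0 x : 0 <= normc (phi x) * (B x `^ r * Pgrowth x `^ t).
  by rewrite !mulr_ge0 ?normc_ge0 ?powR_ge0.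
have [//] := cint_dominated mf (measurable_schwartz_weight phi r t) w0
  (schwartz_weight_lty phi r t) C0 fC.
Qed.

Lemma schwartz_normc_lty (phi : schwartz R n) : (\int[lam]_x (normc (phi x))%:E < +oo)%E.
Proof. by have [] := schwartz_cintegrable phi. Qed.

End schwartz_weight.

Lemma mulr4_le (R : realDomainType) (p q r c w v : R) : 0 <= p -> 0 <= q ->
  r <= c * w * v -> p * (q * r) <= c * (p * v) * (q * w).
Proof.
move=> p0 q0 h; rewrite (_ : c * _ * _ = p * (q * (c * w * v))); last by ring.
by do 2 apply: ler_wpM2l => //.
Qed.

(** Allows the norm of FL^p_{s,M}, defined through a chosen representative of [u^], to be computed
    with an explicit one. *)
Lemma ae_eq_Lnorm d (T : measurableType d) (R : realType) (nu : {measure set T -> \bar R})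
    (p : \bar R) (f g : T -> \bar R) :
  measurable_fun setT f -> measurable_fun setT g ->
  {ae nu, forall x, f x = g x} -> 'N[nu]_p[f]%E = 'N[nu]_p[g]%E.
Proof.
move=> mf mg fg; rewrite unlock; case: p => [p| |].
- congr (_ `^ _)%E; apply: ae_eq_integral => //.
  + exact: (measurableT_comp (measurable_poweR p) (measurableT_comp (@abse_measurable R setT) mf)).
  + exact: (measurableT_comp (measurable_poweR p) (measurableT_comp (@abse_measurable R setT) mg)).
  + by apply: filterS fg => x -> _.
- case: ifP => // _; apply: eq_ess_sup.
  by apply: filterS fg => x /= ->.
- case: ifP => // _; apply: eq_ess_inf.
  by apply: filterS fg => x /= ->.
Qed.

Section operator.
Context (R : realType) (n : nat) (mu : 'I_n -> nat) (s m : R).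
Context (a : 'rV[R]_n -> 'rV[R]_n -> R[i]).
Local Notation lam := (lebesgue_rV R n).
Local Notation B := (@Mbracket R n mu).
Local Notation W := (@Wdecay R n).
Hypothesis n0 : (0 < n)%N.
Hypothesis ma : cmeasurable (fun z : 'rV[R]_n * 'rV[R]_n => a z.1 z.2).
Hypothesis a_le : exists2 C : R, 0 <= C &
  forall x xi, normc (a x xi) <= C * B xi `^ m * Qdecay x.
Hypothesis pairing_le : exists2 C : R, 0 <= C &
  exists L : seq (('I_n -> nat) * ('I_n -> nat)), forall phi xi,
  normc (symbol_pairing a phi xi) <=
  C * (\sum_(q <- L) seminorm q.1 q.2 phi) * (B xi `^ (s + m) * W xi).
Hypothesis kernel_le : exists2 C : R, 0 <= C & forall eta xi,
  B eta `^ s * normc (symbol_fourier a (eta - xi) xi) <=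
  C * (B xi `^ (s + m) * W (eta - xi)).
Implicit Types (U V : 'rV[R]_n -> R[i]) (f phi chi : schwartz R n) (x xi eta : 'rV[R]_n).
Local Notation sfk eta xi := (symbol_fourier a (eta - xi) xi).
Local Notation wt eta := (B eta `^ (- s) * Pgrowth eta `^ (tau R n)).

Let mfst := @measurable_fst _ _ 'rV[R]_n 'rV[R]_n.
Let msnd := @measurable_snd _ _ 'rV[R]_n 'rV[R]_n.
Let mswap := @measurable_swap _ _ 'rV[R]_n 'rV[R]_n.

(* The condition on u^ under which all the integrals below converge; it
   holds both on FL^p_{s+m,M}, for every p, and on S(R^n). *)
Definition admissible U := cmeasurable U /\
  (\int[lam]_xi (normc (U xi) * (B xi `^ (s + m) * W xi))%:E < +oo)%E.

Lemma cmeasurable_symbolr xi : cmeasurable (a ^~ xi).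
Proof. exact: (cmeasurable_comp ma (measurable_pair2 xi)). Qed.

Lemma cintegrable_pairing phi xi :
  cintegrable (fun x => expi (- dot x (- xi)) * (a x xi * phi x)).
Proof.
have [C C0 HC] := a_le.
apply: (@cintegrable_Qdecay _ _ _ (C * B xi `^ m * seminorm (fun=> 0%N) (fun=> 0%N) phi)).
  apply: cmeasurableM.
    by apply: cmeasurable_expi_dot; [exact: measurable_id|exact: measurable_cst].
  by apply: cmeasurableM; [exact: cmeasurable_symbolr|exact: schwartz_cmeasurable].
move=> x; rewrite normc_expiM normcM mulrAC.
by apply: ler_pM; rewrite ?normc_ge0//; exact: normc_schwartz_le.
Qed.

Lemma symbol_pairing_lin c phi chi xi : symbol_pairing a (c *: phi + chi) xi =
  c * symbol_pairing a phi xi + symbol_pairing a chi xi.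
Proof.
have i1 := cintegrable_pairing phi xi; have i2 := cintegrable_pairing chi xi.
rewrite /symbol_pairing /fourier -cintZ// -cintD//; last exact: cintegrableZ.
by apply: eq_cint => x; rewrite schwartz_linE; ring.
Qed.

Lemma cmeasurable_pairing phi : cmeasurable (symbol_pairing a phi).
Proof.
apply: (@cmeasurable_cint R n _ _ (fun xi x => expi (- dot x (- xi)) * (a x xi * phi x))).
apply: cmeasurableM.
  apply: (@cmeasurable_expi_dot R n _ ('rV[R]_n * 'rV[R]_n)%type (fun z => z.2) (fun z => - z.1)).
    exact: measurable_snd.
  by apply: measurable_rVN; exact: measurable_fst.
apply: cmeasurableM.
  exact: (cmeasurable_comp ma mswap).
exact: (cmeasurable_comp (schwartz_cmeasurable phi) msnd).
Qed.

Lemma measurable_admissible_weight U : cmeasurable U ->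
  measurable_fun setT (fun xi => normc (U xi) * (B xi `^ (s + m) * W xi)).
Proof.
move=> mU; apply: measurable_funM; first exact: cmeasurable_normc.
by apply: measurable_funM; [exact: measurable_MbracketR|exact: measurable_Wdecay].
Qed.

Lemma cint_admissible U : admissible U -> exists2 I : R, 0 <= I &
  forall (f : 'rV[R]_n -> R[i]) C, cmeasurable f -> 0 <= C ->
  (forall xi, normc (f xi) <= C * (normc (U xi) * (B xi `^ (s + m) * W xi))) ->
  cintegrable f /\ normc (cint f) <= 2 * (C * I).
Proof.
move=> [mU iU]; have w0 x : 0 <= normc (U x) * (B x `^ (s + m) * W x).
  by rewrite !mulr_ge0 ?normc_ge0 ?powR_ge0.
exists (fine (\int[lam]_xi (normc (U xi) * (B xi `^ (s + m) * W xi))%:E)).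
  by apply: fine_ge0; apply: integral_ge0 => x _; rewrite lee_fin.
by move=> f C mf; apply: cint_dominated => //; exact: measurable_admissible_weight.
Qed.

Lemma cint_operator U : admissible U -> exists (C : R) (L : seq (('I_n -> nat) * ('I_n -> nat))),
  forall phi, cintegrable (fun xi => U xi * symbol_pairing a phi xi) /\
    normc (cint (fun xi => U xi * symbol_pairing a phi xi)) <=
      C * \sum_(q <- L) seminorm q.1 q.2 phi.
Proof.
move=> aU; have [C C0 [L HL]] := pairing_le; have [I I0 HI] := cint_admissible aU.
exists (2 * (C * I)), L => phi; set S := \sum_(q <- L) _.
have S0 : 0 <= S by apply: sumr_ge0 => q _; exact: seminorm_ge0.
rewrite (_ : 2 * _ * S = 2 * (C * S * I)); last by ring.
apply: HI; [|exact: mulr_ge0|].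
  by apply: cmeasurableM; [exact: aU.1|exact: cmeasurable_pairing].
move=> xi; rewrite normcM mulrCA.
by apply: ler_wpM2l; [exact: normc_ge0|exact: HL].
Qed.

Lemma cintegrable_operator U phi : admissible U ->
  cintegrable (fun xi => U xi * symbol_pairing a phi xi).
Proof. by move=> /cint_operator[C [L /(_ phi)[]]]. Qed.

Definition cpi : R[i] := ((2 * pi) ^- n)%:C.

Definition operator_fun U phi : R[i] :=
  cpi * cint (fun xi => U xi * symbol_pairing a phi xi).

Lemma operator_fun_tempered U : admissible U -> is_tempered (operator_fun U).
Proof.
move=> aU; split.
  move=> c phi chi; rewrite /operator_fun.
  rewrite (@eq_cint _ _ _ (fun xi => c * (U xi * symbol_pairing a phi xi) +
    U xi * symbol_pairing a chi xi)); last first.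
    by move=> xi; rewrite symbol_pairing_lin; ring.
  rewrite cintD ?cintZ.
  - by rewrite mulrDr mulrCA.
  - exact: cintegrable_operator.
  - by apply: cintegrableZ; exact: cintegrable_operator.
  - exact: cintegrable_operator.
have [C [L HL]] := cint_operator aU.
exists (normc cpi * C), L => phi.
rewrite /operator_fun normcM -mulrA.
by apply: ler_wpM2l; [exact: normc_ge0|exact: (HL phi).2].
Qed.

Definition operator_ext (u : tempered R n) : tempered R n :=
  insubd (0 : tempered R n) (operator_fun (fourier_fun u)).

(** The pairing does not see null sets, so the representative chosen by [fourier_fun] may be
    exchanged for [V]; admissibility makes the functional tempered, so that [insubd] returns it and
    not the default. *)
Lemma operator_extE (u : tempered R n) V phi :
  is_function (tempered_fourier u) V -> admissible V ->
  operator_ext u phi = operator_fun V phi.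
Proof.
move=> uV aV; have uU := fourier_fun_unique uV.
have -> : operator_ext u = insubd (0 : tempered R n) (operator_fun V).
  rewrite /operator_ext; congr insubd; apply/funext => psi.
  rewrite /operator_fun; congr (_ * _); apply: ae_eq_cint.
  - apply: cmeasurableM; last exact: cmeasurable_pairing.
    by apply: is_function_cmeasurable; apply: fourier_funP; exists V; exact: uV.
  - by apply: cmeasurableM; [exact: aV.1|exact: cmeasurable_pairing].
  - by apply: filterS uU => x ->.
rewrite -[LHS]/(\val (insubd (0 : tempered R n) (operator_fun V)) phi) insubdK//.
by rewrite inE; exact: operator_fun_tempered.
Qed.

Lemma cmeasurable_kernel :
  cmeasurable (fun z : 'rV[R]_n * 'rV[R]_n => sfk z.1 z.2).
Proof.
apply: (@cmeasurable_cint R n _ ('rV[R]_n * 'rV[R]_n)%type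
  (fun z x => expi (- dot x (z.1 - z.2)) * a x z.2)).
have m1 : measurable_fun setT (fun w : 'rV[R]_n * 'rV[R]_n * 'rV[R]_n => w.1.1).
  exact: (measurableT_comp mfst measurable_fst).
have m2 : measurable_fun setT (fun w : 'rV[R]_n * 'rV[R]_n * 'rV[R]_n => w.1.2).
  exact: (measurableT_comp msnd measurable_fst).
have m3 : measurable_fun setT (fun w : 'rV[R]_n * 'rV[R]_n * 'rV[R]_n => w.2).
  exact: measurable_snd.
apply: cmeasurableM.
  apply: (@cmeasurable_expi_dot R n _ ('rV[R]_n * 'rV[R]_n * 'rV[R]_n)%type
    (fun w => w.2) (fun w => w.1.1 - w.1.2)) => //.
  by apply: measurable_rVD => //; exact: measurable_rVN.
apply: (cmeasurable_comp (h := fun w : 'rV[R]_n * 'rV[R]_n * 'rV[R]_n => (w.2, w.1.2)) ma).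
exact: measurable_fun_pair.
Qed.

(** Divides the kernel bound by [<eta>^s] and separates the variables with [WdecayB]. What remains
    in [xi] is the weight in [admissible]; what remains in [eta] grows at most polynomially. *)
Lemma kernel_tensor_le : exists2 C : R, 0 <= C & forall eta xi,
  normc (sfk eta xi) <= C * wt eta * (B xi `^ (s + m) * W xi).
Proof.
have [C C0 HC] := kernel_le; exists C => // eta xi.
have B0 := Mbracket_gt0 mu eta.
have h : B eta `^ s * normc (sfk eta xi) <=
    C * (B xi `^ (s + m) * (W xi * Pgrowth eta `^ tau R n)).
  apply: le_trans (HC eta xi) _; apply: ler_wpM2l => //.
  by apply: ler_wpM2l; [exact: powR_ge0|exact: WdecayB].
have E : B eta `^ (- s) * B eta `^ s = 1.
  by rewrite -powRD ?(gt_eqF B0) ?implybT// addNr powRr0.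
move: E h (powR_ge0 (B eta) (- s)) => E h b0.
have := ler_wpM2l b0 h; move: E {h b0}.
move: (B eta `^ (- s)) (B eta `^ s) (B xi `^ _) (Pgrowth _ `^ _) (W xi) (normc _).
move=> b b' v w z r E; rewrite (mulrA b b' r) E mul1r => /le_trans; apply.
by apply: eqW; ring.
Qed.

Lemma cpi_neq0 : cpi != 0.
Proof.
apply/eqP => /(congr1 (@complex.Re R))/= /eqP; rewrite invr_eq0 expf_eq0 mulf_eq0.
by rewrite pnatr_eq0 (gt_eqF (pi_gt0 R)) andbF.
Qed.

Definition transform U eta : R[i] := cpi * cint (fun xi => sfk eta xi * U xi).

Lemma cint_kernel U : admissible U -> exists2 C : R, 0 <= C & forall eta,
  cintegrable (fun xi => sfk eta xi * U xi) /\
  normc (cint (fun xi => sfk eta xi * U xi)) <= C * wt eta.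
Proof.
move=> aU; have [C C0 HC] := kernel_tensor_le; have [I I0 HI] := cint_admissible aU.
exists (2 * (C * I)) => [|eta]; first by rewrite !mulr_ge0.
have w0 : 0 <= wt eta by rewrite mulr_ge0 ?powR_ge0.
have := HI (fun xi => sfk eta xi * U xi) (C * wt eta).
rewrite (_ : 2 * (C * wt eta * I) = 2 * (C * I) * wt eta); last by move: (wt _) => ?; ring.
apply; [|exact: mulr_ge0|].
  apply: cmeasurableM; last exact: aU.1.
  exact: (cmeasurable_comp cmeasurable_kernel (measurable_pair1 eta)).
move=> xi; rewrite normcM mulrC [leRHS]mulrCA.
by apply: ler_wpM2l; [exact: normc_ge0|exact: HC].
Qed.

Lemma cintegrable_kernel U eta : admissible U -> cintegrable (fun xi => sfk eta xi * U xi).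
Proof. by move=> /cint_kernel[C _ /(_ eta)[]]. Qed.

Lemma cmeasurable_transform U : cmeasurable U -> cmeasurable (transform U).
Proof.
move=> mU; apply: cmeasurableM; first exact: cmeasurable_cst.
apply: (@cmeasurable_cint R n _ _ (fun eta xi => sfk eta xi * U xi)).
apply: cmeasurableM; first exact: cmeasurable_kernel.
exact: (cmeasurable_comp mU msnd).
Qed.

(** Insert the integral defining [phi^] and exchange: the phases combine to [exp(- i x.(eta - xi))].
    This is how the kernel appears on the Fourier side. *)
Lemma symbol_pairing_fourier phi xi :
  symbol_pairing a (schwartz_fourier phi) xi = cint (fun eta => phi eta * sfk eta xi).
Proof.
have [C C0 HC] := a_le.
rewrite /symbol_pairing /fourier schwartz_fourierE /fourier.
rewrite (@eq_cint _ _ _ (fun x => cint (fun eta => expi (- dot x (- xi)) * a x xi *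
    (expi (- dot eta x) * phi eta)))); last first.
  by move=> x; rewrite mulrA -cintZ//; exact: cintegrable_expi_schwartz.
rewrite (@cint_Fubini_dom R n n _ (fun x => C * B xi `^ m * Qdecay x) (fun eta => normc (phi eta))).
- apply: eq_cint => eta; rewrite /symbol_fourier /fourier -cintZ; last first.
    apply: (@cintegrable_Qdecay _ _ _ (C * B xi `^ m)).
      apply: cmeasurableM; last exact: cmeasurable_symbolr.
      by apply: cmeasurable_expi_dot; [exact: measurable_id|exact: measurable_cst].
    by move=> x; rewrite normc_expiM.
  apply: eq_cint => x.
  rewrite (_ : - dot x (eta - xi) = - dot x (- xi) + - dot eta x); last first.
    by rewrite dotBr dotNr (dotC eta x); ring.
  by rewrite expiD; ring.
- apply: cmeasurableM.
    apply: cmeasurableM.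
      apply: (@cmeasurable_expi_dot R n _ ('rV[R]_n * 'rV[R]_n)%type (fun z => z.1) (fun=> - xi)).
        exact: measurable_fst.
      exact: measurable_cst.
    exact: (cmeasurable_comp (cmeasurable_symbolr xi) mfst).
  apply: cmeasurableM.
    apply: (@cmeasurable_expi_dot R n _ ('rV[R]_n * 'rV[R]_n)%type (fun z => z.2) (fun z => z.1)).
      exact: measurable_snd.
    exact: measurable_fst.
  exact: (cmeasurable_comp (schwartz_cmeasurable phi) msnd).
- by apply: measurable_funM; [exact: measurable_cst|exact: measurable_Qdecay].
- by apply: cmeasurable_normc; exact: schwartz_cmeasurable.
- by move=> x; rewrite !mulr_ge0 ?powR_ge0 ?Qdecay_ge0.
- by move=> x; exact: normc_ge0.
- exact: (integral_fune_lt_pinfty measurableT (@integrable_Qdecay R n _)).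
- exact: schwartz_normc_lty.
- move=> x eta; rewrite -mulrA normc_expiM normcM normc_expiM.
  by apply: ler_wpM2r; [exact: normc_ge0|exact: HC].
Qed.

Lemma normc_transform_le U : admissible U ->
  exists2 C : R, 0 <= C & forall eta, normc (transform U eta) <= C * wt eta.
Proof.
move=> aU; have [C C0 HC] := cint_kernel aU.
exists (normc cpi * C) => [|eta]; first by rewrite mulr_ge0 ?normc_ge0.
rewrite /transform normcM -mulrA.
by apply: ler_wpM2l; [exact: normc_ge0|exact: (HC eta).2].
Qed.

(** The transform of [T u] acts on [phi] as [T u] acts on [phi^]. By [symbol_pairing_fourier] this
    is a double integral of [U(xi) phi(eta)] against the kernel, and exchanging the order exhibits
    [transform U]. *)
Lemma is_function_transform (u : tempered R n) U :
  is_function (tempered_fourier u) U -> admissible U ->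
  is_function (tempered_fourier (operator_ext u)) (transform U).
Proof.
move=> uU aU; have [mU iU] := aU.
have [mT1 mT2] := cmeasurable_transform mU.
split=> // phi.
have ig : cintegrable (fun eta => transform U eta * phi eta).
  have [C C0 HC] := normc_transform_le aU.
  apply: (cintegrable_schwartz_weight (phi := phi) _ C0).
    by apply: cmeasurableM; [split|exact: schwartz_cmeasurable].
  move=> eta; rewrite normcM mulrC [leRHS]mulrCA.
  by apply: ler_wpM2l; [exact: normc_ge0|exact: HC].
split; first exact: cintegrable_normc ig.
have [C C0 HC] := kernel_tensor_le.
rewrite /tempered_fourier (operator_extE _ uU aU) /operator_fun.
rewrite (@eq_cint _ _ _ (fun xi => cint (fun eta => U xi * (phi eta * sfk eta xi)))); last first.
  move=> xi; rewrite symbol_pairing_fourier -cintZ//.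
  have c0 : 0 <= C * (B xi `^ (s + m) * W xi) by rewrite !mulr_ge0 ?powR_ge0.
  apply: (cintegrable_schwartz_weight (phi := phi) _ c0).
    apply: cmeasurableM; first exact: schwartz_cmeasurable.
    exact: (cmeasurable_comp cmeasurable_kernel (measurable_pair2 xi)).
  move=> eta; rewrite normcM [leRHS]mulrCA.
  by apply: ler_wpM2l; [exact: normc_ge0|rewrite mulrAC; exact: HC].
rewrite (@cint_Fubini_dom R n n _
  (fun xi => C * (normc (U xi) * (B xi `^ (s + m) * W xi))) (fun eta => normc (phi eta) * wt eta)).
- rewrite (@eq_cint _ _ _ (fun eta => cpi^-1 * (transform U eta * phi eta))).
    by rewrite cintZ// mulrA mulfV ?cpi_neq0// mul1r.
  move=> eta; rewrite /transform -mulrA mulKf ?cpi_neq0// mulrC.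
  rewrite -cintZ; last exact: cintegrable_kernel.
  by apply: eq_cint => xi; ring.
- apply: cmeasurableM.
    exact: (cmeasurable_comp mU mfst).
  apply: cmeasurableM.
    exact: (cmeasurable_comp (schwartz_cmeasurable phi) msnd).
  exact: (cmeasurable_comp cmeasurable_kernel mswap).
- by apply: measurable_funM; [exact: measurable_cst|exact: measurable_admissible_weight].
- exact: measurable_schwartz_weight.
- by move=> x; rewrite !mulr_ge0 ?normc_ge0 ?powR_ge0 ?Wdecay_ge0.
- by move=> x; rewrite !mulr_ge0 ?normc_ge0 ?powR_ge0.
- rewrite integralZ_real//; first by rewrite lte_mul_pinfty ?lee_fin.
    exact: measurable_admissible_weight.
  by move=> x; rewrite !mulr_ge0 ?normc_ge0 ?powR_ge0.
- exact: schwartz_weight_lty.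
- move=> xi eta; rewrite !normcM.
  exact: (mulr4_le (normc_ge0 _) (normc_ge0 _) (HC eta xi)).
Qed.

(** Integrability of a complex function that is linear in [U], so that stability under linear
    combinations is inherited. *)
Lemma admissibleP U : admissible U <->
  cmeasurable U /\ cintegrable (fun xi => (B xi `^ (s + m) * W xi)%:C * U xi).
Proof.
have E xi : normc ((B xi `^ (s + m) * W xi)%:C * U xi) = normc (U xi) * (B xi `^ (s + m) * W xi).
  rewrite normcM mulrC; congr (_ * _).
  by rewrite /= expr0n/= addr0 sqrtr_sqr ger0_norm// mulr_ge0 ?powR_ge0.
split=> [[mU iU]|[mU [_ iU]]]; split=> //; last first.
  by under eq_integral do rewrite -E.
split; last by under eq_integral do rewrite E.
apply: cmeasurableM => //; split => /=; last exact: measurable_cst.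
by apply: measurable_funM; [exact: measurable_MbracketR|exact: measurable_Wdecay].
Qed.

Lemma admissible_lin c U V : admissible U -> admissible V ->
  admissible (fun xi => c * U xi + V xi).
Proof.
move=> /admissibleP[mU iU] /admissibleP[mV iV]; apply/admissibleP; split.
  by apply: cmeasurableD => //; apply: cmeasurableM => //; exact: cmeasurable_cst.
have := cintegrableD (cintegrableZ c iU) iV.
by congr cintegrable; apply/funext => xi; ring.
Qed.

Lemma operator_fun_lin c U V phi : admissible U -> admissible V ->
  operator_fun (fun xi => c * U xi + V xi) phi =
  c * operator_fun U phi + operator_fun V phi.
Proof.
move=> aU aV.
have i1 := cintegrable_operator phi aU.
have i2 := cintegrable_operator phi aV.
rewrite /operator_fun (@eq_cint _ _ _ (fun xi => c * (U xi * symbol_pairing a phi xi) +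
  V xi * symbol_pairing a phi xi)); last by move=> xi; ring.
by rewrite cintD ?cintZ//; [rewrite mulrDr mulrCA|exact: cintegrableZ].
Qed.

Let w (D : R) x y := D * W (x - y).

Let mw D : measurable_fun setT (fun z : 'rV[R]_n * 'rV[R]_n => w D z.1 z.2).
Proof.
apply: measurable_funM; first exact: measurable_cst.
apply: (measurableT_comp (@measurable_Wdecay R n)).
apply: measurable_rVD; first exact: measurable_fst.
by apply: measurable_rVN; exact: measurable_snd.
Qed.

Let w0 D x y : 0 <= D -> 0 <= w D x y.
Proof. by move=> D0; rewrite mulr_ge0// Wdecay_ge0. Qed.

Let wl D y : 0 <= D -> (\int[lam]_x (w D x y)%:E <= (D * cW R n)%:E)%E.
Proof.
move=> D0; rewrite /w integralZ_real//; last by move=> x; exact: Wdecay_ge0.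
  by rewrite EFinM; apply: lee_wpmul2l; [rewrite lee_fin|exact: integral_Wdecay_l].
apply: (measurableT_comp (@measurable_Wdecay R n)).
by apply: measurable_rVD; [exact: measurable_id|exact: measurable_cst].
Qed.

Let wr D x : 0 <= D -> (\int[lam]_y (w D x y)%:E <= (D * cW R n)%:E)%E.
Proof.
move=> D0; rewrite /w integralZ_real//; last by move=> y; exact: Wdecay_ge0.
  by rewrite EFinM; apply: lee_wpmul2l; [rewrite lee_fin|exact: integral_Wdecay_r].
apply: (measurableT_comp (@measurable_Wdecay R n)).
by apply: measurable_rVD; [exact: measurable_cst|apply: measurable_rVN; exact: measurable_id].
Qed.

Let cW_gt0 : 0 < cW R n.
Proof. by rewrite exprn_gt0// divr_gt0// subr_gt0 tau_gt1. Qed.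

Let measurable_weighted r U : cmeasurable U ->
  measurable_fun setT (fun xi => B xi `^ r * normc (U xi)).
Proof.
move=> mU; apply: measurable_funM; first exact: measurable_MbracketR.
exact: cmeasurable_normc.
Qed.

(** [schur_finite] for the convolution kernel [W(x - y)] at the single point [x = 0], [W] being
    even. *)
Lemma Lnorm_admissible (p : \bar R) U : (1 <= p)%E -> cmeasurable U ->
  ('N[lam]_p[EFin \o (fun xi => (B xi `^ (s + m) * normc (U xi))%R)] < +oo)%E ->
  admissible U.
Proof.
move=> p1 mU Up; split=> //.
have := @schur_finite R n (w 1) (1 * cW R n) _ (mw 1) _ _
  (fun xi => B xi `^ (s + m) * normc (U xi)) _ _ p 0 p1 _ Up.
move=> h; apply: le_lt_trans (h _ _ _ _ _ _).
- apply: eqW; apply: eq_integral => xi _.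
  by rewrite /w mul1r sub0r WdecayN; congr (_%:E); ring.
- by move=> x y; exact: w0.
- by move=> x; exact: wr.
- by rewrite mul1r.
- by move=> x; rewrite mulr_ge0 ?powR_ge0 ?normc_ge0.
- exact: measurable_weighted.
- by move=> y; rewrite /w mul1r; exact: Wdecay_le1.
Qed.

Lemma transform_bounded : exists2 D : R, 0 < D & forall (p : \bar R) U, (1 <= p)%E ->
  admissible U ->
  ('N[lam]_p[EFin \o (fun xi => (B xi `^ s * normc (transform U xi))%R)] <=
   D%:E * 'N[lam]_p[EFin \o (fun xi => (B xi `^ (s + m) * normc (U xi))%R)])%E.
Proof.
have [C C0 HC] := kernel_le.
have c0 := normc_ge0 cpi.
(* The 2 is that of [normc_cint_le]; the 1 makes the constant positive, as Schur's test requires. *)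
pose D := normc cpi * (2 * C) + 1.
have D0 : 0 < D by rewrite ltr_wpDl// !mulr_ge0.
exists (D * cW R n) => [|p U p1 aU]; first exact: mulr_gt0.
have [mU iU] := aU.
apply: (@schur_test R n (w D)) => //.
- by move=> x y; apply: w0; exact: ltW.
- by move=> y; apply: wl; exact: ltW.
- by move=> x; apply: wr; exact: ltW.
- exact: mulr_gt0.
- by move=> x; rewrite mulr_ge0 ?powR_ge0 ?normc_ge0.
- exact: measurable_weighted.
- by apply: measurable_weighted; exact: (cmeasurable_transform).
- by move=> x; rewrite mulr_ge0 ?powR_ge0 ?normc_ge0.
move=> eta.
have ik := cintegrable_kernel eta aU.
have h := normc_cint_le ik.
have mk : measurable_fun setT (fun xi => normc (sfk eta xi * U xi)).
  by apply: cmeasurable_normc; exact: ik.1.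
have b0 : 0 <= B eta `^ s * normc cpi by rewrite mulr_ge0 ?powR_ge0.
rewrite /transform normcM mulrA EFinM.
apply: le_trans (lee_wpmul2l _ h) _; first by rewrite lee_fin.
rewrite muleA -EFinM -integralZ_real//; [|by move=> x; exact: normc_ge0|exact: mulr_ge0].
apply: le_integral_real.
- by apply: measurable_funM => //; exact: measurable_cst.
- apply: measurable_funM; last exact: measurable_weighted.
  exact: (measurableT_comp (mw D) (measurable_pair1 eta)).
- by move=> xi; rewrite !mulr_ge0 ?normc_ge0 ?powR_ge0.
move=> xi; rewrite normcM /w.
have hk := HC eta xi; have k0 : 0 <= C * (B xi `^ (s + m) * W (eta - xi)).
  by rewrite !mulr_ge0 ?powR_ge0 ?Wdecay_ge0.
have W0 : 0 <= B xi `^ (s + m) * W (eta - xi) by rewrite mulr_ge0 ?powR_ge0 ?Wdecay_ge0.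
have U0 := normc_ge0 (U xi).
move: hk W0 c0 U0; rewrite /D.
move: (B eta `^ s) (normc (sfk _ _)) (B xi `^ _) (W _) (normc (U xi)) (normc cpi).
move=> e1 e2 e3 e4 e5 e6 hk W0 e60 e50.
rewrite (_ : e1 * e6 * 2 * (e2 * e5) = (e6 * 2 * e5) * (e1 * e2)); last by ring.
apply: (@le_trans _ _ ((e6 * 2 * e5) * (C * (e3 * e4)))).
  by apply: ler_wpM2l => //; rewrite !mulr_ge0.
have : 0 <= e3 * e4 * e5 by rewrite mulr_ge0.
rewrite (_ : (e6 * (2 * C) + 1) * e4 * (e3 * e5) =
  (e6 * 2 * e5) * (C * (e3 * e4)) + e3 * e4 * e5); last by ring.
by rewrite lerDl.
Qed.

(** The multiplication formula: the integrals of [f phi^] and of [f^ phi] agree by Fubini's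
    theorem. *)
Lemma is_function_tempered_fourier (u : tempered R n) f :
  is_function u f -> is_function (tempered_fourier u) (fourier f).
Proof.
move=> uf; rewrite -schwartz_fourierE; have [m1 m2] := schwartz_cmeasurable (schwartz_fourier f).
split=> // phi; split.
  apply: cintegrable_normc.
  have [g gE] : exists g : schwartz R n, g = schwartz_fourier f by exists (schwartz_fourier f).
  rewrite -gE.
  have mg := schwartz_cmeasurable g.
  have [|//] := cint_dominated (cmeasurableM mg (schwartz_cmeasurable phi)) (cmeasurable_normc mg)
    (fun x => normc_ge0 _) (schwartz_normc_lty g) (seminorm_ge0 (fun=> 0%N) (fun=> 0%N) phi).
  move=> x; rewrite normcM mulrC.
  by apply: ler_wpM2r; [exact: normc_ge0|exact: normc_schwartz_le].
rewrite /tempered_fourier (is_functionE _ uf) !schwartz_fourierE /fourier.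
have mf := schwartz_cmeasurable f; have mphi := schwartz_cmeasurable phi.
have ie (g : schwartz R n) xi := cintegrable_expi_schwartz g xi.
rewrite (@eq_cint _ _ _ (fun x => cint (fun y => f x * (expi (- dot y x) * phi y)))); last first.
  by move=> x; rewrite cintZ.
rewrite (@cint_Fubini_dom R n n _ (fun x => normc (f x)) (fun y => normc (phi y))).
- apply: eq_cint => y; rewrite mulrC -cintZ//; apply: eq_cint => x.
  by rewrite dotC; ring.
- apply: cmeasurableM; first exact: (cmeasurable_comp mf mfst).
  apply: cmeasurableM; last exact: (cmeasurable_comp mphi msnd).
  apply: (@cmeasurable_expi_dot R n _ ('rV[R]_n * 'rV[R]_n)%type (fun z => z.2) (fun z => z.1)).
    exact: measurable_snd.
  exact: measurable_fst.
- exact: cmeasurable_normc.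
- exact: cmeasurable_normc.
- by move=> x; exact: normc_ge0.
- by move=> x; exact: normc_ge0.
- exact: schwartz_normc_lty.
- exact: schwartz_normc_lty.
- by move=> x y; rewrite normcM normc_expiM.
Qed.

Lemma admissible_schwartz f : admissible f.
Proof.
split; first exact: schwartz_cmeasurable.
apply: le_lt_trans (schwartz_weight_lty mu f (s + m) 0).
apply: le_integral_real.
- by apply: measurable_admissible_weight; exact: schwartz_cmeasurable.
- exact: measurable_schwartz_weight.
- by move=> x; rewrite !mulr_ge0 ?normc_ge0 ?powR_ge0.
- move=> x; apply: ler_wpM2l; first exact: normc_ge0.
  apply: ler_wpM2l; first exact: powR_ge0.
  by rewrite powRr0; exact: Wdecay_le1.
Qed.

(** With [g = f^], the duality formula is a double integral of [g(xi) exp(i x.xi) a(x, xi) phi(x)].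
    Integrating first in [xi] gives the defining integral of [a(x, D) f]; the factor [Qdecay x] in
    the bound on [a] makes it integrable against [phi]. *)
Lemma is_function_psido (u : tempered R n) f :
  is_function u f -> is_function (operator_ext u) (psido a f).
Proof.
move=> uf; have uF := is_function_tempered_fourier uf.
have [g gE] : exists g : schwartz R n, g = fourier f :> ('rV[R]_n -> R[i]).
  by exists (schwartz_fourier f); rewrite schwartz_fourierE.
rewrite -gE in uF; have [C C0 HC] := a_le.
have mg := schwartz_cmeasurable g.
have pE x : psido a f x = cpi * cint (fun xi => expi (dot x xi) * a x xi * g xi).
  by rewrite /psido gE.
have bnd x xi : normc (expi (dot x xi) * a x xi * g xi) <=
    C * Qdecay x * (normc (g xi) * (B xi `^ m * Pgrowth xi `^ 0)).
  rewrite -mulrA normc_expiM normcM powRr0 mulr1.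
  apply: le_trans (ler_wpM2r (normc_ge0 _) (HC x xi)) _.
  by move: (B xi `^ _) (Qdecay _) (normc _) => ? ? ?; apply: eqW; ring.
have mk : cmeasurable (fun z : 'rV[R]_n * 'rV[R]_n => expi (dot z.1 z.2) * a z.1 z.2 * g z.2).
  apply: cmeasurableM; last exact: (cmeasurable_comp mg msnd).
  apply: cmeasurableM => //; apply: cmeasurable_expi.
  exact: (measurable_dot mfst msnd).
have wlty := schwartz_weight_lty mu g m 0.
have mwg := measurable_schwartz_weight mu g m 0.
have CQ0 x : 0 <= C * Qdecay x by rewrite mulr_ge0 ?Qdecay_ge0.
have wg0 xi : 0 <= normc (g xi) * (B xi `^ m * Pgrowth xi `^ 0).
  by rewrite !mulr_ge0 ?normc_ge0 ?powR_ge0.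
have ik x := cint_dominated (cmeasurable_comp mk (measurable_pair1 x)) mwg wg0 wlty (CQ0 x) (bnd x).
have mp : cmeasurable (psido a f).
  rewrite (funext pE); apply: cmeasurableM; first exact: cmeasurable_cst.
  exact: (cmeasurable_cint mk).
have [D HD] : exists D : R, forall x, normc (psido a f x) <= D * Qdecay x.
  set I := fine _ in ik; exists (normc cpi * (2 * (C * I))) => x.
  rewrite pE normcM -mulrA; apply: ler_wpM2l; first exact: normc_ge0.
  by apply: le_trans (ik x).2 _; apply: eqW; ring.
have [mp1 mp2] := mp.
split=> // phi.
set S := seminorm (fun=> 0%N) (fun=> 0%N) phi.
have S0 : 0 <= S by exact: seminorm_ge0.
have mphi := schwartz_cmeasurable phi.
have ip : cintegrable (fun x => psido a f x * phi x).
  apply: (@cintegrable_Qdecay _ _ _ (D * S)); first exact: cmeasurableM.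
  move=> x; rewrite normcM mulrAC.
  by apply: ler_pM; rewrite ?normc_ge0//; exact: normc_schwartz_le.
split; first exact: cintegrable_normc ip.
rewrite (operator_extE _ uF (admissible_schwartz g)) /operator_fun.
rewrite (@eq_cint _ _ _ (fun xi => cint (fun x =>
    g xi * (expi (- dot x (- xi)) * (a x xi * phi x))))); last first.
  by move=> xi; rewrite cintZ//; exact: cintegrable_pairing phi xi.
rewrite (@cint_Fubini_dom R n n _ (fun xi => normc (g xi) * (B xi `^ m * Pgrowth xi `^ 0))
  (fun x => C * S * Qdecay x)).
- rewrite (@eq_cint _ _ _ (fun x => cpi^-1 * (psido a f x * phi x))).
    by rewrite cintZ// mulrA mulfV ?cpi_neq0// mul1r.
  move=> x; rewrite pE -mulrA mulKf ?cpi_neq0// mulrC -cintZ; last exact: (ik x).1.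
  by apply: eq_cint => xi; rewrite dotNr opprK; ring.
- apply: cmeasurableM; first exact: (cmeasurable_comp mg mfst).
  apply: cmeasurableM.
    apply: (@cmeasurable_expi_dot R n _ ('rV[R]_n * 'rV[R]_n)%type (fun z => z.2) (fun z => - z.1)).
      exact: measurable_snd.
    by apply: measurable_rVN; exact: measurable_fst.
  apply: cmeasurableM; last exact: (cmeasurable_comp mphi msnd).
  exact: (cmeasurable_comp ma mswap).
- exact: mwg.
- by apply: measurable_funM; [exact: measurable_cst|exact: measurable_Qdecay].
- by move=> xi; rewrite !mulr_ge0 ?normc_ge0 ?powR_ge0.
- by move=> x; rewrite !mulr_ge0 ?Qdecay_ge0.
- exact: wlty.
- exact: (integral_fune_lt_pinfty measurableT (@integrable_Qdecay R n _)).
- move=> xi x; rewrite normcM normc_expiM normcM powRr0 mulr1.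
  have := ler_pM (normc_ge0 _) (normc_ge0 _) (HC x xi) (normc_schwartz_le phi x).
  move=> /(ler_wpM2l (normc_ge0 (g xi))) /le_trans; apply.
  rewrite -/S; move: (normc _) (B xi `^ _) (Qdecay _) => ? ? ?.
  by apply: eqW; ring.
Qed.

Lemma operator_extends (p : \bar R) : (1 <= p)%E ->
  extends_bounded mu (psido a) p (s + m) s.
Proof.
move=> p1; have [D D0 HD] := transform_bounded.
have FLadm (u : tempered R n) : FL mu p (s + m) u ->
    is_function (tempered_fourier u) (fourier_fun u) /\ admissible (fourier_fun u).
  move=> [/fourier_funP uU uF]; split=> //.
  by apply: (Lnorm_admissible p1) => //; exact: is_function_cmeasurable uU.
exists (operator_ext); split.
- move=> c u v /FLadm[uU aU] /FLadm[vV aV].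
  apply/val_inj/funext => phi.
  have uv : is_function (tempered_fourier (c *: u + v))
      (fun xi => c * fourier_fun u xi + fourier_fun v xi).
    exact: is_function_lin uU vV.
  rewrite -[LHS]/(operator_ext (c *: u + v) phi).
  rewrite (operator_extE phi uv (admissible_lin c aU aV)).
  rewrite operator_fun_lin//.
  rewrite -(operator_extE phi uU aU).
  by rewrite -(operator_extE phi vV aV).
- exists D => u uFL; have [uU aU] := FLadm u uFL.
  have Tu := is_function_transform uU aU.
  have bound : (FLnorm mu p s (operator_ext u) <= D%:E * FLnorm mu p (s + m) u)%E.
    rewrite /FLnorm (@ae_eq_Lnorm _ _ _ _ p _
      (EFin \o (fun xi => B xi `^ s * normc (transform (fourier_fun u) xi)))).
    + exact: HD.
    + apply/measurable_EFinP; apply: measurable_funM; first exact: measurable_MbracketR.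
      apply: cmeasurable_normc; apply: is_function_cmeasurable (fourier_funP _).
      by exists (transform (fourier_fun u)); exact: Tu.
    + apply/measurable_EFinP; apply: measurable_funM; first exact: measurable_MbracketR.
      by apply: cmeasurable_normc; exact: is_function_cmeasurable Tu.
    + by apply: filterS (fourier_fun_unique Tu) => xi /= ->.
  split=> //; split; first by exists (transform (fourier_fun u)).
  apply: le_lt_trans bound _; apply: lte_mul_pinfty; rewrite ?lee_fin ?(ltW D0)//.
  exact: uFL.2.
- by move=> f u; exact: is_function_psido.
Qed.

End operator.

(** * Choice of the orders [N0] and [N] *)

Lemma symbol_extends (R : realType) (n : nat) (mu : 'I_n -> nat)
    (m delta kappa s : R) (N0 N : nat) (a : 'rV[R]_n -> 'rV[R]_n -> R[i])
    (K : set 'rV[R]_n) (p : \bar R) :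
  (0 < n)%N -> (forall j, 0 < mu j)%N -> 0 <= delta <= 1 ->
  symbol_class mu m delta kappa a -> compact K ->
  (forall xi, closure [set x | a x xi != 0] `<=` K) ->
  N0%:R < kappa -> (n.+1 <= N0 * Mmin mu)%N ->
  kappa + 1 <= N%:R -> N0%:R + s <= N%:R ->
  delta * (N%:R - kappa) + N0%:R <= N%:R + Num.min s 0 ->
  (1 <= p)%E -> extends_bounded mu (psido a) p (s + m) s.
Proof.
move=> n0 mu0 d01 ha cK aK N0k N0M Nk Ns hN p1.
have a_low := symbol_bound_low mu0 ha cK aK N0k.
have a_high := symbol_bound_high mu0 d01 ha cK aK Nk.
have NN : (N0 <= N)%N by rewrite -(ler_nat R); lra.
(* The minimum unites the two exponent conditions below: one is needed for [s >= 0], the other for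
   [s < 0]. *)
have m1 : Num.min s 0 <= 0 by rewrite ge_min lexx orbT.
have m2 : Num.min s 0 <= s by rewrite ge_min lexx.
have em : (m + delta * (N%:R - kappa)) - N%:R + N0%:R <= m by lra.
have esm : (m + delta * (N%:R - kappa)) - N%:R + N0%:R <= s + m by lra.
apply: operator_extends => //.
- exact: cmeasurable_symbol ha.
(* The derivative of order 0, in any one variable, gives the bound on [a] itself. *)
- have [C C0 HC] := a_low; exists C => // x xi.
  have := HC (Ordinal n0) 0%N x xi isT.
  by rewrite cmderiv_mdeltaE/=; case: (a x xi).
- exact: (symbol_pairing_le n0 mu0 ha a_high esm N0M).
- exact: (symbol_kernel n0 mu0 ha a_low a_high NN Ns em esm N0M).
Qed.

Theorem theorem2p2 (R : realType) (n : nat) (mu : 'I_n -> nat)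
    (m delta kappa : R) (a : 'rV[R]_n -> 'rV[R]_n -> R[i])
    (K : set 'rV[R]_n) :
  (0 < n)%N ->
  (forall j, 0 < mu j)%N ->
  0 <= delta <= 1 ->
  (Num.floor (n%:R / (Mmin mu)%:R : R))%:~R + 1 < kappa ->
  symbol_class mu m delta kappa a ->
  compact K ->
  (forall xi, closure [set x | a x xi != 0] `<=` K) ->
  forall p : \bar R, (1 <= p)%E ->
  (delta < 1 -> forall s : R,
    extends_bounded mu (psido a) p (s + m) s) /\
  (delta = 1 -> forall s : R, 0 < s ->
    extends_bounded mu (psido a) p (s + m) s).
Proof.
move=> n0 mu0 d01 kappa_gt ha cK aK p p1.
have M0 : (0 < Mmin mu)%N := Mmin_gt0 n0 mu0.
(* The least integer with [N0 mu_* > n]; it equals [[n / mu_*] + 1], which is below [kappa] by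
   assumption. *)
pose N0 := (n %/ Mmin mu).+1.
have N0M : (n.+1 <= N0 * Mmin mu)%N by exact: ltn_ceil.
have N0k : N0%:R < kappa.
  apply: le_lt_trans kappa_gt; rewrite /N0 -natr1 lerD2r.
  rewrite -[leLHS]/((n %/ Mmin mu)%:Z%:~R) ler_int floor_ge_int.
  by rewrite ler_pdivlMr ?ltr0n// -natrM ler_nat leq_trunc_div.
have /andP[d0 d1] := d01.
split=> [dlt1 s|dE s s0].
  (* Solves [delta (N - kappa) + N0 <= N - |s|] for [N], which is possible as [1 - delta > 0]; and
     [- |s| <= min(s, 0)]. *)
  pose q := (N0%:R + `|s| - delta * kappa) / (1 - delta).
  have [N HN] := nat_above (`|kappa| + 1 + N0%:R + `|s| + `|q|).
  have k1 := ler_norm kappa; have s1 := ler_norm s; have q1 := ler_norm q.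
  have k2 := normr_ge0 kappa; have s2 := normr_ge0 s; have q2 := normr_ge0 q.
  have N00 : 0 <= N0%:R :> R by [].
  apply: (symbol_extends n0 mu0 d01 ha cK aK N0k N0M (N := N)) => //; [lra|lra|].
  have : N0%:R + `|s| - delta * kappa <= N%:R * (1 - delta).
    by rewrite -ler_pdivrMr ?subr_gt0//; rewrite -/q; lra.
  have : - `|s| <= Num.min s 0.
    by rewrite le_min oppr_le0 s2 andbT lerNl -normrN; exact: ler_norm.
  rewrite !mulrBr mulr1 (mulrC N%:R); move: (delta * N%:R) (delta * kappa) => ? ?; lra.
have [N HN] := nat_above (`|kappa| + 1 + N0%:R + s).
have k1 := ler_norm kappa; have k2 := normr_ge0 kappa.
have N00 : 0 <= N0%:R :> R by [].
apply: (symbol_extends n0 mu0 d01 ha cK aK N0k N0M (N := N)) => //; [lra|lra|].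
(* For [delta = 1] the order [N] cancels and the condition reduces to [N0 <= kappa]. *)
rewrite dE mul1r (_ : Num.min s 0 = 0); first lra.
by apply/min_idPr; exact: ltW.
Qed.
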